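(* Let $A,B\subseteq\mathbb{R}^d$ be measurable sets with finite measure. If $f:[0,1]\to\mathbb{C}$ is continuous at $1$ and satisfies $|f(\theta)|\le C\theta$ for all $\theta\in[0,1]$, for some $C>0$, then $$\operatorname{Tr}f(S_{cA,B})=c^d|A||B|f(1)+o(c^d)\quad\text{as }c\to\infty.$$
   Context: The Fourier transform on $L^2(\mathbb{R}^d)$ is $\mathcal{F}f(\xi)=\int_{\mathbb{R}^d}e^{-2\pi i x\cdot\xi}f(x)\,dx$. For a measurable set $A\subset\mathbb{R}^d$, $|A|$ is its Lebesgue measure, $P_A$ is multiplication by the indicator $1_A$ and $Q_A=\mathcal{F}^{-1}P_A\mathcal{F}$. For measurable $A,B\subset\mathbb{R}^d$ of finite measure, $S_{A,B}=P_AQ_BP_A$ is a non-negative self-adjoint trace class operator on $L^2(\mathbb{R}^d)$ with norm at most $1$; $\lambda_1(A,B)\ge\lambda_2(A,B)\ge\dots\ge0$ are its eigenvalues with multiplicity. $cA=\{cx:x\in A\}$. For $f:[0,1]\to\mathbb{C}$ with $f(0)=0$, $f(S_{A,B})$ is defined spectrally, and $\operatorname{Tr}f(S_{A,B})=\sum_nf(\lambda_n(A,B))$ when this converges absolutely. *)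

(* Defs.v *)
From HB Require Import structures.
From mathcomp Require Import all_boot all_order all_algebra.
From mathcomp Require Import all_classical all_reals all_analysis.
From mathcomp Require Import complex.

Set Implicit Arguments.
Unset Strict Implicit.
Unset Printing Implicit Defensive.
Import Order.TTheory GRing.Theory Num.Theory.
Import numFieldNormedType.Exports.

Local Open Scope classical_set_scope.
Local Open Scope ring_scope.
Local Open Scope complex_scope.

Notation normc := ComplexField.Normc.normc.

Section borel_lebesgue.
Context {R : realType}.
Notation mR := (measurableTypeR R).

Definition cons_pair d (p : mR * d.-tuple mR) : d.+1.-tuple mR :=
  [the d.+1.-tuple mR of p.1 :: p.2].

Definition uncons d (t : d.+1.-tuple mR) : mR * d.-tuple mR :=
  (thead t, [tuple of behead t]).

Lemma cons_pairK d : cancel (@cons_pair d) (@uncons d).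
Proof. by case=> x t; congr pair; apply/val_inj. Qed.

Lemma measurable_cons_pair d :
  measurable_fun [set: mR * d.-tuple mR] (@cons_pair d).
Proof. exact: measurable_cons. Qed.

Lemma measurable_uncons d : measurable_fun [set: d.+1.-tuple mR] (@uncons d).
Proof.
apply/measurable_fun_pairP; split; first exact: measurable_tnth.
exact: measurable_behead.
Qed.

Section cons_measure.
Variables (d : nat) (m : {sigma_finite_measure set (d.-tuple mR) -> \bar R}).

Definition cons_measure : set (d.+1.-tuple mR) -> \bar R :=
  pushforward (@lebesgue_measure R \x m)%E (@cons_pair d).

Let cm0 : cons_measure set0 = 0%E.
Proof. by rewrite /cons_measure /pushforward preimage_set0 measure0. Qed.

Let cm_ge0 A : (0 <= cons_measure A)%E.
Proof. by rewrite /cons_measure /pushforward measure_ge0. Qed.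

Let cm_additive : semi_sigma_additive cons_measure.
Proof.
move=> F mF tF _; rewrite /cons_measure /pushforward preimage_bigcup.
have mF' n : measurable (@cons_pair d @^-1` F n).
  by rewrite -[X in measurable X]setTI; exact: measurable_cons_pair.
apply: measure_semi_sigma_additive => //; last exact: bigcup_measurable.
apply/trivIsetP => /= i j _ _ ij; rewrite -preimage_setI.
by move/trivIsetP : tF => /(_ _ _ _ _ ij) ->//; rewrite preimage_set0.
Qed.

HB.instance Definition _ :=
  isMeasure.Build _ _ _ cons_measure cm0 cm_ge0 cm_additive.

Let cm_sigma_finite : sigma_finite setT cons_measure.
Proof.
have /sigma_finiteP[F [TF ndF Foo]] := sigma_finiteT (@lebesgue_measure R).
have /sigma_finiteP[G [TG ndG Goo]] := sigma_finiteT m.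
exists (fun k => @uncons d @^-1` (F k `*` G k)).
  rewrite -preimage_bigcup -[LHS](preimage_setT (@uncons d)) -setXTT TF TG.
  congr (_ @^-1` _); rewrite predeqE => -[x y].
  split => [[/= [n _ Fnx] [k _ Gky]]|[n _ []]].
    exists (maxn n k) => //; split.
    - by move: x Fnx; exact/subsetPset/ndF/leq_maxl.
    - by move: y Gky; exact/subsetPset/ndG/leq_maxr.
  by move=> Fnx Gny; split; exists n.
move=> k; have [mF Fk] := Foo k; have [mG Gk] := Goo k.
have mFG : measurable (F k `*` G k) by exact: measurableX.
split; first by rewrite -[X in measurable X]setTI; exact: measurable_uncons.
rewrite /cons_measure /pushforward -comp_preimage.
rewrite (_ : @uncons d \o @cons_pair d = id); last first.
  by apply/funext => p; rewrite /= cons_pairK.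
by rewrite preimage_id product_measure1E// lte_mul_pinfty// ge0_fin_numE.
Qed.

HB.instance Definition _ :=
  Measure_isSigmaFinite.Build _ _ _ cons_measure cm_sigma_finite.

End cons_measure.

(* Lebesgue measure on the Borel sets of R^d = d.-tuple R, as an iterated product
   along (x, y) |-> x :: y. *)
Fixpoint borel_lebesgue d : {sigma_finite_measure set (d.-tuple mR) -> \bar R} :=
  match d with
  | 0 => [the {sigma_finite_measure set _ -> \bar R} of
           \d_([tuple] : 0.-tuple mR)]
  | d'.+1 => [the {sigma_finite_measure set _ -> \bar R} of
           cons_measure (borel_lebesgue d')]
  end.

End borel_lebesgue.


Section space.
Context {R : realType}.

(* R^d with the sigma-algebra of all Lebesgue measurable sets (the completion
   of the Borel sigma-algebra), and its complete Lebesgue measure. *)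
Definition Rd (d : nat) : measurableType _ :=
  caratheodory_type (@borel_lebesgue R d)^*%mu.

Definition leb d : {measure set (Rd d) -> \bar R} :=
  [the {measure set _ -> \bar R} of
    @completed_measure_extension _ _ R (@borel_lebesgue R d)].

Variable d : nat.
Implicit Types (x y xi : Rd d) (A B : set (Rd d)) (g : Rd d -> R[i]).

Definition coord x (i : 'I_d) : R := tnth (x : d.-tuple R) i.

Definition dot x y : R := \sum_(i < d) coord x i * coord y i.

Definition scale (c : R) x : Rd d := [tuple c * coord x i | i < d].

(* c A *)
Definition dilate (c : R) A : set (Rd d) := scale c @` A.

Definition cexpi (t : R) : R[i] := cos t +i* sin t.

Definition cintegral g : R[i] :=
  (\int[leb d]_x complex.Re (g x)) +i* (\int[leb d]_x complex.Im (g x)).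

Definition fourier g xi : R[i] :=
  cintegral (fun x => cexpi (- (2 * pi * dot x xi)) * g x).

Definition inv_fourier g x : R[i] :=
  cintegral (fun xi => cexpi (2 * pi * dot x xi) * g xi).

Definition proj A g x : R[i] := (\1_A x)%:C * g x.

(* Q_B = F^-1 P_B F *)
Definition band_proj B g : Rd d -> R[i] := inv_fourier (proj B (fourier g)).

(* S_{A,B} = P_A Q_B P_A.  When A and B have finite measure and g is in L^2, the
   functions P_A g and P_B F P_A g to which the two transforms are applied are in
   L^1 as well as in L^2, so that the integrals converge absolutely and are the
   Fourier transforms in the L^2 sense. *)
Definition concentration A B g : Rd d -> R[i] := proj A (band_proj B (proj A g)).

Definition L2 g : Prop :=
  [/\ measurable_fun setT (fun x => complex.Re (g x)),
      measurable_fun setT (fun x => complex.Im (g x)) &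
      (\int[leb d]_x ((normc (g x)) ^+ 2)%:E < +oo)%E].

Implicit Types T : (Rd d -> R[i]) -> (Rd d -> R[i]).

Definition eigenfunction T (mu : R) g : Prop :=
  L2 g /\ {ae leb d, forall x, T g x = mu%:C * g x}.

(* linear independence in L^2, that is, modulo a.e. equality *)
Definition independent k (e : 'I_k -> Rd d -> R[i]) : Prop :=
  forall a : 'I_k -> R[i],
    {ae leb d, forall x, \sum_(i < k) a i * e i x = 0} -> forall i, a i = 0.

(* the eigenspace ker (T - mu) has dimension at least k *)
Definition multiplicity_ge T (mu : R) (k : nat) : Prop :=
  exists e : 'I_k -> Rd d -> R[i],
    (forall i, eigenfunction T mu (e i)) /\ independent e.

(* lambda lists the positive eigenvalues of T in nonincreasing order, each
   repeated according to its multiplicity, and is continued by zeros if there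
   are finitely many of them. *)
Definition eigenvalue_seq T (lambda : nat -> R) : Prop :=
  [/\ forall n, 0 <= lambda n, nonincreasing_seq lambda &
      forall (mu : R) (k : nat), 0 < mu ->
        multiplicity_ge T mu k <-> (`I_k #<= [set n | lambda n = mu])%card].

(* There is at most one eigenvalue_seq; for a non-negative compact operator, in
   particular for S_{A,B}, it exists and the default value is not used. *)
Definition eigenvalues T : nat -> R :=
  xget (fun=> 0) [set l | eigenvalue_seq T l].

Definition abs_summable (u : nat -> R[i]) : Prop :=
  cvgn (series (fun n => normc (u n))).

Definition cseries (u : nat -> R[i]) : R[i] :=
  limn (series (fun n => complex.Re (u n))) +i* limn (series (fun n => complex.Im (u n))).

(* Tr f(T), for f(0) = 0.  Only the values of f on the spectrum of T matter. *)
Definition trace_fun (f : R -> R[i]) T : R[i] :=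
  cseries (fun n => f (eigenvalues T n)).

End space.

(* Main.v *)
(* Restricted to A, the operator S = S_{A,B} is V^* V with V u = 1_B F(1_A u), so
   it is positive, its norm is at most 1 by Bessel's inequality for the Fourier
   transform, and it is compact, being an integral operator with bounded kernel
   on a set of finite measure.  Hence it has a sequence of eigenvalues l_n in
   [0, 1].  Write m = c^d |A| |B| for S = S_{cA,B}.
   Two trace estimates suffice.  Integrating the kernel of S on the diagonal gives
   sum l_n <= m.  The Hilbert-Schmidt norm gives
   sum l_n^2 = int_{cA x cA} |F 1_B (x - y)|^2 >= m - o(c^d), because after
   rescaling c^d |F 1_B (c t)|^2 concentrates at 0 with total mass |B|
   (Plancherel for 1_B, approached by damping with the transform of the Poisson
   kernel, which is itself an approximate identity).  That approximate identities
   do not see the boundary of A is checked on half-spaces; the Borel sets with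
   this property form a sigma-algebra.
   Hence sum l_n = m + o(c^d) and sum l_n (1 - l_n) = o(c^d).  Finally, continuity
   of f at 1 and |f(t)| <= C t give, for every e > 0, a constant K_e with
   |f(t) - t f(1)| <= e t + K_e t (1 - t) on [0, 1]. *)
Require Import Defs.
From HB Require Import structures.
From mathcomp Require Import all_boot all_order all_algebra.
From mathcomp Require Import all_classical all_reals all_analysis.
From mathcomp Require Import complex.
From mathcomp Require Import measurable_realfun.
From mathcomp Require Import ring lra zify.
Set Implicit Arguments.
Unset Strict Implicit.
Unset Printing Implicit Defensive.
Import Order.TTheory GRing.Theory Num.Theory.
Import numFieldNormedType.Exports.
Local Open Scope classical_set_scope.
Local Open Scope ring_scope.
Local Open Scope complex_scope.

(** * Moduli, real and imaginary parts of complex numbers *)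

Section complex_facts.
Context {R : realType}.
Implicit Types z w : R[i].

(** Three constraints shape the development. Eigenfunctions are functions satisfying an equation
    almost everywhere, and the operator is given by pointwise integrals; so vectors are functions,
    the inner product is only semi-definite, and the spectral theorem is proved for operators that
    send null vectors to 0 and for which limits exist merely along images. Plancherel enters only
    with an integrable weight on the frequency side, where it is Fubini's theorem. The weight is the
    product of exp(-2 pi e |xi_i|): the transform of each factor follows from an explicit primitive,
    and everything factors over the coordinates. Letting the weight increase to 1 gives Bessel's
    inequality on sets of finite measure; keeping it gives a lower bound for the mass of |F 1_B|^2.
    The series of l_n^2 is never summed. For each n the kernel energy is at most l_n m + sum_(i < n)
    l_i^2, and the first term tends to 0. Compactness and both upper trace estimates hold for every
    unimodular kernel and are proved in that generality; the norm bound 1 and the lower bound of the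
    energy are special to the Fourier kernel. *)

Lemma sqr_normcE z : normc z ^+ 2 = complex.Re z ^+ 2 + complex.Im z ^+ 2.
Proof. by case: z => a b /=; rewrite sqr_sqrtr// addr_ge0// sqr_ge0. Qed.

Lemma normc_ge0 z : 0 <= normc z.
Proof. by case: z => a b /=; exact: sqrtr_ge0. Qed.

Lemma normc_real (r : R) : normc r%:C = `|r|.
Proof. by rewrite /= expr0n addr0 sqrtr_sqr. Qed.

Lemma normc_conjc z : normc (conjc z) = normc z.
Proof. by case: z => a b /=; rewrite sqrrN. Qed.

Lemma mul_conjc z : z * conjc z = (normc z ^+ 2)%:C.
Proof.
by rewrite sqr_normcE; case: z => a b; apply/eqP; rewrite eq_complex /=;
  apply/andP; split; apply/eqP; ring.
Qed.

Lemma ReD z w : complex.Re (z + w) = complex.Re z + complex.Re w.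
Proof. by case: z w => a b [c d]. Qed.

Lemma ImD z w : complex.Im (z + w) = complex.Im z + complex.Im w.
Proof. by case: z w => a b [c d]. Qed.

Lemma ReN z : complex.Re (- z) = - complex.Re z.
Proof. by case: z => a b. Qed.

Lemma ImN z : complex.Im (- z) = - complex.Im z.
Proof. by case: z => a b. Qed.

Lemma ReZ (r : R) z : complex.Re (r%:C * z) = r * complex.Re z.
Proof. by case: z => a b /=; rewrite mul0r subr0. Qed.

Lemma ReJ z : complex.Re (conjc z) = complex.Re z.
Proof. by case: z. Qed.

Lemma conjcZ (r : R) z : conjc (r%:C * z) = r%:C * conjc z.
Proof.
by case: z => a b; apply/eqP; rewrite eq_complex /=; apply/andP; split; apply/eqP; ring.
Qed.

Lemma normr_Re z : `|complex.Re z| <= normc z.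
Proof.
rewrite -(ler_pXn2r (_ : 0 < 2)%N) ?nnegrE ?normc_ge0//.
by rewrite sqr_normcE real_normK ?num_real// lerDl sqr_ge0.
Qed.

Lemma normr_Im z : `|complex.Im z| <= normc z.
Proof.
rewrite -(ler_pXn2r (_ : 0 < 2)%N) ?nnegrE ?normc_ge0//.
by rewrite sqr_normcE real_normK ?num_real// lerDr sqr_ge0.
Qed.

Lemma complex_ge0 z : 0 <= z -> z = (complex.Re z)%:C /\ 0 <= complex.Re z.
Proof. by case: z => a b; rewrite lecE /= => /andP[/eqP -> ?]. Qed.

End complex_facts.

(** * Semi-inner products and compact positive operators *)

Section semi_inner_product.
Variables (R : realType) (V : lmodType R[i]) (ip : V -> V -> R[i]).

(** Definiteness is left out: the vectors will be square integrable functions rather than classes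
    modulo a.e. equality. In the order of [R[i]], [0 <= ip u u] also says that [ip u u] is real. *)
Definition semi_inner := [/\
  forall a u v w, ip (a *: u + v) w = a * ip u w + ip v w,
  forall u v, ip v u = conjc (ip u v) &
  forall u, 0 <= ip u u].

Definition nm2 u : R := complex.Re (ip u u).

Hypothesis ipP : semi_inner.

Lemma ipC u v : ip v u = conjc (ip u v). Proof. by case: ipP. Qed.

Lemma ipDl u v w : ip (u + v) w = ip u w + ip v w.
Proof. by case: ipP => /(_ 1 u v w); rewrite scale1r mul1r. Qed.

Lemma ip0l w : ip 0 w = 0.
Proof. by apply: (addIr (ip 0 w)); rewrite -ipDl !add0r. Qed.

Lemma ipZl a u w : ip (a *: u) w = a * ip u w.
Proof. by case: ipP => /(_ a u 0 w); rewrite addr0 ip0l addr0. Qed.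

Lemma ipNl u w : ip (- u) w = - ip u w.
Proof. by rewrite -scaleN1r ipZl mulN1r. Qed.

Lemma ipBl u v w : ip (u - v) w = ip u w - ip v w.
Proof. by rewrite ipDl ipNl. Qed.

Lemma ip_suml I (r : seq I) (P : pred I) (F : I -> V) w :
  ip (\sum_(i <- r | P i) F i) w = \sum_(i <- r | P i) ip (F i) w.
Proof. by elim/big_rec2: _ => [|i y1 y2 _ <-]; rewrite ?ip0l// ipDl. Qed.

Lemma ipDr u v w : ip w (u + v) = ip w u + ip w v.
Proof. by rewrite ipC ipDl raddfD /= -!ipC. Qed.

Lemma ipZr a u w : ip w (a *: u) = conjc a * ip w u.
Proof. by rewrite ipC ipZl rmorphM /= -ipC. Qed.

Lemma ip0r w : ip w 0 = 0. Proof. by rewrite ipC ip0l conjc0. Qed.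

Lemma ipNr u w : ip w (- u) = - ip w u.
Proof. by rewrite ipC ipNl raddfN /= -ipC. Qed.

Lemma ipBr u v w : ip w (u - v) = ip w u - ip w v.
Proof. by rewrite ipDr ipNr. Qed.

Lemma ip_sumr I (r : seq I) (P : pred I) (F : I -> V) w :
  ip w (\sum_(i <- r | P i) F i) = \sum_(i <- r | P i) ip w (F i).
Proof. by elim/big_rec2: _ => [|i y1 y2 _ <-]; rewrite ?ip0r// ipDr. Qed.

Lemma ipuuE u : ip u u = (nm2 u)%:C.
Proof. by case: ipP => _ _ /(_ u) /complex_ge0[]. Qed.

Lemma nm2_ge0 u : 0 <= nm2 u.
Proof. by case: ipP => _ _ /(_ u) /complex_ge0[]. Qed.

Lemma nm2D u v : nm2 (u + v) = nm2 u + nm2 v + 2 * complex.Re (ip u v).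
Proof. by rewrite /nm2 ipDl !ipDr !ReD (ipC u v) ReJ; ring. Qed.

Lemma nm2N u : nm2 (- u) = nm2 u.
Proof. by rewrite /nm2 ipNl ipNr opprK. Qed.

Lemma nm2B u v : nm2 (u - v) = nm2 u + nm2 v - 2 * complex.Re (ip u v).
Proof. by rewrite nm2D nm2N ipNr ReN; ring. Qed.

Lemma nm2_0 : nm2 0 = 0. Proof. by rewrite /nm2 ip0l. Qed.

Lemma nm2Z a u : nm2 (a *: u) = normc a ^+ 2 * nm2 u.
Proof. by rewrite {1}/nm2 ipZl ipZr mulrA mul_conjc ReZ. Qed.

Lemma le_nm2D u v : nm2 (u + v) <= 2 * nm2 u + 2 * nm2 v.
Proof.
have := nm2_ge0 (u - v); rewrite nm2B nm2D => h.
by rewrite -subr_ge0; apply: le_trans h _; lra.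
Qed.

Lemma cauchy_schwarz u v : normc (ip u v) ^+ 2 <= nm2 u * nm2 v.
Proof.
set c := normc _ ^+ 2.
(* The squared seminorm of [u - t <u, v> v] as a polynomial in a real parameter t, which the two
   cases below choose. *)
have H t : 0 <= nm2 u - 2 * t * c + t ^+ 2 * c * nm2 v.
  have := nm2_ge0 (u - (t%:C * ip u v) *: v).
  rewrite nm2B nm2Z ipZr ComplexField.Normc.normcM normc_real exprMn real_normK ?num_real// -/c.
  rewrite conjcZ -mulrA (mulrC (conjc _)) mul_conjc ReZ /= -/c.
  by move/le_trans; apply; rewrite le_eqVlt; apply/orP; left; apply/eqP; ring.
have c0 : 0 <= c by exact: sqr_ge0.
have [v0|v0] := ltP 0 (nm2 v).
  have := H (nm2 v)^-1; rewrite -(ler_pM2r v0) mul0r => /le_trans => /(_ (nm2 u * nm2 v - c)).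
  rewrite subr_ge0; apply; rewrite le_eqVlt; apply/orP; left; apply/eqP.
  by field; exact: lt0r_neq0.
have {}v0 : nm2 v = 0 by apply/eqP; rewrite eq_le v0 nm2_ge0.
rewrite v0 mulr0 leNgt; apply/negP => cp.
(* When [nm2 v = 0], the expression in [H] is affine in t with slope [-2 c], and this t gives it the
   value -1. *)
have := H ((nm2 u + 1) / (2 * c)); rewrite v0 mulr0 addr0.
rewrite (_ : 2 * _ * c = nm2 u + 1); last by field; exact: lt0r_neq0.
by lra.
Qed.

Lemma ip_null u v : nm2 u = 0 -> ip u v = 0.
Proof.
move=> u0; apply: ComplexField.Normc.eq0_normc; apply/eqP; rewrite -sqrf_eq0 eq_le sqr_ge0 andbT.
by rewrite (le_trans (cauchy_schwarz _ _))// u0 mul0r.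
Qed.

Lemma nm2_null_eq u v : nm2 (u - v) = 0 -> nm2 u = nm2 v.
Proof.
move=> uv; rewrite -[u](subrK v) nm2D uv ip_null// add0r mulr0.
by rewrite addr0.
Qed.

Lemma Re_ip_le u v : complex.Re (ip u v) ^+ 2 <= nm2 u * nm2 v.
Proof.
apply: le_trans (cauchy_schwarz u v); rewrite sqr_normcE lerDl.
exact: sqr_ge0.
Qed.

(* Completeness and compactness are only needed for the images under T. *)
Definition compact_positive (T : V -> V) := [/\
  (forall a u v, T (a *: u + v) = a *: T u + T v) /\
  (forall u v, ip (T u) v = ip u (T v)),
  (forall u, 0 <= complex.Re (ip (T u) u)) /\
  (forall u, nm2 u = 0 -> T u = 0),
  exists M, forall u, nm2 (T u) <= M * nm2 u,
  forall u : nat -> V,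
    (forall e, 0 < e -> exists n0, forall i j, (n0 <= i)%N -> (n0 <= j)%N ->
       nm2 (u i - u j) <= e) ->
    exists v, nm2 (T (u n) - v) @[n --> \oo] --> (0 : R) &
  forall w : nat -> V, (forall n, nm2 (w n) <= 1) ->
    (forall v, normc (ip (w n) v) @[n --> \oo] --> (0 : R)) ->
    nm2 (T (w n)) @[n --> \oo] --> (0 : R)].

End semi_inner_product.

(** * Spectral theorem for compact positive operators, by deflation *)

Section top_eigenvector.
Variables (R : realType) (V : lmodType R[i]) (ip : V -> V -> R[i]).
Hypothesis ipP : semi_inner ip.
Local Notation N := (nm2 ip).

Section iterates.
Variable T : V -> V.
Hypothesis Tlin : forall a u v, T (a *: u + v) = a *: T u + T v.
Hypothesis Tsym : forall u v, ip (T u) v = ip u (T v).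

Lemma opD u v : T (u + v) = T u + T v.
Proof. by rewrite -{1}[u]scale1r Tlin scale1r. Qed.

Lemma op0 : T 0 = 0.
Proof. by apply: (addIr (T 0)); rewrite -opD !add0r. Qed.

Lemma opZ a u : T (a *: u) = a *: T u.
Proof. by rewrite -[a *: u]addr0 Tlin op0 addr0. Qed.

Lemma opN u : T (- u) = - T u.
Proof. by rewrite -scaleN1r opZ scaleN1r. Qed.

Lemma opB u v : T (u - v) = T u - T v.
Proof. by rewrite opD opN. Qed.

Lemma iter_sym k u v : ip (iter k T u) v = ip u (iter k T v).
Proof. by elim: k u v => //= k IH u v; rewrite Tsym IH -iterSr. Qed.

Lemma ip_iter2 i j u : ip (iter (i + i) T u) (iter (j + j) T u)
  = (N (iter (i + j) T u))%:C.
Proof.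
rewrite -ipuuE// iter_sym -iterD iter_sym -iterD.
by congr (ip _ (iter _ _ _)); lia.
Qed.

(** The sequence N(T^k f) is log-convex: N(T^(j+1) f) = <T^j f, T^(j+2) f> by symmetry, and
    Cauchy-Schwarz applies. So its successive ratios do not decrease, and the first one is at least
    m r because [N f <= 1]. *)
Lemma nm2_iter_ge (m r : R) f k : 0 < m -> 0 < r -> r <= N f <= 1 ->
  m * r <= N (T f) ->
  (m * r) ^+ k * r <= N (iter k T f) /\ m * r * N (iter k T f) <= N (iter k.+1 T f).
Proof.
move=> m0 r0 /andP[rf f1] hf; have mr0 : 0 < m * r by exact: mulr_gt0.
have step j : 0 < N (iter j T f) /\ m * r * N (iter j T f) <= N (iter j.+1 T f).
  elim: j => [|j [pj IH]].
    split; last by rewrite /= (le_trans _ hf)// ler_piMr// ltW.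
    exact: lt_le_trans rf.
  have p1 : 0 < N (iter j.+1 T f) by apply: lt_le_trans IH; exact: mulr_gt0.
  split => //.
  have := cauchy_schwarz ipP (iter j T f) (iter j.+2 T f).
  rewrite [iter j.+2 _ _]/= -Tsym -/(iter j.+1 T f) ipuuE// normc_real.
  rewrite ger0_norm ?nm2_ge0// => h.
  rewrite -(ler_pM2l pj); apply: le_trans h.
  by rewrite mulrA (mulrC _ (m * r)) expr2 ler_pM2r.
split; last by case: (step k).
elim: k => [|k IH]; first by rewrite expr0 mul1r.
by rewrite exprS -mulrA (le_trans _ (step k).2)// ler_pM2l.
Qed.

End iterates.

Lemma bernoulli_ineq (x : R) n : 0 <= x <= 1 -> 1 - n%:R * x <= (1 - x) ^+ n.
Proof.
move=> /andP[x0 x1]; elim: n => [|n IH]; first by rewrite mul0r subr0 expr0.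
have h : 0 <= (1 - x) * ((1 - x) ^+ n - (1 - n%:R * x)).
  by rewrite mulr_ge0 ?subr_ge0.
have h2 : 0 <= n%:R * x ^+ 2 by rewrite mulr_ge0// sqr_ge0.
by rewrite exprS -subr_ge0 (le_trans (addr_ge0 h h2))// -natr1 le_eqVlt; apply/orP; left; apply/eqP; ring.
Qed.

Lemma cvg0_le (u v : nat -> R) : (forall n, 0 <= u n <= v n) ->
  v n @[n --> \oo] --> (0 : R) -> u n @[n --> \oo] --> (0 : R).
Proof.
move=> uv v0; apply: (@squeeze_cvgr _ _ _ _ (fun=> 0) v) => //.
- by near=> n; exact: uv.
- exact: cvg_cst.
Unshelve. all: by end_near. Qed.

Lemma cvgZ0 (k : R) (u : nat -> R) :
  u n @[n --> \oo] --> (0 : R) -> k * u n @[n --> \oo] --> (0 : R).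
Proof. by move=> u0; rewrite -[X in _ --> X](mulr0 k); exact: cvgMr. Qed.

Lemma const_cvg0 (k : R) : (fun _ : nat => k) @ \oo --> (0 : R) -> k = 0.
Proof.
move=> h; apply: (@cvg_unique _ (@Rhausdorff R) _ _ _ _ _ h); exact: cvg_cst.
Qed.

(* A positive compact operator has its squared norm [m] as the square of an
   eigenvalue.  If the powers of T / sqrt m do not tend strongly to 0, they
   converge along some orbit (their norms decrease), and the limit is an
   eigenvector.  Otherwise images of near-maximizers under growing powers are
   weakly null, which contradicts compactness. *)
Lemma top_eigenvector_of_norm T (m : R) : compact_positive ip T -> 0 < m ->
  (forall u, N (T u) <= m * N u) ->
  (forall r, r < 1 -> exists u, N u <= 1 /\ m * r <= N (T u)) ->
  exists e, N e = 1 /\ T e = (Num.sqrt m)%:C *: e.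
Proof.
move=> [[Tlin Tsym] [Tpos Tnull] _ TCS TCC] m0 Tm Tsup.
have mu0 : 0 < Num.sqrt m by rewrite sqrtr_gt0.
set mu := Num.sqrt m in mu0 *.
have mmu : m = mu ^+ 2 by rewrite sqr_sqrtr// ltW.
(* The squared norms along the orbit of [u] under the contraction T / sqrt m. *)
pose t u k := N (iter k T u) / m ^+ k.
have t_ge0 u k : 0 <= t u k by rewrite divr_ge0 ?nm2_ge0// exprn_ge0// ltW.
have t_noninc u : nonincreasing_seq (t u).
  apply/nonincreasing_seqP => k; rewrite /t /= exprS invfM mulrA.
  rewrite ler_pM2r ?invr_gt0 ?exprn_gt0// ler_pdivrMr// mulrC; exact: Tm.
have t_cvg u : cvgn (t u).
  apply: nonincreasing_is_cvgn => //; exists 0 => _ [k _ <-]; exact: t_ge0.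
have [[u tu]|Hno] := pselect (exists u, 0 < limn (t u)); last first.
  exfalso.
  have t0 u : t u n @[n --> \oo] --> (0 : R).
    suff <- : limn (t u) = 0 by exact: t_cvg.
    apply/eqP; rewrite eq_le limr_ge ?andbT//; last by near=> n; exact: t_ge0.
    by rewrite leNgt; apply/negP => h; apply: Hno; exists u.
  have /choice[f Hf] : forall j, exists f, N f <= 1 /\
      m ^+ j / 2 <= N (iter j T f) /\ m / 2 * N (iter j T f) <= N (iter j.+1 T f).
    (* The defect of the near-maximizer is tuned to the power: by Bernoulli's inequality
       [r ^+ j.+1 >= 1/2], so j applications of T lose at most half of the maximal growth. *)
    move=> j; pose x : R := (2 * j.+1%:R)^-1; pose r := 1 - x.
    have jp : 0 < 2 * j.+1%:R :> R by rewrite mulr_gt0.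
    have x0 : 0 < x by rewrite invr_gt0.
    have x1 : x <= 2^-1.
      by rewrite /x invfM ler_piMr// invf_le1// ler1n.
    have r1 : r < 1 by rewrite /r; lra.
    have r2 : 2^-1 <= r by rewrite /r; lra.
    have rr : 2^-1 <= r ^+ j.+1.
      have := @bernoulli_ineq x j.+1; rewrite -/r => H.
      apply: le_trans (H _); last by rewrite ltW//=; lra.
      rewrite /x invfM mulrCA divff ?mulr1//; lra.
    have [f [f1 hf]] := Tsup r r1.
    have rf : r <= N f.
      by rewrite -(ler_pM2l m0) (le_trans hf).
    have r0 : 0 < r by apply: lt_le_trans r2; rewrite invr_gt0.
    have := @nm2_iter_ge T Tsym m r f j m0 r0; rewrite rf f1 => /(_ isT hf)[h1 h2].
    exists f; split => //; split.
      apply: le_trans h1; rewrite exprMn -mulrA ler_pM2l ?exprn_gt0//.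
      by rewrite -exprSr.
    by apply: le_trans h2; rewrite ler_wpM2r ?nm2_ge0// ler_pM2l.
  pose w j := (mu ^- j)%:C *: iter j T (f j).
  have Nw j : N (w j) = t (f j) j.
    rewrite /w nm2Z// normc_real ger0_norm ?invr_ge0 ?exprn_ge0 ?(ltW mu0)//.
    by rewrite /t mulrC mmu -!exprM exprVn -exprM mulnC.
  have w1 j : N (w j) <= 1.
    rewrite Nw; apply: (@le_trans _ _ (t (f j) 0%N)); first exact: t_noninc.
    by rewrite /t expr0 divr1; case: (Hf j).
  (* Moving the powers of T onto [v] bounds the squared inner product by [N (f n) * t v n], hence by
     [t v n]. *)
  have wnull v : normc (ip (w n) v) @[n --> \oo] --> (0 : R).
    have : Num.sqrt (t v n) @[n --> \oo] --> (0 : R).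
      by rewrite -[X in _ --> X]sqrtr0; apply: continuous_cvg => //; exact: sqrt_continuous.
    apply: cvg0_le => j; rewrite normc_ge0/=.
    rewrite -(ger0_norm (normc_ge0 _)) -sqrtr_sqr ler_wsqrtr//.
    rewrite /w ipZl// ComplexField.Normc.normcM exprMn normc_real.
    rewrite iter_sym//; apply: le_trans (ler_wpM2l _ (cauchy_schwarz ipP _ _)) _.
      exact: sqr_ge0.
    rewrite real_normK ?num_real// /t mmu -exprM exprVn -exprM mulnC.
    rewrite (mulrC _ (_^-1)) ler_wpM2l ?invr_ge0 ?exprn_ge0 ?(ltW mu0)//.
    by rewrite ler_piMl ?nm2_ge0//; case: (Hf j).
  have := TCC w w1 wnull => /cvgrPdist_lt /(_ (m / 4)).
  have m4 : 0 < m / 4 by rewrite divr_gt0.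
  move=> /(_ m4) [n0 _ /(_ n0)] /(_ (leqnn _)) /=.
  rewrite sub0r normrN ger0_norm ?nm2_ge0//; apply/negP; rewrite -leNgt.
  rewrite /w opZ// nm2Z// normc_real real_normK ?num_real//.
  have [_ [h1 h2]] := Hf n0.
  rewrite -exprVn -exprM mulnC exprM exprVn -mmu exprVn.
  rewrite (mulrC (m ^- n0)) ler_pdivlMr ?exprn_gt0//.
  apply: le_trans h2; apply: le_trans (ler_wpM2l _ h1); last by rewrite divr_ge0 ?(ltW m0).
  by rewrite le_eqVlt; apply/orP; left; apply/eqP; field.
(* Only even powers: by [ip_iter2] the inner products of the [v j] are then values of [t u], so
   convergence of [t u] makes [v] a Cauchy sequence. *)
pose v j := (m ^- j)%:C *: iter (j + j) T u.
have vS n : m%:C *: v n.+1 = T (T (v n)).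
  rewrite /v !(opZ Tlin) scalerA addSn addnS iterS iterS; congr (_ *: _).
  by apply/eqP; rewrite eq_complex /= exprS invfM; apply/andP; split; apply/eqP;
    field; rewrite expf_neq0 ?lt0r_neq0.
have NB i j : N (v i - v j) = t u (i + i)%N + t u (j + j)%N - 2 * t u (i + j)%N.
  have mn0 : m != 0 by exact: lt0r_neq0.
  rewrite nm2B// !nm2Z// ipZl// ipZr// ip_iter2// !normc_real !real_normK ?num_real//.
  rewrite /= /t oppr0 !mulr0 !mul0r !subr0 !exprD.
  by field; rewrite !expf_neq0.
have /TCS[w vw] : forall e, 0 < e -> exists n0, forall i j, (n0 <= i)%N -> (n0 <= j)%N ->
       N (v i - v j) <= e.
  move=> e e0; have e4 : 0 < e / 4 by rewrite divr_gt0.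
  have /cvgrPdist_lt/(_ _ e4)[n0 _ Hn0] := t_cvg u.
  exists n0 => i j hi hj; rewrite NB.
  have := Hn0 (i + i)%N; have := Hn0 (j + j)%N; have := Hn0 (i + j)%N => /=.
  move=> /(_ (leq_trans hi (leq_addr _ _))) + /(_ (leq_trans hj (leq_addr _ _))) + /(_ (leq_trans hi (leq_addr _ _))).
  rewrite !ltr_norml => /andP[a1 a2] /andP[b1 b2] /andP[c1 c2]; lra.
have tj j : N (T (v j)) = m * t u (j + j).+1.
  rewrite opZ// nm2Z// normc_real real_normK ?num_real// /t (exprS m) exprD -/(iter (j + j).+1 T u).
  by field; rewrite !expf_neq0 ?lt0r_neq0.
(* Otherwise N(T v_j) = m t_u(2j + 1) would tend to 0, although it never falls below m times the
   positive limit of [t u]. *)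
have Nw : 0 < N w.
  rewrite lt_neqAle nm2_ge0// andbT; apply/eqP => w0.
  have : (fun j => 2 * N (T (v j) - w)) @ \oo --> (0 : R) by exact: cvgZ0.
  move=> /(cvg0_le (u := fun=> m * limn (t u))) => /(_ _)/const_cvg0.
  have H (n:nat) : 0 <= m * limn (t u) <= 2 * N (T (v n) - w).
    rewrite mulr_ge0 ?(ltW m0) ?(ltW tu)//=.
    have := le_nm2D ipP (T (v n) - w) w; rewrite subrK -w0 mulr0 addr0.
    apply: le_trans; rewrite tj ler_pM2l//; exact: nonincreasing_cvgn_ge.
  by move=> /(_ H)/eqP; rewrite mulf_eq0 !gt_eqF.
(* By [vS], T^2 maps v_n to m v_(n+1); applying T and passing to the limit of the T v_n gives T^2 w
   = m w up to a null vector. *)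
have TT : N (T (T w) - m%:C *: w) = 0.
  apply: const_cvg0.
  apply: (@cvg0_le _ (fun j => (2 * m ^+ 2 ) * N (T (v j) - w) + (2 * m ^+ 2) * N (T (v j.+1) - w))).
    move=> n; rewrite nm2_ge0//=.
    have -> : T (T w) - m%:C *: w = - T (T (T (v n) - w)) + m%:C *: (T (v n.+1) - w).
      rewrite !(opB Tlin) scalerBr opprB -addrA; congr (_ + _).
      by rewrite -(opZ Tlin) vS addrA addNr add0r.
    apply: le_trans (le_nm2D ipP _ _) _; rewrite nm2N// nm2Z// normc_real.
    rewrite real_normK ?num_real// mulrA lerD2r -mulrA ler_wpM2l//.
    by rewrite (le_trans (Tm _))// expr2 -mulrA ler_pM2l.
  rewrite -[X in _ --> X]addr0; apply: cvgD; apply: cvgZ0 => //.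
  by rewrite (cvg_shiftS (fun j => N (T (v j) - w))).
(* T^2 - m factors as (T + mu)(T - mu), and positivity of T makes T + mu injective modulo null
   vectors. *)
have h0 : N (T w - mu%:C *: w) = 0.
  set h := T w - _.
  have hh : T h + mu%:C *: h = T (T w) - m%:C *: w.
    rewrite /h (opB Tlin) (opZ Tlin) scalerBr scalerA -rmorphM /= -expr2 -mmu.
    by rewrite addrA subrK.
  have : complex.Re (ip (T h + mu%:C *: h) h) = 0 by rewrite hh ip_null.
  rewrite ipDl// ReD ipZl// ReZ => /eqP.
  rewrite paddr_eq0 ?Tpos// ?mulr_ge0 ?(ltW mu0) ?nm2_ge0//.
  by move=> /andP[_]; rewrite mulf_eq0 gt_eqF//= => /eqP.
(* T sends null vectors to 0, so one more application turns the relation modulo null vectors into an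
   equality; the eigenvector is T w, not w. *)
have ew : T (T w) = mu%:C *: T w.
  by apply/eqP; rewrite -subr_eq0 -opZ// -opB// (Tnull _ h0).
have NTw : 0 < N (T w).
  rewrite (nm2_null_eq ipP h0) nm2Z// normc_real.
  by rewrite real_normK ?num_real// mulr_gt0// exprn_gt0.
exists ((Num.sqrt (N (T w)))^-1%:C *: T w); split.
  rewrite nm2Z// normc_real ger0_norm ?invr_ge0 ?sqrtr_ge0//.
  by rewrite exprVn sqr_sqrtr ?(ltW NTw)// mulVf// lt0r_neq0.
by rewrite opZ// ew !scalerA mulrC.
Unshelve. all: by end_near. Qed.

(** The first component is the operator norm, the root of the supremum of N(T u) over the unit ball.
    The pair (0, 0) is the answer when the norm vanishes: deflation then never stops, and the
    eigenvalues get continued by zeros. *)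
Lemma top_eigenvector T : compact_positive ip T ->
  exists p : R * V, [/\ 0 <= p.1, forall u, N (T u) <= p.1 ^+ 2 * N u,
    T p.2 = p.1%:C *: p.2 & (0 < p.1 /\ N p.2 = 1) \/ (p.1 = 0 /\ p.2 = 0)].
Proof.
move=> cT; have [[Tlin Tsym] [Tpos Tnull] [M TM] _ _] := cT.
pose S := [set N (T u) | u in [set u | N u <= 1]].
have S0 : S 0 by exists 0; rewrite ?op0//= nm2_0.
have Sub : has_ubound S.
  exists (Num.max M 0) => _ [u /= u1 <-]; rewrite (le_trans (TM _))//.
  have [M0|M0] := leP M 0; last by rewrite -[leRHS]mulr1 ler_pM2l.
  by rewrite -oppr_ge0 -mulNr mulr_ge0 ?oppr_ge0 ?nm2_ge0.
have m0 : 0 <= sup S by exact: ub_le_sup.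
have Tm u : N (T u) <= sup S * N u.
  have [u0|u0] := ltP 0 (N u); last first.
    have {}u0 : N u = 0 by apply/eqP; rewrite eq_le u0 nm2_ge0.
    by rewrite u0 Tnull// nm2_0// mulr0.
  rewrite -ler_pdivrMr//; apply: ub_le_sup => //.
  exists ((Num.sqrt (N u))^-1%:C *: u) => /=; rewrite ?opZ// nm2Z// normc_real.
    by rewrite real_normK ?num_real// exprVn sqr_sqrtr ?(ltW u0)// mulVf// gt_eqF.
  by rewrite real_normK ?num_real// exprVn sqr_sqrtr ?(ltW u0)// mulrC.
have [mp|mp] := ltP 0 (sup S); last first.
  have {}mp : sup S = 0 by apply/eqP; rewrite eq_le mp m0.
  exists (0, 0); split => //=; [|by rewrite op0// scaler0|by right].
  by move=> u; rewrite expr0n /=; apply: le_trans (Tm u) _; rewrite mp.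
have [r r1|e [e1 Te]] := top_eigenvector_of_norm cT mp Tm.
  have mr : 0 < sup S - sup S * r by rewrite subr_gt0 gtr_pMr.
  have [_ [u /= u1 <-]] := sup_adherent mr (conj (ex_intro _ _ S0) Sub).
  by rewrite opprB addrCA subrr addr0 => h; exists u; split => //; exact: ltW.
exists (Num.sqrt (sup S), e); split => //=.
  by move=> u; rewrite sqr_sqrtr.
by left; rewrite sqrtr_gt0.
Qed.

Definition project (e u : V) := u - ip u e *: e.

Lemma projectZD e a u v : project e (a *: u + v) = a *: project e u + project e v.
Proof.
rewrite /project ipDl// ipZl// scalerBr !scalerA scalerDl opprD !addrA.
by congr (_ - _); rewrite addrAC.
Qed.

Lemma projectB e u v : project e u - project e v = project e (u - v).
Proof.
by rewrite addrC -scaleN1r -projectZD scaleN1r addrC.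
Qed.

Section unit_or_zero.
Variable e : V.
Hypothesis e1 : N e = 1 \/ e = 0.

Lemma project_sym u v : ip (project e u) v = ip u (project e v).
Proof.
by rewrite /project ipBl// ipBr// ipZl// ipZr// (ipC ipP v e) mulrC (ipC ipP e v) conjcK.
Qed.

Lemma ip_project u : ip (project e u) e = 0.
Proof.
case: e1 => [h|e0]; last by rewrite e0 ip0r.
rewrite /project ipBl// ipZl//.
by rewrite (ipuuE ipP e) h mulr1 subrr.
Qed.

Lemma nm2_project u : N (project e u) = N u - normc (ip u e) ^+ 2.
Proof.
rewrite {1}/nm2 {2}/project ipBr// ipZr// ip_project mulr0 subr0.
rewrite /project ipBl// ipZl// ReD ReN; congr (_ - _).
by rewrite (ipC ipP u e) mul_conjc.
Qed.

Lemma le_nm2_project u : N (project e u) <= N u.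
Proof. by rewrite nm2_project lerBlDr lerDl sqr_ge0. Qed.

(** Because [e] is an eigenvector, T (project e u) is again orthogonal to [e], so T after the
    projection has the same form as its two-sided compression; this gives symmetry and positivity.
    The rest uses that [project e] is a symmetric contraction. *)
Lemma compact_positive_project T l : compact_positive ip T -> 0 <= l ->
  T e = l%:C *: e -> compact_positive ip (fun u => T (project e u)).
Proof.
move=> [[Tlin Tsym] [Tpos Tnull] [M TM] TCS TCC] l0 Te.
have TP u v : ip (T (project e u)) v = ip (T (project e u)) (project e v).
  rewrite {3}/project ipBr// ipZr// (Tsym _ e) Te ipZr// ip_project.
  by rewrite !mulr0 subr0.
split.
- split=> [a u v|u v]; first by rewrite projectZD Tlin.
  by rewrite TP Tsym ipC// -TP -ipC.
- split=> [u|u u0]; first by rewrite TP Tpos.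
  by rewrite Tnull//; apply/eqP; rewrite eq_le nm2_ge0// -[leRHS]u0 le_nm2_project.
- exists (Num.max M 0) => u; apply: le_trans (TM _) _.
  apply: (@le_trans _ _ (Num.max M 0 * N (project e u))).
    by rewrite ler_wpM2r ?nm2_ge0// le_max lexx.
  by rewrite ler_wpM2l ?le_nm2_project// le_max lexx orbT.
- move=> u Hu; apply: (TCS (fun n => project e (u n))) => d d0.
  have [n0 H] := Hu d d0; exists n0 => i j hi hj.
  by rewrite projectB (le_trans (le_nm2_project _))// H.
- move=> w w1 w0; apply: (TCC (fun n => project e (w n))) => [n|v].
    exact: le_trans (le_nm2_project _) _.
  by under eq_fun do rewrite project_sym; exact: w0.
Qed.

End unit_or_zero.

(** The last clause stands in for completeness of the eigenvectors: it controls T on the orthogonal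
    complement of the first n of them, and all later tail estimates come from it. *)
Theorem compact_positive_spectral T : compact_positive ip T ->
  exists (l : nat -> R) (e : nat -> V), [/\ forall n, 0 <= l n,
    nonincreasing_seq l,
    forall n, T (e n) = (l n)%:C *: e n,
    (forall n, (0 < l n /\ N (e n) = 1) \/ (l n = 0 /\ e n = 0)) /\
    (forall i j, i != j -> ip (e i) (e j) = 0) &
    forall n u, (forall i, (i < n)%N -> ip u (e i) = 0) ->
      N (T u) <= l n ^+ 2 * N u].
Proof.
(* Compact positivity travels with the operator, since each choice of a top eigenvector depends on
   it. *)
move=> cT; pose state := {S : V -> V | compact_positive ip S}.
have /choice[pick Hpick] : forall s : state, _ := fun s => top_eigenvector (projT2 s).
have e1 s : N (pick s).2 = 1 \/ (pick s).2 = 0.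
  by have [_ _ _ [[]|[]]] := Hpick s; [left|right].
pose next s : state := exist _ _
  (let: And4 a _ c _ := Hpick s in compact_positive_project (e1 s) (projT2 s) a c).
pose S n := iter n next (exist _ T cT : state).
pose l n := (pick (S n)).1; pose e n := (pick (S n)).2.
pose P n := projT1 (S n).
have PS n u : P n.+1 u = P n (project (e n) u) by [].
have Plin n : forall a u v, P n (a *: u + v) = a *: P n u + P n v.
  by have [[]] := projT2 (S n).
have Psym n : forall u v, ip (P n u) v = ip u (P n v).
  by have [[]] := projT2 (S n).
have l0 n : 0 <= l n by have [] := Hpick (S n).
have Pl n u : N (P n u) <= l n ^+ 2 * N u by have [_ /(_ u)] := Hpick (S n).
have Pe n : P n (e n) = (l n)%:C *: e n by have [_ _] := Hpick (S n).
have le n : (0 < l n /\ N (e n) = 1) \/ (l n = 0 /\ e n = 0).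
  by have [_ _ _] := Hpick (S n).
have kill0 n : P n.+1 (e n) = 0.
  rewrite PS /project; have [[_ h]|[_ ->]] := le n.
    by rewrite ipuuE// h scale1r subrr op0//.
  by rewrite scaler0 subr0 op0.
(* An eigenvector with positive eigenvalue lies in the range of the symmetric map [P n], hence is
   orthogonal to its kernel, which contains all earlier eigenvectors. *)
have ort0 n u : P n u = 0 -> ip u (e n) = 0.
  move=> Pu; have [[lp h]|[_ ->]] := le n; last by rewrite ip0r.
  have : ip (P n u) (e n) = 0 by rewrite Pu ip0l.
  rewrite Psym Pe ipZr// => /eqP; rewrite mulf_eq0 conjc_eq0 => /orP[|/eqP//].
  by rewrite eq_complex /= gt_eqF.
have kill i k : P (i + k).+1 (e i) = 0.
  elim: k => [|k IH]; first by rewrite addn0.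
  by rewrite addnS PS /project (ort0 _ _ IH) scale0r subr0.
have ort i j : (i < j)%N -> ip (e i) (e j) = 0.
  by move=> ij; apply: ort0; rewrite -(subnKC ij) addSn kill.
have ort' i j : i != j -> ip (e i) (e j) = 0.
  by rewrite neq_ltn => /orP[/ort//|/ort h]; rewrite ipC// h conjc0.
have Pn n u : (forall i, (i < n)%N -> ip u (e i) = 0) -> P n u = T u.
  elim: n => [//|n IH] h; rewrite PS /project h// scale0r subr0 IH// => i ni.
  by apply: h; exact: ltnW.
exists l, e; split => //.
- apply/nonincreasing_seqP => n.
  have [[lp h]|[-> _]] := le n.+1; last exact: l0.
  rewrite -(ler_pXn2r (_ : 0 < 2)%N) ?nnegrE//.
  (* [P n.+1] is [P n] after a contraction, so the unit vector [e n.+1] tests the norm bound of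
     [P n]. *)
  have : N (P n.+1 (e n.+1)) = l n.+1 ^+ 2.
    by rewrite Pe nm2Z// h mulr1 normc_real real_normK ?num_real.
  move=> <-; rewrite PS (le_trans (Pl _ _))// -[leRHS]mulr1 ler_wpM2l ?sqr_ge0//.
  by rewrite -h; apply: le_nm2_project; exact: e1.
- by move=> n; rewrite -(Pn n) ?Pe// => i ni; apply: ort'; rewrite gtn_eqF.
- by move=> n u h; rewrite -(Pn n) ?Pl.
Qed.

End top_eigenvector.

(** * A nonincreasing sequence is determined by its positive value counts *)

Section eigenvalue_counting.
Variables (R : realType).

Definition same_positive_counts (l l' : nat -> R) := forall mu k, 0 < mu ->
  (`I_k #<= [set n | l n = mu])%card <-> (`I_k #<= [set n | l' n = mu])%card.

Lemma card_I_le_seqP (A : set nat) k : (`I_k #<= A)%card <->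
  exists s : seq nat, [/\ uniq s, size s = k & forall n, n \in s -> A n].
Proof.
split=> [/pcard_leP/unsquash f|[s [us sk sA]]].
  exists [seq f i | i <- iota 0 k]; split.
  - rewrite map_inj_in_uniq ?iota_uniq// => i j; rewrite !mem_iota /= => ik jk.
    by move=> /(@inj _ _ _ f); apply; rewrite inE.
  - by rewrite size_map size_iota.
  - by move=> _ /mapP[i + ->]; rewrite mem_iota /= => ik; exact: funS.
have h : (nth 0%N s @` `I_k `<=` A).
  by move=> _ [i /= ik <-]; apply: sA; rewrite mem_nth// sk.
apply: card_le_trans (subset_card_le h).
suff : (nth 0%N s @` `I_k #= `I_k)%card by rewrite card_eq_le => /andP[].
apply: inj_card_eq => i j; rewrite !inE /= => ik jk /eqP.
by rewrite nth_uniq ?sk// => /eqP.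
Qed.

(** Let n be the first index of disagreement, with [u n > v n]. The value [u n] is taken by [u] at n
    and at the indices [s] before it, so [v] takes it at least that often plus once; but [v] lies
    below it from n on, and before n it agrees with [u]. *)
Lemma same_positive_counts_eq (l l' : nat -> R) :
  (forall n, 0 <= l n) -> nonincreasing_seq l ->
  (forall n, 0 <= l' n) -> nonincreasing_seq l' ->
  same_positive_counts l l' -> l = l'.
Proof.
move=> l0 ld l'0 l'd ll'.
have key (u v : nat -> R) n : (forall n, 0 <= v n) -> nonincreasing_seq u -> nonincreasing_seq v ->
    same_positive_counts u v -> (forall i, (i < n)%N -> u i = v i) -> u n <= v n.
  move=> v0 ud vd uv un; rewrite leNgt; apply/negP => vn.
  have up : 0 < u n by exact: le_lt_trans vn.
  pose s := [seq i <- iota 0 n | u i == u n].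
  have ns : n \notin s by rewrite mem_filter mem_iota ltnn !andbF.
  have /(uv (u n) (size s).+1 up).1/card_I_le_seqP[t [ut st tA]] :
      (`I_(size s).+1 #<= [set k | u k = u n])%card.
    apply/card_I_le_seqP; exists (n :: s); split => //.
      by rewrite /= ns filter_uniq// iota_uniq.
    by move=> k; rewrite inE => /orP[/eqP->//|]; rewrite mem_filter => /andP[/eqP].
  suff : (size t <= size s)%N by rewrite st ltnn.
  apply: uniq_leq_size => // k /tA /= vk; rewrite mem_filter mem_iota /= add0n.
  have kn : (k < n)%N.
    by rewrite ltnNge; apply/negP => /vd; rewrite vk leNgt vn.
  by rewrite kn un// vk eqxx.
apply/funext => n; elim/ltn_ind: n => n IH; apply/eqP; rewrite eq_le.
rewrite (key l l')//= (key l' l)//; last by move=> i /IH.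
by move=> mu k /ll' h; split=> /h.
Qed.

End eigenvalue_counting.

(** * Multiplicities as dimensions of eigenspaces *)

Section eigenspaces.
Variables (R : realType) (V : lmodType R[i]) (ip : V -> V -> R[i]).
Hypothesis ipP : semi_inner ip.
Local Notation N := (nm2 ip).
Variables (T : V -> V) (l : nat -> R) (e : nat -> V).
Hypothesis cT : compact_positive ip T.
Hypotheses (l0 : forall n, 0 <= l n) (ld : nonincreasing_seq l)
  (Te : forall n, T (e n) = (l n)%:C *: e n)
  (e01 : forall n, (0 < l n /\ N (e n) = 1) \/ (l n = 0 /\ e n = 0))
  (eort : forall i j, i != j -> ip (e i) (e j) = 0)
  (Tl : forall n u, (forall i, (i < n)%N -> ip u (e i) = 0) ->
      N (T u) <= l n ^+ 2 * N u)
  (lto0 : l @ \oo --> (0 : R)).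

(** In the L^2 case this is the eigenvalue equation almost everywhere. *)
Definition approx_eigen (mu : R) u := N (T u - mu%:C *: u) = 0.

Lemma eigen_ip_eq0 (mu : R) u i : approx_eigen mu u -> l i != mu -> ip u (e i) = 0.
Proof.
have [[_ Tsym] _ _ _ _] := cT.
move=> Tu lmu; have : ip (T u) (e i) = mu%:C * ip u (e i).
  by apply/eqP; rewrite -subr_eq0 -(ipZl ipP) -(ipBl ipP); apply/eqP/ip_null.
rewrite Tsym Te ipZr// => /eqP; rewrite -subr_eq0 -mulrBl mulf_eq0 => /orP[|/eqP//].
by rewrite subr_eq0 eq_complex /= (negbTE lmu).
Qed.

(** Orthogonality to the remaining [e i] is automatic, the eigenvalues being different. Hence mu^2 N
    u = N(T u) <= l_n^2 N u for every n, while l_n drops below mu. *)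
Lemma eigen_orthogonal_null (mu : R) u : 0 < mu -> approx_eigen mu u ->
  (forall i, l i = mu -> ip u (e i) = 0) -> N u = 0.
Proof.
move=> mu0 Tu Hu; have u0 i : ip u (e i) = 0.
  by have [/Hu//|] := eqVneq (l i) mu; exact: eigen_ip_eq0.
have /cvgrPdist_lt/(_ _ mu0)[n _ /(_ n (leqnn n))] := lto0.
rewrite /= sub0r normrN ger0_norm// => ln.
have := @Tl n u (fun i _ => u0 i); rewrite (nm2_null_eq ipP Tu) nm2Z// normc_real.
rewrite real_normK ?num_real// -subr_ge0 -mulrBl => h; apply/eqP.
rewrite eq_le nm2_ge0// andbT leNgt; apply/negP => up.
move: h; rewrite pmulr_lge0// subr_ge0 ler_pXn2r ?nnegrE// ?(ltW mu0)//.
by rewrite leNgt ln.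
Qed.

Lemma eigenspace_dimension (mu : R) k : 0 < mu ->
  (exists E : 'I_k -> V, (forall i, approx_eigen mu (E i)) /\
     forall a : 'I_k -> R[i], N (\sum_(i < k) a i *: E i) = 0 -> forall i, a i = 0) <->
  (`I_k #<= [set n | l n = mu])%card.
Proof.
have [[Tlin Tsym] _ _ _ _] := cT.
move=> mu0; split=> [[E [HE Eind]]|].
  have /cvgrPdist_lt/(_ _ mu0)[n0 _ Hn0] := lto0.
  (* The sequence tends to 0, so the positive value [mu] is taken only at indices below [n0]. *)
  pose s := [seq n <- iota 0 n0 | l n == mu].
  have sP n : l n = mu -> n \in s.
    move=> ln; rewrite mem_filter ln eqxx mem_iota /= ltnNge; apply/negP => /Hn0 /=.
    by rewrite sub0r normrN ger0_norm// ln ltxx.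
  have su : uniq s by rewrite filter_uniq// iota_uniq.
  suff ks : (k <= size s)%N.
    apply/card_I_le_seqP; exists (take k s); split; first exact: take_uniq.
      by rewrite size_takel.
    by move=> n /mem_take; rewrite mem_filter => /andP[/eqP].
  rewrite leqNgt; apply/negP => sk.
  (* With more functions than indices, the matrix of inner products has a nonzero vector in its left
     kernel. The corresponding combination is orthogonal to every [e i] of eigenvalue [mu], hence
     null, against independence. *)
  pose A : 'M[R[i]]_(k, size s) := \matrix_(i < k, j < size s) ip (E i) (e (nth 0%N s j)).
  have : kermx A != 0.
    rewrite kermx_eq0 /row_free; apply/negP => /eqP h; move: sk; rewrite ltnNge -h.
    by rewrite rank_leq_col.
  move=> /rowV0Pn[a /sub_kermxP aA /eqP a0]; apply: a0.
  suff H : N (\sum_(i < k) a ord0 i *: E i) = 0.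
    by apply/rowP => i; rewrite (Eind _ H) mxE.
  apply: (@eigen_orthogonal_null mu) => // [|i /sP si].
    rewrite /approx_eigen; pose D u := T u - mu%:C *: u.
    have DD : forall c u v, D (c *: u + v) = c *: D u + D v.
      move=> c u v; rewrite /D Tlin !scalerDr scalerN !scalerA opprD addrACA.
      by rewrite (mulrC mu%:C).
    rewrite -/(D _) (_ : D _ = \sum_(i < k) a ord0 i *: D (E i)); last first.
      elim/big_rec2: _ => [|i y1 y2 _ <-]; first exact: op0.
      by rewrite DD.
    elim/big_rec: _ => [|i x _ x0]; first exact: nm2_0.
    apply/eqP; rewrite eq_le nm2_ge0// andbT.
    apply: le_trans (le_nm2D ipP _ _) _; rewrite x0 nm2Z// HE.
    by rewrite !mulr0 addr0.
  rewrite ip_suml//; have isz : (index i s < size s)%N by rewrite index_mem.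
  move/rowP/(_ (Ordinal isz)) : aA; rewrite !mxE => h; apply: etrans h.
  by apply: eq_bigr => j _; rewrite mxE ipZl//= nth_index.
move=> /card_I_le_seqP[s [us sk sA]].
exists (fun i => e (nth 0%N s i)).
have ls (i : 'I_k) : l (nth 0%N s i) = mu by apply: sA; rewrite mem_nth ?sk.
split=> [i|a Na i]; first by rewrite /approx_eigen Te ls subrr nm2_0.
have := ip_null ipP (e (nth 0%N s i)) Na.
rewrite ip_suml// (bigD1 i)//= big1 ?addr0; last first.
  move=> j ji; rewrite ipZl// eort ?mulr0//.
  by rewrite nth_uniq ?sk.
rewrite ipZl// ipuuE//; have [[_ ->]|[h _]] := e01 (nth 0%N s i).
  by rewrite mulr1.
by move: mu0; rewrite -(ls i) h ltxx.
Qed.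

End eigenspaces.

(** * Measurability and integration of complex functions *)

Section complex_measurability.
Context d (T : measurableType d) (R : realType).
Implicit Types (g h : T -> R[i]) (f : T -> R).

Definition cmeas g := measurable_fun setT (fun x => complex.Re (g x)) /\
  measurable_fun setT (fun x => complex.Im (g x)).

Lemma cmeasD g h : cmeas g -> cmeas h -> cmeas (fun x => g x + h x).
Proof.
move=> [g1 g2] [h1 h2]; split.
  by under eq_fun do rewrite ReD; exact: measurable_funD.
by under eq_fun do rewrite ImD; exact: measurable_funD.
Qed.

Lemma cmeasM g h : cmeas g -> cmeas h -> cmeas (fun x => g x * h x).
Proof.
move=> [g1 g2] [h1 h2]; split.
- have -> : (fun x => complex.Re (g x * h x)) = (fun x =>
      complex.Re (g x) * complex.Re (h x) - complex.Im (g x) * complex.Im (h x)).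
    by apply/funext => x; case: (g x) (h x) => a b [].
  by apply: measurable_funB; exact: measurable_funM.
- have -> : (fun x => complex.Im (g x * h x)) = (fun x =>
      complex.Re (g x) * complex.Im (h x) + complex.Im (g x) * complex.Re (h x)).
    by apply/funext => x; case: (g x) (h x) => a b [].
  by apply: measurable_funD; exact: measurable_funM.
Qed.

Lemma cmeas_real f : measurable_fun setT f -> cmeas (fun x => (f x)%:C).
Proof. by move=> mf; split => //=; exact: measurable_cst. Qed.

Lemma cmeas_cst (a : R[i]) : cmeas (fun=> a).
Proof. by split; exact: measurable_cst. Qed.

Lemma cmeasJ g : cmeas g -> cmeas (fun x => conjc (g x)).
Proof.
move=> [g1 g2]; split; first by under eq_fun do rewrite ReJ.
have -> : (fun x => complex.Im (conjc (g x))) = (fun x => - complex.Im (g x)).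
  by apply/funext => x; case: (g x).
exact: measurableT_comp.
Qed.

Lemma cmeasZ (a : R[i]) g : cmeas g -> cmeas (fun x => a * g x).
Proof. by move=> mg; apply: cmeasM => //; exact: cmeas_cst. Qed.

Lemma cmeasN g : cmeas g -> cmeas (fun x => - g x).
Proof. by move=> mg; under eq_fun do rewrite -mulN1r; exact: cmeasZ. Qed.

Lemma cmeas_sqr_normc g : cmeas g -> measurable_fun setT (fun x => normc (g x) ^+ 2).
Proof.
move=> [g1 g2]; under eq_fun do rewrite sqr_normcE.
by apply: measurable_funD; exact: measurable_funX.
Qed.

Lemma cmeas_normc g : cmeas g -> measurable_fun setT (fun x => normc (g x)).
Proof.
move=> mg; have -> : (fun x => normc (g x)) = (fun x => (normc (g x) ^+ 2) `^ 2^-1).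
  by apply/funext => x; rewrite powR12_sqrt ?sqr_ge0// sqrtr_sqr ger0_norm// normc_ge0.
by apply: (measurableT_comp (measurable_powR _)) => //; exact: cmeas_sqr_normc.
Qed.

End complex_measurability.

Lemma cmeas_comp d1 d2 (T1 : measurableType d1) (T2 : measurableType d2)
    (R : realType) (g : T2 -> R[i]) (h : T1 -> T2) :
  measurable_fun setT h -> cmeas g -> cmeas (fun x => g (h x)).
Proof. by move=> mh [g1 g2]; split; [exact: (measurableT_comp g1 mh)|exact: (measurableT_comp g2 mh)]. Qed.

Section complex_integral.
Context d (T : measurableType d) (R : realType) (mu : {measure set T -> \bar R}).
Implicit Types (g h : T -> R[i]) (f : T -> R).

Definition cint g : R[i] :=
  (\int[mu]_x complex.Re (g x)) +i* (\int[mu]_x complex.Im (g x)).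

Definition cintble g := mu.-integrable setT (fun x => (complex.Re (g x))%:E) /\
  mu.-integrable setT (fun x => (complex.Im (g x))%:E).

Lemma cintble_meas g : cintble g -> cmeas g.
Proof.
by move=> [/integrableP[/measurable_EFinP ? _] /integrableP[/measurable_EFinP ? _]].
Qed.

Lemma cintble_le g f : cmeas g -> mu.-integrable setT (EFin \o f) ->
  (forall x, normc (g x) <= f x) -> cintble g.
Proof.
move=> [g1 g2] If gf; split; apply: le_integrable If => //.
- exact/measurable_EFinP.
- move=> x _ /=; rewrite lee_fin (le_trans (normr_Re _))//.
  by rewrite (le_trans (gf x))// ler_norm.
- exact/measurable_EFinP.
- move=> x _ /=; rewrite lee_fin (le_trans (normr_Im _))//.
  by rewrite (le_trans (gf x))// ler_norm.
Qed.

Lemma normc_le_ReIm (z : R[i]) : normc z <= `|complex.Re z| + `|complex.Im z|.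
Proof.
rewrite -(ler_pXn2r (_ : 0 < 2)%N) ?nnegrE ?normc_ge0 ?addr_ge0// sqr_normcE.
rewrite sqrrD !real_normK ?num_real// -addrAC lerDl.
by rewrite mulrn_wge0 ?mulr_ge0.
Qed.

Lemma cintble_normc g : cintble g -> mu.-integrable setT (fun x => (normc (g x))%:E).
Proof.
move=> ig; have mg := cintble_meas ig; case: ig => i1 i2.
have i12 := integrableD measurableT (integrable_abse i1) (integrable_abse i2).
apply: le_integrable i12 => //; first exact/measurable_EFinP/cmeas_normc.
move=> x _ /=; rewrite lee_fin ger0_norm ?normc_ge0//.
by rewrite (le_trans (normc_le_ReIm _))// ler_norm.
Qed.

Lemma cintble_real f : mu.-integrable setT (fun x => (f x)%:E) -> cintble (fun x => (f x)%:C).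
Proof. by move=> If; split => //=; exact: integrable0. Qed.

Lemma cintbleZ (a : R[i]) g : cintble g -> cintble (fun x => a * g x).
Proof.
move=> ig; apply: (@cintble_le _ (fun x => normc a * normc (g x))).
- by apply: cmeasZ; exact: cintble_meas.
- exact: (integrableZl measurableT _ (cintble_normc ig)).
- by move=> x; rewrite ComplexField.Normc.normcM.
Qed.

Lemma cintbleJ g : cintble g -> cintble (fun x => conjc (g x)).
Proof.
move=> ig; apply: (@cintble_le _ (fun x => normc (g x))).
- by apply: cmeasJ; exact: cintble_meas.
- exact: cintble_normc.
- by move=> x; rewrite normc_conjc.
Qed.

Lemma cintD g h : cintble g -> cintble h ->
  cint (fun x => g x + h x) = cint g + cint h.
Proof.
move=> [g1 g2] [h1 h2]; rewrite /cint; congr (_ +i* _).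
  by under eq_Rintegral do rewrite ReD; rewrite RintegralD.
by under eq_Rintegral do rewrite ImD; rewrite RintegralD.
Qed.

Lemma cintZ (a : R[i]) g : cintble g -> cint (fun x => a * g x) = a * cint g.
Proof.
move=> [g1 g2]; case: a => a b.
have i k (f : T -> R) : mu.-integrable setT (fun x => (f x)%:E) ->
   mu.-integrable setT (fun x => (k * f x)%:E) by move=> If; exact: (integrableZl measurableT k If).
rewrite /cint; apply/eqP; rewrite eq_complex /=; apply/andP; split; apply/eqP.
  have -> : (fun x => complex.Re ((a +i* b) * g x)) = (fun x =>
      a * complex.Re (g x) - b * complex.Im (g x)).
    by apply/funext => x; case: (g x).
  by rewrite RintegralB ?RintegralZl//; exact: i.
have -> : (fun x => complex.Im ((a +i* b) * g x)) = (fun x =>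
    a * complex.Im (g x) + b * complex.Re (g x)).
  by apply/funext => x; case: (g x).
by rewrite RintegralD ?RintegralZl//; exact: i.
Qed.

Lemma RintegralN f : mu.-integrable setT (EFin \o f) ->
  \int[mu]_x (- f x) = - \int[mu]_x f x.
Proof.
move=> If; rewrite -mulN1r -RintegralZl//.
by apply: eq_Rintegral => x _; rewrite mulN1r.
Qed.

Lemma cintJ g : cintble g -> cint (fun x => conjc (g x)) = conjc (cint g).
Proof.
move=> [_ gi]; rewrite /cint /=; congr (_ +i* _); first by under eq_Rintegral do rewrite ReJ.
rewrite -RintegralN//; apply: eq_Rintegral => x _; by case: (g x).
Qed.

Lemma cint_real f : cint (fun x => (f x)%:C) = (\int[mu]_x f x)%:C.
Proof. by rewrite /cint /= Rintegral_cst// mul0r. Qed.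

Lemma le_normc_cint g : cintble g -> normc (cint g) <= \int[mu]_x normc (g x).
Proof.
move=> ig; set z := cint g.
have [->|z0] := eqVneq (normc z) 0; first by apply: Rintegral_ge0 => x _; exact: normc_ge0.
have zp : 0 < normc z by rewrite lt_neqAle eq_sym z0 normc_ge0.
rewrite -(ler_pM2l zp) -expr2.
have iz := cintbleZ (conjc z) ig.
(* Rotating by [conjc z] turns the modulus of the integral into the integral of a real part. *)
have -> : normc z ^+ 2 = \int[mu]_x complex.Re (conjc z * g x).
  transitivity (complex.Re (cint (fun x => conjc z * g x))) => //.
  by rewrite cintZ// -/z mulrC mul_conjc.
rewrite -RintegralZl//; last exact: cintble_normc.
apply: le_Rintegral => //; first by case: iz.
  exact: (integrableZl measurableT _ (cintble_normc ig)).
move=> x _; rewrite -(normc_conjc z) -ComplexField.Normc.normcM.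
by rewrite (le_trans _ (normr_Re _))// ler_norm.
Qed.

Lemma cint_ge0_eq0 f : measurable_fun setT f -> (forall x, 0 <= f x) ->
  mu.-integrable setT (EFin \o f) ->
  \int[mu]_x f x = 0 <-> {ae mu, forall x, f x = 0}.
Proof.
move=> mf f0 If; have EI : (\int[mu]_x f x)%:E = (\int[mu]_x (f x)%:E)%E.
  by rewrite /Rintegral fineK//; exact: integrable_fin_num.
have eqv := ae_eq_integral_abs mu measurableT (measurable_int mu If).
have E : (\int[mu]_x `|(EFin \o f) x| = \int[mu]_x (f x)%:E)%E.
  by apply: eq_integral => x _ /=; rewrite ger0_norm.
split=> [h|h].
  have : (\int[mu]_x `|(EFin \o f) x|)%E = 0%E by rewrite E -EI h.
  by move=> /eqv; apply: filterS => x /(_ I) [].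
have /eqv : ae_eq mu setT (EFin \o f) (cst 0%E) by apply: filterS h => x /= ->.
by rewrite E -EI => -[].
Qed.

Lemma ae_eq_cint g h : cintble g -> cintble h -> {ae mu, forall x, g x = h x} ->
  cint g = cint h.
Proof.
move=> [g1 g2] [h1 h2] gh; congr (_ +i* _); congr fine.
  apply: ae_eq_integral => //; [exact: measurable_int g1|exact: measurable_int h1|].
  by apply: filterS gh => x /= ->.
apply: ae_eq_integral => //; [exact: measurable_int g2|exact: measurable_int h2|].
by apply: filterS gh => x /= ->.
Qed.

End complex_integral.

(** * Fubini for complex integrands dominated by products *)

Section fubini.
Context d1 d2 (T1 : measurableType d1) (T2 : measurableType d2) (R : realType)
  (m1 : {sigma_finite_measure set T1 -> \bar R})
  (m2 : {sigma_finite_measure set T2 -> \bar R}).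

(** Tonelli applies to the positive and negative parts; [fine] then keeps measurability also where
    their integrals are infinite. *)
Lemma measurable_fun_Rintegral (f : T1 * T2 -> R) : measurable_fun setT f ->
  measurable_fun setT (fun x => \int[m2]_y f (x, y)).
Proof.
move=> mf; apply: (measurableT_comp (fine_measurable measurableT)).
under eq_fun do rewrite integralE.
have mF : measurable_fun setT (EFin \o f) by exact/measurable_EFinP.
apply: emeasurable_funB.
  rewrite [X in measurable_fun _ X](_ : _ = fubini_F m2 (EFin \o f)^\+%E); last first.
    apply/funext => x; apply: eq_integral => y _; by rewrite !funeposE.
  apply: measurable_fun_fubini_tonelli_F.
    exact: measurable_funepos.
  by move=> x; exact: funepos_ge0.
rewrite [X in measurable_fun _ X](_ : _ = fubini_F m2 (EFin \o f)^\-%E); last first.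
    apply/funext => x; apply: eq_integral => y _; by rewrite !funenegE.
  apply: measurable_fun_fubini_tonelli_F.
  exact: measurable_funeneg.
by move=> x; exact: funeneg_ge0.
Qed.

Lemma cmeas_cint (f : T1 * T2 -> R[i]) : cmeas f ->
  cmeas (fun x => cint m2 (fun y => f (x, y))).
Proof.
by move=> [f1 f2]; split; [exact: (measurable_fun_Rintegral f1)|exact: (measurable_fun_Rintegral f2)].
Qed.

Lemma integrable_prod_mul (a : T1 -> R) (b : T2 -> R) :
  m1.-integrable setT (EFin \o a) -> m2.-integrable setT (EFin \o b) ->
  (m1 \x m2)%E.-integrable setT (fun z => (a z.1 * b z.2)%:E).
Proof.
move=> Ia Ib; have ma : measurable_fun setT a by apply/measurable_EFinP; exact: measurable_int Ia.
have mb : measurable_fun setT b by apply/measurable_EFinP; exact: measurable_int Ib.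
have mab : measurable_fun setT (fun z : T1 * T2 => (a z.1 * b z.2)%:E).
  apply/measurable_EFinP; apply: measurable_funM.
    exact: (measurableT_comp ma measurable_fst).
  exact: (measurableT_comp mb measurable_snd).
apply/(integrable12ltyP _ _ mab) => /=.
have /integrableP[_ la] := Ia; have /integrableP[_ lb] := Ib.
have -> : (\int[m1]_x \int[m2]_y `|a x * b y|%:E =
    (\int[m1]_x `|a x|%:E) * (\int[m2]_y `|b y|%:E))%E.
  rewrite -ge0_integralZr//; last 2 first.
    by apply/measurable_EFinP; exact: measurableT_comp.
    exact: integral_ge0.
  apply: eq_integral => x _; rewrite -ge0_integralZl//; last first.
    by apply/measurable_EFinP; exact: measurableT_comp.
  by apply: eq_integral => y _; rewrite normrM EFinM.
by rewrite lte_mul_pinfty// ?integral_ge0// ge0_fin_numE// integral_ge0.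
Qed.

Section dominated.
Variables (f : T1 * T2 -> R[i]) (a : T1 -> R) (b : T2 -> R).
Hypotheses (mf : cmeas f)
  (Ia : m1.-integrable setT (EFin \o a)) (Ib : m2.-integrable setT (EFin \o b))
  (fab : forall x y, normc (f (x, y)) <= a x * b y).

Let If : cintble (m1 \x m2)%E f.
Proof.
apply: cintble_le (integrable_prod_mul Ia Ib) _ => //= -[x y]; exact: fab.
Qed.

Lemma cintble_section1 y : cintble m1 (fun x => f (x, y)).
Proof.
apply: (@cintble_le _ _ _ _ _ (fun x => a x * b y)) => //.
- exact: (cmeas_comp (measurable_pair2 y)).
- exact: (integrableZr measurableT (b y) Ia).
Qed.

Lemma cintble_section2 x : cintble m2 (fun y => f (x, y)).
Proof.
apply: (@cintble_le _ _ _ _ _ (fun y => a x * b y)) => //.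
- exact: (cmeas_comp (measurable_pair1 x)).
- exact: (integrableZl measurableT (a x) Ib).
Qed.

Let fub (p : R[i] -> R) : (forall y, m1.-integrable setT (fun x => (p (f (x, y)))%:E)) ->
  (forall x, m2.-integrable setT (fun y => (p (f (x, y)))%:E)) ->
  (m1 \x m2)%E.-integrable setT (fun z => (p (f z))%:E) ->
  \int[m1]_x \int[m2]_y p (f (x, y)) = \int[m2]_y \int[m1]_x p (f (x, y)) /\
  \int[(m1 \x m2)%E]_z p (f z) = \int[m1]_x \int[m2]_y p (f (x, y)).
Proof.
move=> s1 s2 I; split; congr fine.
  under eq_integral do rewrite fineK ?integrable_fin_num//.
  rewrite (Fubini I); apply: eq_integral => y _; rewrite fineK ?integrable_fin_num//.
under [RHS]eq_integral do rewrite fineK ?integrable_fin_num//.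
by rewrite -(integral12_prod_meas1 I).
Qed.

(** A bound [a x * b y] with integrable factors is what the kernels below offer. It makes every
    section integrable, not just almost every one, so no exceptional sets appear. *)
Lemma cint_fubini : cint m1 (fun x => cint m2 (fun y => f (x, y))) =
  cint m2 (fun y => cint m1 (fun x => f (x, y))).
Proof.
case: If => I1 I2; congr (_ +i* _).
  have [] // := fub _ _ I1 => z; first by case: (cintble_section1 z).
  by case: (cintble_section2 z).
have [] // := fub _ _ I2 => z; first by case: (cintble_section1 z).
by case: (cintble_section2 z).
Qed.

Lemma cint_prod : cint (m1 \x m2)%E f = cint m1 (fun x => cint m2 (fun y => f (x, y))).
Proof.
case: If => I1 I2; congr (_ +i* _).
  have [] // := fub _ _ I1 => z; first by case: (cintble_section1 z).
  by case: (cintble_section2 z).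
have [] // := fub _ _ I2 => z; first by case: (cintble_section1 z).
by case: (cintble_section2 z).
Qed.

End dominated.

End fubini.

(** * The space of square integrable functions *)

Section square_integrable.
Context d (T : measurableType d) (R : realType) (mu : {measure set T -> \bar R}).
Implicit Types (g h : T -> R[i]) (f : T -> R).

Definition sqint g := cmeas g /\ mu.-integrable setT (fun x => (normc (g x) ^+ 2)%:E).

Lemma sqint_le g f : cmeas g -> mu.-integrable setT (EFin \o f) ->
  (forall x, normc (g x) ^+ 2 <= f x) -> sqint g.
Proof.
move=> mg If gf; split => //; apply: le_integrable If => //.
  by apply/measurable_EFinP; exact: cmeas_sqr_normc.
move=> x _ /=; rewrite lee_fin ger0_norm ?sqr_ge0//.
by rewrite (le_trans (gf x))// ler_norm.
Qed.

Lemma sqint0 : sqint (fun=> 0).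
Proof.
split; first exact: cmeas_cst.
rewrite ComplexField.Normc.normc0 expr0n /=; exact: integrable0.
Qed.

Lemma sqr_normcD_le (z w : R[i]) :
  normc (z + w) ^+ 2 <= 2 * normc z ^+ 2 + 2 * normc w ^+ 2.
Proof.
rewrite !sqr_normcE; case: z w => a b [c e] /=; rewrite -subr_ge0.
rewrite (_ : _ - _ = (a - c) ^+ 2 + (b - e) ^+ 2); last by ring.
by rewrite addr_ge0// sqr_ge0.
Qed.

Lemma sqintD g h : sqint g -> sqint h -> sqint (fun x => g x + h x).
Proof.
move=> [mg Ig] [mh Ih].
apply: (@sqint_le _ (fun x => 2 * normc (g x) ^+ 2 + 2 * normc (h x) ^+ 2)).
- exact: cmeasD.
- exact: (integrableD measurableT (integrableZl measurableT 2 Ig) (integrableZl measurableT 2 Ih)).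
- by move=> x; exact: sqr_normcD_le.
Qed.

Lemma sqintZ (a : R[i]) g : sqint g -> sqint (fun x => a * g x).
Proof.
move=> [mg Ig]; apply: (@sqint_le _ (fun x => normc a ^+ 2 * normc (g x) ^+ 2)).
- exact: cmeasZ.
- exact: (integrableZl measurableT _ Ig).
- by move=> x; rewrite ComplexField.Normc.normcM exprMn.
Qed.

Lemma sqint_mulJ g h : sqint g -> sqint h -> cintble mu (fun x => g x * conjc (h x)).
Proof.
move=> [mg Ig] [mh Ih].
apply: (@cintble_le _ _ _ _ _ (fun x => normc (g x) ^+ 2 + normc (h x) ^+ 2)).
- by apply: cmeasM => //; exact: cmeasJ.
- exact: (integrableD measurableT Ig Ih).
- move=> x; rewrite ComplexField.Normc.normcM normc_conjc.
  have := sqr_ge0 (normc (g x) - normc (h x)); rewrite sqrrB => hh.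
  have := mulr_ge0 (normc_ge0 (g x)) (normc_ge0 (h x)); lra.
Qed.

(** Functions, not classes: values at points are used all along, and equality in this module is
    pointwise. Equality almost everywhere is vanishing of the seminorm. *)
Record l2 := L2fun { l2_fun :> T -> R[i]; l2_sqint : sqint l2_fun }.

HB.instance Definition _ := gen_eqMixin l2.
HB.instance Definition _ := gen_choiceMixin l2.

Lemma l2_ext (u v : l2) : (forall x, u x = v x) -> u = v.
Proof.
case: u v => u hu [v hv] /= /funext uv; rewrite uv in hu *.
by rewrite (Prop_irrelevance hu hv).
Qed.

Definition l2_zero := L2fun sqint0.
Definition l2_add (u v : l2) := L2fun (sqintD (l2_sqint u) (l2_sqint v)).
Definition l2_scale (a : R[i]) (u : l2) := L2fun (sqintZ a (l2_sqint u)).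
Definition l2_opp (u : l2) := l2_scale (-1) u.

Let l2_addA : associative l2_add.
Proof. by move=> u v w; apply: l2_ext => x /=; rewrite addrA. Qed.
Let l2_addC : commutative l2_add.
Proof. by move=> u v; apply: l2_ext => x /=; rewrite addrC. Qed.
Let l2_add0 : left_id l2_zero l2_add.
Proof. by move=> u; apply: l2_ext => x /=; rewrite add0r. Qed.
Let l2_addN : left_inverse l2_zero l2_opp l2_add.
Proof. by move=> u; apply: l2_ext => x /=; rewrite mulN1r addNr. Qed.

HB.instance Definition _ := GRing.isZmodule.Build l2 l2_addA l2_addC l2_add0 l2_addN.

Let l2_scaleA a b u : l2_scale a (l2_scale b u) = l2_scale (a * b) u.
Proof. by apply: l2_ext => x /=; rewrite mulrA. Qed.
Let l2_scale1 : left_id 1 l2_scale.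
Proof. by move=> u; apply: l2_ext => x /=; rewrite mul1r. Qed.
Let l2_scaleDr : right_distributive l2_scale +%R.
Proof. by move=> a u v; apply: l2_ext => x /=; rewrite mulrDr. Qed.
Let l2_scaleDl u : {morph l2_scale^~ u : a b / a + b}.
Proof. by move=> a b; apply: l2_ext => x /=; rewrite mulrDl. Qed.

HB.instance Definition _ := GRing.Zmodule_isLmodule.Build R[i] l2
  l2_scaleA l2_scale1 l2_scaleDr l2_scaleDl.

Lemma l2D (u v : l2) x : (u + v) x = u x + v x. Proof. by []. Qed.
Lemma l2Z a (u : l2) x : (a *: u) x = a * u x. Proof. by []. Qed.
Lemma l2N (u : l2) x : (- u) x = - u x. Proof. by rewrite -scaleN1r l2Z mulN1r. Qed.
Lemma l2B (u v : l2) x : (u - v) x = u x - v x. Proof. by rewrite l2D l2N. Qed.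
Lemma l2_sum I (r : seq I) (F : I -> l2) x : (\sum_(i <- r) F i) x = \sum_(i <- r) F i x.
Proof. by elim/big_rec2: _ => [|i y1 y2 _ <-]. Qed.

Definition ip2 (u v : l2) : R[i] := cint mu (fun x => u x * conjc (v x)).

Lemma ip2_semi_inner : semi_inner ip2.
Proof.
split=> [a u v w|u v|u].
- rewrite /ip2 -cintZ; last exact: sqint_mulJ (l2_sqint _) (l2_sqint _).
  rewrite -cintD; [|apply: cintbleZ; exact: sqint_mulJ (l2_sqint _) (l2_sqint _)
    |exact: sqint_mulJ (l2_sqint _) (l2_sqint _)].
  by congr cint; apply/funext => x; rewrite l2D l2Z mulrDl mulrA.
- rewrite /ip2 -cintJ; last exact: sqint_mulJ (l2_sqint _) (l2_sqint _).
  by congr cint; apply/funext => x; rewrite rmorphM /= conjcK mulrC.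
- rewrite /ip2; under [X in cint _ X]eq_fun do rewrite mul_conjc.
  by rewrite cint_real ler0c Rintegral_ge0// => x _; exact: sqr_ge0.
Qed.

Lemma nm2_ip2E u : nm2 ip2 u = \int[mu]_x (normc (u x) ^+ 2).
Proof.
rewrite /nm2 /ip2; under [X in cint _ X]eq_fun do rewrite mul_conjc.
by rewrite cint_real.
Qed.

Lemma nm2_ip2_eq0 u : nm2 ip2 u = 0 <-> {ae mu, forall x, u x = 0}.
Proof.
have [mu' Iu] := l2_sqint u.
rewrite nm2_ip2E cint_ge0_eq0//; first last.
- by move=> x; exact: sqr_ge0.
- exact: cmeas_sqr_normc.
split; apply: filterS => x.
  by move=> /eqP; rewrite sqrf_eq0 => /eqP/ComplexField.Normc.eq0_normc.
by move=> ->; rewrite ComplexField.Normc.normc0 expr0n.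
Qed.

Lemma nm2_ip2_le (u : l2) f : mu.-integrable setT (EFin \o f) ->
  (forall x, normc (u x) ^+ 2 <= f x) -> nm2 ip2 u <= \int[mu]_x f x.
Proof.
by move=> If uf; rewrite nm2_ip2E; apply: le_Rintegral => //; case: (l2_sqint u).
Qed.

End square_integrable.

Lemma measurable_indic_comp d1 d2 (T1 : measurableType d1) (T2 : measurableType d2)
    (R : realType) (h : T1 -> T2) (D : set T2) : measurable D -> measurable_fun setT h ->
  measurable_fun setT (fun x => \1_D (h x) : R).
Proof.
move=> mD mh; have mi : measurable_fun setT (\1_D : T2 -> R) by exact: measurable_indic.
exact: (measurableT_comp mi mh).
Qed.

Lemma sqr_cvg0 (R : realType) (s : nat -> R) :
  s n @[n --> \oo] --> (0 : R) -> s n ^+ 2 @[n --> \oo] --> (0 : R).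
Proof.
move=> s0; have -> : (fun n => s n ^+ 2) = s \* s.
  by apply/funext => n; rewrite expr2.
suff : (s \* s) @ \oo --> (0 * 0 : R) by rewrite mulr0.
exact: cvgM.
Qed.

Lemma sqr_normcB_cvg (R : realType) (z : R[i]) (s : nat -> R[i]) :
  cvgn (fun n => complex.Re (s n)) -> cvgn (fun n => complex.Im (s n)) ->
  normc (z - s n) ^+ 2 @[n --> \oo] -->
  normc (z - (limn (fun n => complex.Re (s n)) +i* limn (fun n => complex.Im (s n)))) ^+ 2.
Proof.
move=> c1 c2; rewrite sqr_normcE !ReD !ImD !ReN !ImN /=.
set p := limn _ in c1 *; set q := limn _ in c2 *.
have h1 : complex.Re z - complex.Re (s n) @[n --> \oo] --> complex.Re z - p.
  by apply: cvgB => //; exact: cvg_cst.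
have h2 : complex.Im z - complex.Im (s n) @[n --> \oo] --> complex.Im z - q.
  by apply: cvgB => //; exact: cvg_cst.
have -> : (fun n => normc (z - s n) ^+ 2) = (fun n =>
    (complex.Re z - complex.Re (s n)) * (complex.Re z - complex.Re (s n)) +
    (complex.Im z - complex.Im (s n)) * (complex.Im z - complex.Im (s n))).
  by apply/funext => n; rewrite sqr_normcE !ReD !ImD !ReN !ImN !expr2.
by rewrite !expr2; exact: cvgD (cvgM h1 h1) (cvgM h2 h2).
Qed.

(** * The limiting operator of a unimodular kernel *)

Section limited_operator.
Context d (T : measurableType d) (R : realType)
  (mu : {sigma_finite_measure set T -> \bar R}) (E : T * T -> R[i]).
Hypotheses (mE : cmeas E) (E1 : forall z, normc (E z) = 1).
Variables A B : set T.
Hypotheses (mA : measurable A) (mB : measurable B)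
  (A_fin : (mu A < +oo)%E) (B_fin : (mu B < +oo)%E).
Local Notation V := (l2 mu).
Local Notation ip := (@ip2 _ T R mu).
Local Notation N := (nm2 ip).

Definition chi (D : set T) (g : T -> R[i]) x : R[i] := (\1_D x)%:C * g x.
(** For E(x, xi) = exp(2 pi i x.xi) this is the Fourier integral, and [limited] is the operator
    S_(A,B). *)
Definition transform (g : T -> R[i]) xi := cint mu (fun x => conjc (E (x, xi)) * g x).
Definition cotransform (g : T -> R[i]) x := cint mu (fun xi => E (x, xi) * g xi).
Definition limited g := chi A (cotransform (chi B (transform (chi A g)))).

Let a := fine (mu A).
Let b := fine (mu B).

Section indicator.
Variable D : set T.
Hypotheses (mD : measurable D) (D_fin : (mu D < +oo)%E).

Lemma integrable_ind (M : R) : mu.-integrable setT (fun x => (M * \1_D x)%:E).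
Proof.
have I1 : mu.-integrable setT (EFin \o (\1_D : T -> R)).
  apply/integrableP; split; first exact/measurable_EFinP/measurable_indic.
  under eq_integral do rewrite /= ger0_norm//.
  by rewrite integral_indic// setIT.
exact: (integrableZl measurableT M I1).
Qed.

Lemma Rintegral_ind (M : R) : \int[mu]_x (M * \1_D x) = M * fine (mu D).
Proof.
have I1 : mu.-integrable setT (EFin \o (\1_D : T -> R)).
  by have := integrable_ind 1; congr (_.-integrable _ _); apply/funext => x /=; rewrite mul1r.
by rewrite RintegralZl//; congr (_ * _); rewrite /Rintegral integral_indic// setIT.
Qed.

Lemma cmeas_chi g : cmeas g -> cmeas (chi D g).
Proof.
move=> mg; apply: cmeasM => //; apply: cmeas_real.
exact: measurable_indic.
Qed.

Lemma normc_chi g x : normc (chi D g x) = \1_D x * normc (g x).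
Proof. by rewrite /chi ComplexField.Normc.normcM normc_real ger0_norm. Qed.

Lemma ind_idem x : (\1_D x : R) * \1_D x = \1_D x.
Proof. by rewrite indicE; case: (_ \in _); rewrite ?mulr0 ?mulr1. Qed.

Lemma indC_idem x : (\1_D x : R)%:C * (\1_D x)%:C = (\1_D x)%:C.
Proof. by rewrite -rmorphM ind_idem. Qed.

Lemma chiJ g x : conjc (chi D g x) = (\1_D x)%:C * conjc (g x).
Proof. by rewrite /chi conjcZ. Qed.

Lemma chi_sqint g (M : R) : cmeas g -> (forall x, normc (g x) <= M) -> sqint mu (chi D g).
Proof.
move=> mg gM; apply: (@sqint_le _ _ _ _ _ (fun x => M ^+ 2 * \1_D x)).
- exact: cmeas_chi.
- exact: integrable_ind.
- move=> x; rewrite normc_chi exprMn [\1_D x ^+ 2]expr2 ind_idem mulrC ler_wpM2r//.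
  by rewrite ler_pXn2r ?nnegrE ?normc_ge0// (le_trans _ (gM x))// normc_ge0.
Qed.

Lemma chi_cintble g (M : R) : cmeas g -> (forall x, normc (g x) <= M) -> cintble mu (chi D g).
Proof.
move=> mg gM; apply: (@cintble_le _ _ _ _ _ (fun x => M * \1_D x)).
- exact: cmeas_chi.
- exact: integrable_ind.
- by move=> x; rewrite normc_chi mulrC ler_wpM2r.
Qed.

Lemma chi_sqint_cintble g : sqint mu g -> cintble mu (chi D g).
Proof.
move=> [mg Ig]; apply: (@cintble_le _ _ _ _ _ (fun x => 1 * \1_D x + normc (g x) ^+ 2)).
- exact: cmeas_chi.
- exact: (integrableD measurableT (integrable_ind 1) Ig).
- move=> x; rewrite normc_chi mul1r indicE; case: (_ \in _); last first.
    by rewrite mul0r add0r sqr_ge0.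
  rewrite mul1r; have := sqr_ge0 (normc (g x) - 1); rewrite sqrrB1 => h.
  by have := normc_ge0 (g x); rewrite /= ; move: h; rewrite mulr2n; lra.
Qed.

Lemma sqint_chi g : sqint mu g -> sqint mu (chi D g).
Proof.
move=> [mg Ig]; apply: (@sqint_le _ _ _ _ _ (fun x => normc (g x) ^+ 2)) => //.
- exact: cmeas_chi.
- move=> x; rewrite normc_chi exprMn expr2 ind_idem.
  by rewrite ler_piMl ?sqr_ge0// indicE; case: (_ \in _).
Qed.

(* Cauchy-Schwarz against the indicator function *)
Lemma sqr_int_chi_le (u : V) :
  (\int[mu]_x normc (chi D u x)) ^+ 2 <= fine (mu D) * N u.
Proof.
have mn : cmeas (fun x => (normc (u x))%:C).
  by apply: cmeas_real; apply: cmeas_normc; case: (l2_sqint u).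
have sq1 : sqint mu (fun x => (normc (u x))%:C).
  have [_ Iu] := l2_sqint u; split => //.
  by under eq_fun do rewrite normc_real real_normK ?num_real//.
have one : sqint mu (chi D (fun=> 1)).
  apply: (@chi_sqint _ 1) => [|x]; first exact: cmeas_cst.
  by rewrite ComplexField.Normc.normc1.
have := cauchy_schwarz (@ip2_semi_inner _ T R mu) (L2fun one) (L2fun sq1).
have -> : N (L2fun sq1) = N u.
  rewrite !nm2_ip2E; apply: eq_Rintegral => x _ /=.
  by rewrite expr0n addr0 sqrtr_sqr ger0_norm// normc_ge0.
have -> : N (L2fun one) = fine (mu D).
  rewrite nm2_ip2E -[RHS]mul1r -Rintegral_ind; apply: eq_Rintegral => x _.
  by rewrite [normc _]normc_chi ComplexField.Normc.normc1 mulr1 expr2 ind_idem mul1r.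
have -> : ip (L2fun one) (L2fun sq1) = (\int[mu]_x normc (chi D u x))%:C.
  rewrite -cint_real; congr cint; apply/funext => x.
  by rewrite normc_chi /= /chi mulr1 oppr0 rmorphM.
by rewrite normc_real real_normK ?num_real.
Qed.

End indicator.

Lemma cmeas_swap (g : T * T -> R[i]) : cmeas g -> cmeas (fun z => g (z.2, z.1)).
Proof. by apply: cmeas_comp; apply: measurable_fun_pair. Qed.

Lemma cmeas_transform g : cmeas g -> cmeas (transform g).
Proof.
move=> mg; apply: (@cmeas_cint _ _ T T R mu (fun z => conjc (E (z.2, z.1)) * g z.2)).
apply: cmeasM; first by apply: cmeasJ; exact: cmeas_swap.
exact: (cmeas_comp measurable_snd).
Qed.

Lemma cmeas_cotransform g : cmeas g -> cmeas (cotransform g).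
Proof.
move=> mg; apply: (@cmeas_cint _ _ T T R mu (fun z => E (z.1, z.2) * g z.2)).
apply: cmeasM; last exact: (cmeas_comp measurable_snd).
by rewrite (_ : (fun z => _) = E)//; apply/funext => -[].
Qed.

Lemma cmeas_E1 y : cmeas (fun x => E (x, y)).
Proof. exact: (cmeas_comp (measurable_pair2 y)). Qed.

Lemma cmeas_E2 x : cmeas (fun y => E (x, y)).
Proof. exact: (cmeas_comp (measurable_pair1 x)). Qed.

Lemma cintble_unimodular (h g : T -> R[i]) : cmeas h -> (forall x, normc (h x) = 1) ->
  cintble mu g -> cintble mu (fun x => h x * g x).
Proof.
move=> mh h1 ig; apply: (@cintble_le _ _ _ _ _ (fun x => normc (g x))).
- by apply: cmeasM => //; exact: (cintble_meas ig).
- exact: cintble_normc.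
- by move=> x; rewrite ComplexField.Normc.normcM h1 mul1r.
Qed.

Lemma cintble_transform g xi : cintble mu g -> cintble mu (fun x => conjc (E (x, xi)) * g x).
Proof.
apply: cintble_unimodular; first by apply: cmeasJ; exact: cmeas_E1.
by move=> x; rewrite normc_conjc.
Qed.

Lemma cintble_cotransform g x : cintble mu g -> cintble mu (fun xi => E (x, xi) * g xi).
Proof. by apply: cintble_unimodular => //; exact: cmeas_E2. Qed.

Lemma normc_transform g xi : cintble mu g ->
  normc (transform g xi) <= \int[mu]_x normc (g x).
Proof.
move=> ig; apply: le_trans (le_normc_cint (cintble_transform xi ig)) _.
rewrite le_eqVlt; apply/orP; left; apply/eqP; apply: eq_Rintegral => x _.
by rewrite ComplexField.Normc.normcM normc_conjc E1 mul1r.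
Qed.

Lemma normc_cotransform g x : cintble mu g ->
  normc (cotransform g x) <= \int[mu]_x normc (g x).
Proof.
move=> ig; apply: le_trans (le_normc_cint (cintble_cotransform x ig)) _.
rewrite le_eqVlt; apply/orP; left; apply/eqP; apply: eq_Rintegral => y _.
by rewrite ComplexField.Normc.normcM E1 mul1r.
Qed.

Lemma transformZD c g h xi : cintble mu g -> cintble mu h ->
  transform (fun x => c * g x + h x) xi = c * transform g xi + transform h xi.
Proof.
move=> ig ih; rewrite /transform -cintZ; last exact: cintble_transform.
rewrite -cintD; [|by apply: cintbleZ; exact: cintble_transform|exact: cintble_transform].
by congr cint; apply/funext => x; rewrite mulrDr mulrCA.
Qed.

Lemma cotransformZD c g h x : cintble mu g -> cintble mu h ->
  cotransform (fun x => c * g x + h x) x = c * cotransform g x + cotransform h x.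
Proof.
move=> ig ih; rewrite /cotransform -cintZ; last exact: cintble_cotransform.
rewrite -cintD; [|by apply: cintbleZ; exact: cintble_cotransform|exact: cintble_cotransform].
by congr cint; apply/funext => y; rewrite mulrDr mulrCA.
Qed.

Lemma chiZD D c (g h : T -> R[i]) : chi D (fun x => c * g x + h x) =
  (fun x => c * chi D g x + chi D h x).
Proof. by apply/funext => x; rewrite /chi mulrDr mulrCA. Qed.

Let u_int (u : V) : cintble mu (chi A u) := chi_sqint_cintble mA A_fin (l2_sqint u).
Let mF (u : V) : cmeas (transform (chi A u)) := cmeas_transform (cintble_meas (u_int u)).
Let bF (u : V) xi : normc (transform (chi A u) xi) <= \int[mu]_x normc (chi A u x) :=
  normc_transform xi (u_int u).

(* band u = 1_B F (1_A u); the operator is band^* band *)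
Definition band (u : V) : V := L2fun (chi_sqint mB B_fin (mF u) (bF u)).

Let band_int (u : V) : cintble mu (band u) := chi_cintble mB B_fin (mF u) (bF u).

Section coband.
Variables (w : T -> R[i]) (M : R).
Hypotheses (mw : cmeas w) (bw : forall x, normc (w x) <= M).

Let w_int : cintble mu (chi B w) := chi_cintble mB B_fin mw bw.
Let mG : cmeas (cotransform (chi B w)) := cmeas_cotransform (cintble_meas w_int).
Let bG x : normc (cotransform (chi B w) x) <= \int[mu]_x normc (chi B w x) :=
  normc_cotransform x w_int.

(** Allowing any bounded [w] serves two purposes: the transform of [1_A u] yields the operator, a
    conjugated wave yields its reproducing kernel. *)
Definition coband : V := L2fun (chi_sqint mA A_fin mG bG).

(** Fubini, the integrand being dominated by the product of [M * \1_B xi] and [|1_A u|], the latter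
    integrable since A has finite measure. *)
Lemma band_adjoint (u : V) : ip (band u) (L2fun (chi_sqint mB B_fin mw bw)) = ip u coband.
Proof.
pose f (z : T * T) := conjc (E (z.2, z.1)) * chi A u z.2 * conjc (chi B w z.1).
have Nu : mu.-integrable setT (EFin \o (fun x => normc (chi A u x))).
  exact: cintble_normc (u_int u).
have := @cint_fubini _ _ T T R mu mu f (fun xi => M * \1_B xi)
  (fun x => normc (chi A u x)) _ (integrable_ind mB B_fin M) Nu.
move=> /(_ _ _)/=H.
transitivity (cint mu (fun x => cint mu (fun y => f (x, y)))).
  rewrite /ip2; congr cint; apply/funext => xi /=.
  transitivity (conjc (chi B w xi) * transform (chi A u) xi).
    by rewrite chiJ {1}/chi -[X in _ = X * _ * _]indC_idem; ring.
  rewrite /transform -cintZ; last exact: cintble_transform.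
  by congr cint; apply/funext => x; rewrite /f /= mulrC.
rewrite {}H.
- rewrite /ip2; congr cint; apply/funext => x.
  have -> : coband x = chi A (cotransform (chi B w)) x by [].
  transitivity (chi A u x * conjc (cotransform (chi B w) x)); last first.
    by rewrite chiJ /chi; ring.
  rewrite /cotransform -cintJ; last exact: cintble_cotransform.
  rewrite -cintZ; last by apply: cintbleJ; exact: cintble_cotransform.
  by congr cint; apply/funext => xi; rewrite rmorphM [RHS]mulrA; congr (_ * _); exact: mulrC.
- apply: cmeasM.
    apply: cmeasM; first by apply: cmeasJ; exact: cmeas_swap.
    exact: (cmeas_comp measurable_snd (cintble_meas (u_int u))).
  by apply: cmeasJ; exact: (cmeas_comp measurable_fst (cintble_meas w_int)).
- move=> x y; rewrite /f 2!ComplexField.Normc.normcM !normc_conjc E1 mul1r mulrC.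
  by rewrite ler_wpM2r ?normc_ge0// normc_chi mulrC ler_wpM2r.
Qed.

End coband.

Definition lim_op (u : V) : V := coband (mF u) (bF u).

Lemma lim_opE (u : V) x : lim_op u x = limited u x.
Proof. by []. Qed.

Lemma lim_op_linear c (u v : V) : lim_op (c *: u + v) = c *: lim_op u + lim_op v.
Proof.
apply: l2_ext => x; rewrite l2D l2Z !lim_opE /limited.
have -> : chi A (c *: u + v) = (fun x => c * chi A u x + chi A v x) by rewrite -chiZD.
have -> : transform (fun x => c * chi A u x + chi A v x) =
    (fun x => c * transform (chi A u) x + transform (chi A v) x).
  by apply/funext => y; rewrite transformZD.
rewrite chiZD.
have -> : cotransform (fun x => c * chi B (transform (chi A u)) x + chi B (transform (chi A v)) x) =
   (fun x => c * cotransform (chi B (transform (chi A u))) x + cotransform (chi B (transform (chi A v))) x).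
  by apply/funext => y; rewrite cotransformZD//; [exact: (band_int u)|exact: (band_int v)].
by rewrite chiZD.
Qed.

Lemma ip_lim_op (u v : V) : ip u (lim_op v) = ip (band u) (band v).
Proof. by rewrite -band_adjoint. Qed.

Lemma lim_op_sym (u v : V) : ip (lim_op u) v = ip u (lim_op v).
Proof.
have ipP := @ip2_semi_inner _ T R mu.
by rewrite (ipC ipP v) !ip_lim_op -(ipC ipP).
Qed.

Lemma ip_lim_op_nm2 u : ip (lim_op u) u = (N (band u))%:C.
Proof. by rewrite lim_op_sym ip_lim_op ipuuE//; exact: ip2_semi_inner. Qed.

Let bE (x xi : T) : normc (conjc (E (x, xi))) <= 1.
Proof. by rewrite normc_conjc E1. Qed.
Let mEc x : cmeas (fun xi => conjc (E (x, xi))) := cmeasJ (cmeas_E2 x).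

Definition wave x : V := L2fun (chi_sqint mB B_fin (mEc x) (bE x)).

(* the reproducing kernel of the operator *)
Definition ker x : V := coband (mEc x) (bE x).

Lemma kerE x z : ker x z = chi A (fun z => cint mu
  (fun xi => E (z, xi) * ((\1_B xi)%:C * conjc (E (x, xi))))) z.
Proof. by []. Qed.

Lemma nm2_wave x : N (wave x) = b.
Proof.
rewrite nm2_ip2E -[b]mul1r -(Rintegral_ind mB B_fin); apply: eq_Rintegral => y _ /=.
by rewrite -/(chi B (fun xi => conjc (E (x, xi))) y) normc_chi normc_conjc E1 mulr1 expr2 ind_idem mul1r.
Qed.

Lemma cotransform_band (u : V) x : cotransform (chi B (transform (chi A u))) x = ip (band u) (wave x).
Proof.
rewrite /ip2 /cotransform; congr cint; apply/funext => xi /=.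
rewrite -/(chi B (fun xi => conjc (E (x, xi))) xi) chiJ conjcK {1}/chi.
by rewrite -{1}indC_idem /chi; ring.
Qed.

Lemma lim_op_ker u x : x \in A -> lim_op u x = ip u (ker x).
Proof.
move=> xA; rewrite /ker -band_adjoint -cotransform_band lim_opE /limited.
by rewrite {1}/chi indicE xA mul1r.
Qed.

Lemma lim_op_out u x : x \notin A -> lim_op u x = 0.
Proof. by move=> xA; rewrite lim_opE /limited /chi indicE (negbTE xA) mul0r. Qed.

(** Cauchy-Schwarz against the wave at x, of squared norm b. This pointwise control is what allows
    limits of images to be taken at each point. *)
Lemma sqr_lim_op_le_band u x : normc (lim_op u x) ^+ 2 <= \1_A x * (b * N (band u)).
Proof.
have [xA|xA] := boolP (x \in A); last first.
  by rewrite lim_op_out// ComplexField.Normc.normc0 expr0n mulr_ge0// mulr_ge0 ?nm2_ge0//;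
    [exact: fine_ge0|exact: ip2_semi_inner].
rewrite lim_op_ker// /ker -band_adjoint indicE xA mul1r mulrC -(nm2_wave x).
by apply: cauchy_schwarz; exact: ip2_semi_inner.
Qed.

(** A crude bound from the sup norm of the transform, valid for any unimodular kernel and sufficient
    for compactness; the sharp constant 1 is obtained later for the Fourier kernel. *)
Lemma nm2_band_le u : N (band u) <= a * b * N u.
Proof.
apply: (@le_trans _ _ (\int[mu]_x (a * N u * \1_B x))); last first.
  by rewrite (Rintegral_ind mB B_fin) mulrAC.
apply: (nm2_ip2_le (integrable_ind mB B_fin _)) => x.
rewrite [normc _]normc_chi exprMn [\1_B x ^+ 2]expr2 ind_idem mulrC ler_wpM2r//.
apply: le_trans (sqr_int_chi_le mA A_fin u).
by rewrite ler_pXn2r ?nnegrE ?normc_ge0 ?Rintegral_ge0// => y _; exact: normc_ge0.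
Qed.

Lemma nm2_lim_op_le_band u : N (lim_op u) <= a * b * N (band u).
Proof.
apply: (@le_trans _ _ (\int[mu]_x (b * N (band u) * \1_A x))); last first.
  by rewrite (Rintegral_ind mA A_fin) mulrC mulrA.
apply: (nm2_ip2_le (integrable_ind mA A_fin _)) => x.
by rewrite mulrC; exact: sqr_lim_op_le_band.
Qed.

Lemma ab_ge0 : 0 <= a /\ 0 <= b. Proof. by split; exact: fine_ge0. Qed.

Lemma sqr_lim_op_le u x : normc (lim_op u x) ^+ 2 <= \1_A x * (a * b ^+ 2 * N u).
Proof.
have [a0 b0] := ab_ge0.
apply: le_trans (sqr_lim_op_le_band u x) _; rewrite ler_wpM2l//.
rewrite [a * _]mulrC expr2 -!mulrA ler_wpM2l//.
by apply: le_trans (nm2_band_le u) _; rewrite mulrA (mulrC a).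
Qed.

Lemma lim_opB u v : lim_op (u - v) = lim_op u - lim_op v.
Proof. by rewrite (opB lim_op_linear). Qed.

(* An L^2-Cauchy sequence has uniformly Cauchy images, whose pointwise limit is
   also their L^2 limit since everything lives on the set A of finite measure;
   no completeness of L^2 is needed. *)
Lemma lim_op_complete (u : nat -> V) :
  (forall e, 0 < e -> exists n0, forall i j, (n0 <= i)%N -> (n0 <= j)%N ->
     N (u i - u j) <= e) ->
  exists v, N (lim_op (u n) - v) @[n --> \oo] --> (0 : R).
Proof.
move=> Hu; have [a0 b0] := ab_ge0.
pose K := a * b ^+ 2 + 1.
have K0 : 0 < K by rewrite ltr_pwDr// mulr_ge0// sqr_ge0.
have unif e : 0 < e -> exists n0, forall i j, (n0 <= i)%N -> (n0 <= j)%N ->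
    forall x, normc (lim_op (u i) x - lim_op (u j) x) ^+ 2 <= e * \1_A x.
  move=> e0; have [|n0 H] := Hu (e / K); first exact: divr_gt0.
  exists n0 => i j hi hj x; rewrite -l2B -lim_opB.
  apply: le_trans (sqr_lim_op_le _ _) _; rewrite mulrC ler_wpM2r//.
  apply: (@le_trans _ _ (K * (e / K))); last by rewrite mulrC divfK// gt_eqF.
  apply: ler_pM; rewrite ?nm2_ge0 ?mulr_ge0 ?sqr_ge0//; [exact: ip2_semi_inner|by rewrite lerDl|exact: H].
have cauchy_seq_cvg (s : nat -> R) : (forall e, 0 < e -> exists n0, forall i j, (n0 <= i)%N -> (n0 <= j)%N ->
    (s i - s j) ^+ 2 <= e) -> cvgn s.
  move=> Hs; apply: cauchy_cvg; apply: cauchy_exP => e e0.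
  have [|n0 H] := Hs ((e / 2) ^+ 2); first by rewrite exprn_gt0// divr_gt0.
  exists (s n0); exists n0 => // n hn; have := H n0 n (leqnn _) hn.
  rewrite -(real_normK (num_real _)) ler_pXn2r ?nnegrE ?divr_ge0 ?(ltW e0)// => h.
  by rewrite /ball/= (le_lt_trans h)// ltr_pdivrMr// ltr_pMr// ltr1n.
have sq1 (D : set T) x : (\1_D x : R) <= 1 by rewrite indicE; case: (_ \in _).
have cRe x : cvgn (fun n => complex.Re (lim_op (u n) x)).
  apply: cauchy_seq_cvg => e e0; have [n0 H] := unif e e0; exists n0 => i j hi hj.
  apply: le_trans (le_trans (H i j hi hj x) _); last by rewrite ler_piMr// ltW.
  by rewrite sqr_normcE -ReN -ReD lerDl sqr_ge0.
have cIm x : cvgn (fun n => complex.Im (lim_op (u n) x)).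
  apply: cauchy_seq_cvg => e e0; have [n0 H] := unif e e0; exists n0 => i j hi hj.
  apply: le_trans (le_trans (H i j hi hj x) _); last by rewrite ler_piMr// ltW.
  by rewrite sqr_normcE -ImN -ImD lerDr sqr_ge0.
pose v x := limn (fun n => complex.Re (lim_op (u n) x)) +i* limn (fun n => complex.Im (lim_op (u n) x)).
have mop n : cmeas (lim_op (u n)) by case: (l2_sqint (lim_op (u n))).
have mv : cmeas v.
  split => /=.
    apply: (@measurable_fun_cvg _ _ _ setT (fun n x => complex.Re (lim_op (u n) x))) => [n|x _].
      by case: (mop n).
    exact: cRe.
  apply: (@measurable_fun_cvg _ _ _ setT (fun n x => complex.Im (lim_op (u n) x))) => [n|x _].
    by case: (mop n).
  exact: cIm.
have vclose e : 0 < e -> exists n0, forall i, (n0 <= i)%N ->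
    forall x, normc (lim_op (u i) x - v x) ^+ 2 <= e * \1_A x.
  move=> e0; have [n0 H] := unif e e0; exists n0 => i hi x.
  have C : normc (lim_op (u i) x - lim_op (u n) x) ^+ 2 @[n --> \oo] -->
      normc (lim_op (u i) x - v x) ^+ 2.
    by apply: sqr_normcB_cvg; [exact: cRe|exact: cIm].
  rewrite -(cvg_lim _ C)//; apply: limr_le; first exact: cvgP C.
  near=> n; apply: H => //; near: n; exact: nbhs_infty_ge.
have [n1 Hn1] := vclose 1 ltr01.
(* [v] is the square integrable image with index [n1] minus a function that is at most 1 in modulus
   and vanishes outside A. *)
have sv : sqint mu v.
  have S1 : sqint mu (fun x => lim_op (u n1) x - v x).
    apply: (@sqint_le _ _ _ _ _ (fun x => 1 * \1_A x)); last exact: Hn1.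
      by apply: cmeasD => //; exact: cmeasN.
    exact: integrable_ind.
  have := sqintD (l2_sqint (lim_op (u n1))) (sqintZ (-1) S1).
  by congr sqint; apply/funext => x; rewrite mulN1r opprB addrC subrK.
exists (L2fun sv); apply/cvgrPdist_le => e e0.
have [|n0 H] := vclose (e / (a + 1)); first by rewrite divr_gt0// ltr_pwDr.
near=> n; rewrite sub0r normrN ger0_norm ?nm2_ge0//; last exact: ip2_semi_inner.
apply: (@le_trans _ _ (\int[mu]_x (e / (a + 1) * \1_A x))).
  apply: nm2_ip2_le; first exact: integrable_ind.
  by move=> x; rewrite l2B; apply: H; near: n; exact: nbhs_infty_ge.
rewrite Rintegral_ind// mulrAC ler_pdivrMr ?ltr_pwDr// ler_pM2l//.
by rewrite lerDl.
Unshelve. all: by end_near. Qed.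

(** Weak nullity tested against the kernels [ker x] gives pointwise convergence of the images to 0,
    and the pointwise bound by a multiple of the indicator of A is the dominating function. *)
Lemma lim_op_weak (w : nat -> V) : (forall n, N (w n) <= 1) ->
  (forall v, normc (ip (w n) v) @[n --> \oo] --> (0 : R)) ->
  N (lim_op (w n)) @[n --> \oo] --> (0 : R).
Proof.
move=> w1 w0; have [a0 b0] := ab_ge0.
pose K := a * b ^+ 2.
have := @dominated_convergence _ T R mu setT measurableT
  (fun n x => (normc (lim_op (w n) x) ^+ 2)%:E) (cst 0%E) (fun x => (K * \1_A x)%:E).
case=> [n|||||_ _].
- by apply/measurable_EFinP; apply: cmeas_sqr_normc; case: (l2_sqint (lim_op (w n))).
- exact: measurable_cst.
- apply: nearW => x _.
  have [xA|xA] := boolP (x \in A); last first.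
    have -> : (fun n => (normc (lim_op (w n) x) ^+ 2)%:E) = cst 0%E.
      by apply/funext => n; rewrite lim_op_out// ComplexField.Normc.normc0 expr0n.
    exact: cvg_cst.
  have -> : (fun n => (normc (lim_op (w n) x) ^+ 2)%:E) =
      EFin \o (fun n => normc (ip (w n) (ker x)) ^+ 2).
    by apply/funext => n; rewrite lim_op_ker.
  by apply: cvg_EFin; [exact: nearW|exact: sqr_cvg0 (w0 (ker x))].
- exact: integrable_ind.
- apply: nearW => x n _ /=; rewrite lee_fin ger0_norm ?sqr_ge0//.
  apply: le_trans (sqr_lim_op_le _ _) _; rewrite mulrC ler_wpM2r//.
  by rewrite ler_piMr// mulr_ge0// sqr_ge0.
rewrite integral0 => /fine_cvgP[_]; apply: cvg_trans; apply: near_eq_cvg.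
by apply: nearW => n; rewrite nm2_ip2E.
Qed.

Lemma lim_op_compact_positive : compact_positive ip lim_op.
Proof.
split; [split; [exact: lim_op_linear|exact: lim_op_sym]| | |exact: lim_op_complete|exact: lim_op_weak].
- split=> [u|u u0].
    by rewrite ip_lim_op_nm2/= nm2_ge0//; exact: ip2_semi_inner.
  (* The transform sees [u] only up to a.e. equality, so it vanishes identically and the image is 0
     at every point. *)
  have F0 : chi B (transform (chi A u)) = (fun=> 0).
    have u0ae := (nm2_ip2_eq0 u).1 u0.
    apply/funext => xi; rewrite /chi [transform _ _](_ : _ = 0) ?mulr0//.
    rewrite /transform -[RHS](_ : cint mu (fun=> 0) = 0); last by rewrite cint_real Rintegral_cst// mul0r.
    apply: ae_eq_cint.
    + exact: (cintble_transform xi (u_int u)).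
    + by apply: cintble_real; exact: integrable0.
    + by apply: filterS u0ae => x ux; rewrite /chi ux !mulr0.
  apply: l2_ext => x; rewrite lim_opE /limited F0 /chi /cotransform.
  by under [X in cint _ X]eq_fun do rewrite mulr0; rewrite cint_real Rintegral_cst// mul0r mulr0.
- exists (a * b * (a * b)) => u; have [a0 b0] := ab_ge0.
  apply: le_trans (nm2_lim_op_le_band u) _; rewrite -[leRHS]mulrA ler_wpM2l ?mulr_ge0//.
  exact: nm2_band_le.
Qed.

Lemma Rintegral_sum (f : nat -> T -> R) n :
  (forall i, mu.-integrable setT (EFin \o f i)) ->
  mu.-integrable setT (EFin \o (fun x => \sum_(i < n) f i x)) /\
  \int[mu]_x (\sum_(i < n) f i x) = \sum_(i < n) \int[mu]_x f i x.
Proof.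
move=> If; elim: n => [|n [I1 IH]].
  rewrite big_ord0; split; last by under eq_Rintegral do rewrite big_ord0; rewrite Rintegral_cst// mul0r.
  rewrite (_ : _ \o _ = cst 0%E); first exact: integrable0.
  by apply/funext => x /=; rewrite big_ord0.
have -> : (fun x => \sum_(i < n.+1) f i x) = (fun x => \sum_(i < n) f i x + f n x).
  by apply/funext => x; rewrite big_ord_recr.
rewrite big_ord_recr /= RintegralD// IH; split => //.
exact: (integrableD measurableT I1 (If n)).
Qed.

Section orthonormal.
Variable e : nat -> V.
Hypotheses (e01 : forall i, N (e i) = 1 \/ e i = 0)
  (eort : forall i j, i != j -> ip (e i) (e j) = 0).

Lemma nm2_residual (u : V) n : let v := u - \sum_(i < n) ip u (e i) *: e i in
  (forall i, (i < n)%N -> ip v (e i) = 0) /\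
  N u = N v + \sum_(i < n) normc (ip u (e i)) ^+ 2.
Proof.
have ipP := @ip2_semi_inner _ T R mu.
move=> v; have v0 i : (i < n)%N -> ip v (e i) = 0.
  move=> ni; rewrite /v ipBl// ip_suml// (bigD1 (Ordinal ni))//= big1 ?addr0; last first.
    by move=> j ji; rewrite ipZl// eort ?mulr0// (inj_eq val_inj).
  rewrite ipZl//; have [h|->] := e01 i; last by rewrite ip0r// mul0r subr0.
  by rewrite ipuuE// h mulr1 subrr.
split => //.
have -> : u = v + \sum_(i < n) ip u (e i) *: e i by rewrite /v subrK.
rewrite nm2D// [ip v _](_ : _ = 0) ?mulr0 ?addr0; last first.
  by rewrite ip_sumr// big1// => i _; rewrite ipZr// v0// mulr0.
rewrite subrK; congr (_ + _).
rewrite {1}/nm2 ip_suml// -[RHS](_ : complex.Re (\sum_(i < n) (normc (ip u (e i)) ^+ 2)%:C) = _); last first.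
  by rewrite -rmorph_sum.
congr complex.Re; apply: eq_bigr => i _; rewrite ipZl//.
have [h|h] := e01 i; last by rewrite h !ip0r// ComplexField.Normc.normc0 expr0n mul0r.
rewrite ip_sumr// (bigD1 i)//= big1 ?addr0; last first.
  by move=> j ji; rewrite ipZr// eort ?mulr0// eq_sym (inj_eq val_inj).
by rewrite ipZr// ipuuE// h mulr1 mul_conjc.
Qed.

Lemma bessel (u : V) n : \sum_(i < n) normc (ip u (e i)) ^+ 2 <= N u.
Proof.
have [_ ->] := nm2_residual u n; rewrite lerDr nm2_ge0//; exact: ip2_semi_inner.
Qed.

Let bE3 (xi x : T) : normc (E (x, xi)) <= 1.
Proof. by rewrite E1. Qed.

(** At a fixed xi in B, [band (e i) xi] is up to conjugation the inner product of [e i] with a wave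
    cut off to A, whose squared norm is a. Bessel's inequality bounds the sum over i by a, and
    integration over B gives the product. *)
Lemma trace_le n : \sum_(i < n) N (band (e i)) <= a * b.
Proof.
have ipP := @ip2_semi_inner _ T R mu.
have It i : mu.-integrable setT (EFin \o (fun x => normc (band (e i) x) ^+ 2)).
  by case: (l2_sqint (band (e i))).
have [Is Es] := @Rintegral_sum (fun i x => normc (band (e i) x) ^+ 2) n It.
under eq_bigr do rewrite nm2_ip2E; rewrite -Es.
apply: (@le_trans _ _ (\int[mu]_x (a * \1_B x))); last by rewrite Rintegral_ind.
apply: le_Rintegral => //.
  exact: integrable_ind.
move=> xi _; pose g : V := L2fun (chi_sqint mA A_fin (cmeas_E1 xi) (bE3 xi)).
have Ng : N g = a.
  rewrite nm2_ip2E -[a]mul1r -(Rintegral_ind mA A_fin); apply: eq_Rintegral => y _ /=.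
  by rewrite [normc _]normc_chi E1 mulr1 expr2 ind_idem mul1r.
have bg i : normc (band (e i) xi) ^+ 2 = \1_B xi * normc (ip g (e i)) ^+ 2.
  rewrite [normc _]normc_chi exprMn [\1_B xi ^+ 2]expr2 ind_idem; congr (_ * _ ^+ 2).
  rewrite (ipC ipP (e i)) normc_conjc /transform /ip2; congr (normc (cint _ _)).
  by apply/funext => x; rewrite [g x]/= chiJ /chi; ring.
under eq_bigr do rewrite bg.
by rewrite -mulr_sumr mulrC ler_wpM2r// -Ng; exact: bessel.
Qed.

End orthonormal.

Section hilbert_schmidt.
Variables (l : nat -> R) (e : nat -> V).
Hypotheses (l0 : forall n, 0 <= l n)
  (Te : forall n, lim_op (e n) = (l n)%:C *: e n)
  (e01 : forall n, (0 < l n /\ N (e n) = 1) \/ (l n = 0 /\ e n = 0))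
  (eort : forall i j, i != j -> ip (e i) (e j) = 0)
  (Tl : forall n u, (forall i, (i < n)%N -> ip u (e i) = 0) ->
      N (lim_op u) <= l n ^+ 2 * N u).

Let e1 i : N (e i) = 1 \/ e i = 0.
Proof. by have [[_ h]|[_ h]] := e01 i; [left|right]. Qed.

Lemma nm2_band_eigen n : N (band (e n)) = l n.
Proof.
have ipP := @ip2_semi_inner _ T R mu.
have := ip_lim_op_nm2 (e n); rewrite Te ipZl// ipuuE// -rmorphM => -[<-].
have [[_ ->]|[-> _]] := e01 n; by rewrite ?mulr1 ?mul0r.
Qed.

Lemma eigenvalue_sum_le n : \sum_(i < n) l i <= a * b.
Proof. by under eq_bigr do rewrite -nm2_band_eigen; exact: trace_le. Qed.

(* The part of the kernel orthogonal to the first n eigenfunctions is small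
   because it is reproduced by the operator, whose norm there is at most l n. *)
Lemma nm2_ker_le y n : y \in A ->
  N (ker y) <= l n * b + \sum_(i < n) l i ^+ 2 * normc (e i y) ^+ 2.
Proof.
move=> yA; have ipP := @ip2_semi_inner _ T R mu; have [a0 b0] := ab_ge0.
have [v0 ->] := nm2_residual e1 eort (ker y) n.
set v := ker y - _ in v0 *.
apply: lerD; last first.
  apply: ler_sum => i _; rewrite (ipC ipP (e i)) normc_conjc -lim_op_ker// Te.
  by rewrite [(_ *: _ : V) y]l2Z ComplexField.Normc.normcM normc_real exprMn real_normK ?num_real.
(* The reproducing property and orthogonality of [v] to the subtracted part give S v (y) = N v. Then
   (N v)^2 <= b N(band v) by [h1], and N(band v) <= l_n N v by [h2], since N(band v) = <S v, v>. *)
have vE : lim_op v y = (N v)%:C.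
  rewrite lim_op_ker// -ipuuE// {3}/v ipBr// ip_sumr// big1 ?subr0// => i _.
  by rewrite ipZr// v0// mulr0.
have h1 := sqr_lim_op_le_band v y.
rewrite vE normc_real real_normK ?num_real// indicE yA mul1r in h1.
have h2 : N (band v) <= l n * N v.
  have := Re_ip_le ipP (lim_op v) v; rewrite ip_lim_op_nm2 /= => h.
  rewrite -(ler_pXn2r (_ : 0 < 2)%N) ?nnegrE ?mulr_ge0 ?nm2_ge0//.
  apply: le_trans h _; rewrite exprMn [N v ^+ 2]expr2 mulrA ler_wpM2r ?nm2_ge0//.
  exact: Tl.
have [vp|] := ltP 0 (N v); last first.
  by move/le_trans; apply; rewrite mulr_ge0.
rewrite -(ler_pM2r vp) -expr2 (le_trans h1)//.
by rewrite [l n * b]mulrC -mulrA ler_wpM2l.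
Qed.

Lemma cmeas_ker : cmeas (fun z : T * T => ker z.1 z.2).
Proof.
have -> : (fun z : T * T => ker z.1 z.2) = (fun z => (\1_A z.2)%:C * cint mu
  (fun xi => E (z.2, xi) * ((\1_B xi)%:C * conjc (E (z.1, xi))))) by [].
apply: cmeasM.
  by apply: cmeas_real; exact: (measurable_indic_comp _ measurable_snd).
apply: (@cmeas_cint _ _ (T * T)%type T R mu (fun p =>
  E (p.1.2, p.2) * ((\1_B p.2)%:C * conjc (E (p.1.1, p.2))))).
have m11 : measurable_fun setT (fun p : T * T * T => p.1.1).
  exact: (measurableT_comp measurable_fst measurable_fst).
have m12 : measurable_fun setT (fun p : T * T * T => p.1.2).
  exact: (measurableT_comp measurable_snd measurable_fst).
apply: cmeasM.
  by apply: cmeas_comp mE; exact: measurable_fun_pair.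
apply: cmeasM.
  by apply: cmeas_real; exact: (measurable_indic_comp _ measurable_snd).
by apply: cmeasJ; apply: cmeas_comp mE; exact: measurable_fun_pair.
Qed.

(** The pointwise kernel bound integrated over A. Keeping the remainder [l n * (a * b)] at a finite
    n replaces the Hilbert-Schmidt identity. *)
Lemma hilbert_schmidt_le n :
  (\int[mu]_y \int[mu]_z ((\1_A y * normc (ker y z) ^+ 2)%:E) <=
    (l n * (a * b) + \sum_(i < n) l i ^+ 2)%:E)%E.
Proof.
have ipP := @ip2_semi_inner _ T R mu.
pose g y := l n * b * \1_A y + \sum_(i < n) l i ^+ 2 * normc (e i y) ^+ 2.
have Ie i : mu.-integrable setT (EFin \o (fun y => l i ^+ 2 * normc (e i y) ^+ 2)).
  by have [_ h] := l2_sqint (e i); exact: (integrableZl measurableT _ h).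
have [Is Es] := @Rintegral_sum _ n Ie.
have Ig : mu.-integrable setT (EFin \o g).
  exact: (integrableD measurableT (integrable_ind mA A_fin _) Is).
apply: (@le_trans _ _ (\int[mu]_y (g y)%:E)%E).
  apply: ge0_le_integral => //.
  - by move=> y _; apply: integral_ge0 => z _; rewrite lee_fin mulr_ge0// sqr_ge0.
  - apply: (@measurable_fun_fubini_tonelli_F _ _ T T R mu
      (fun p => (\1_A p.1 * normc (ker p.1 p.2) ^+ 2)%:E)).
      apply/measurable_EFinP; apply: measurable_funM.
        exact: (measurable_indic_comp mA measurable_fst).
      exact: cmeas_sqr_normc cmeas_ker.
    by move=> p; rewrite lee_fin mulr_ge0// sqr_ge0.
  - exact: measurable_int Ig.
  move=> y _; have [yA|yA] := boolP (y \in A); last first.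
    rewrite indicE (negbTE yA); under eq_integral do rewrite mul0r.
    rewrite integral0 lee_fin /g addr_ge0 ?mulr_ge0//; first by case: ab_ge0.
    by apply: sumr_ge0 => i _; rewrite mulr_ge0// sqr_ge0.
  rewrite indicE yA; under eq_integral do rewrite mul1r.
  have [_ Ik] := l2_sqint (ker y).
  have -> : (\int[mu]_z (normc (ker y z) ^+ 2)%:E = (N (ker y))%:E)%E.
    by rewrite nm2_ip2E /Rintegral fineK//; exact: integrable_fin_num Ik.
  by rewrite lee_fin /g indicE yA mulr1; exact: nm2_ker_le.
rewrite -[leLHS]fineK; last exact: integrable_fin_num Ig.
rewrite lee_fin; change (\int[mu]_y g y <= l n * (a * b) + \sum_(i < n) l i ^+ 2).
rewrite /g RintegralD//; last exact: integrable_ind.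
rewrite Rintegral_ind// Es -mulrA (mulrC b) lerD2l; apply: ler_sum => i _.
have [_ h] := l2_sqint (e i); rewrite RintegralZl// -nm2_ip2E.
by have [->|->] := e1 i; rewrite ?mulr1// nm2_0// mulr0 sqr_ge0.
Qed.

End hilbert_schmidt.

(** By monotonicity, [n * l n] is at most the n-th partial sum. *)
Lemma nonincreasing_summable_cvg0 (l : nat -> R) (M : R) : (forall n, 0 <= l n) ->
  nonincreasing_seq l -> (forall n, \sum_(i < n) l i <= M) -> l @ \oo --> (0 : R).
Proof.
move=> l0 ld lM; apply/cvgrPdist_lt => e e0.
have M0 : 0 <= M by have := lM 0%N; rewrite big_ord0.
near=> n; rewrite sub0r normrN ger0_norm//.
have h : n%:R * l n <= M.
  apply: le_trans (lM n); rewrite -[X in X%:R * _](card_ord n) mulr_natl -sumr_const.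
  by apply: ler_sum => i _; apply: ld; exact: ltnW.
have n1 : M / e < n%:R.
  near: n; exists (Num.truncn (M / e)).+1 => // k /= hk.
  apply: lt_le_trans (truncnS_gt _) _; by rewrite ler_nat.
have n0 : 0 < n%:R :> R by apply: le_lt_trans n1; rewrite divr_ge0// ltW.
rewrite -(ltr_pM2l n0); apply: le_lt_trans h _.
by rewrite -ltr_pdivrMr.
Unshelve. all: by end_near. Qed.

(** The last clause keeps a unit vector behind each positive eigenvalue, so that a norm estimate for
    [band] can later bound the eigenvalues by 1. *)
Theorem limited_spectrum : exists l : nat -> R, [/\
  (forall n, 0 <= l n) /\ nonincreasing_seq l,
  forall mu0 k, 0 < mu0 ->
    (exists E0 : 'I_k -> V, (forall i, approx_eigen ip lim_op mu0 (E0 i)) /\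
      forall c : 'I_k -> R[i], N (\sum_(i < k) c i *: E0 i) = 0 -> forall i, c i = 0) <->
    (`I_k #<= [set n | l n = mu0])%card,
  forall n, \sum_(i < n) l i <= a * b,
  forall n, (\int[mu]_y \int[mu]_z ((\1_A y * normc (ker y z) ^+ 2)%:E) <=
    (l n * (a * b) + \sum_(i < n) l i ^+ 2)%:E)%E &
  forall n, 0 < l n -> exists u, N u = 1 /\ N (band u) = l n].
Proof.
have ipP := @ip2_semi_inner _ T R mu.
have [l [e [l0 ld Te [e01 eort] Tl]]] := compact_positive_spectral ipP lim_op_compact_positive.
have ls := eigenvalue_sum_le Te e01 eort.
exists l; split => //.
- move=> m k m0; apply: (eigenspace_dimension ipP lim_op_compact_positive l0 Te e01 eort Tl) => //.
  exact: nonincreasing_summable_cvg0 ls.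
- exact: hilbert_schmidt_le.
- move=> n ln; exists (e n); split; last exact: nm2_band_eigen.
  by have [[]//|[h _]] := e01 n; rewrite h ltxx in ln.
Qed.

End limited_operator.

(** * Change of variables *)

Section change_of_measure.
Context d1 d2 (X : measurableType d1) (Y : measurableType d2) (R : realType)
  (m1 : {measure set X -> \bar R}) (m2 : {measure set Y -> \bar R}).
Variables (phi : X -> Y) (mphi : measurable_fun setT phi).

Lemma ge0_integral_transport (k : {nonneg R}) (g : Y -> \bar R) :
  (forall S, measurable S -> m1 (phi @^-1` S) = (k%:num%:E * m2 S)%E) ->
  measurable_fun setT g -> (forall y, (0 <= g y)%E) ->
  (\int[m1]_x g (phi x) = k%:num%:E * \int[m2]_y g y)%E.
Proof.
move=> Hk mg g0.
pose mphi_mixin := isMeasurableFun.Build _ _ _ _ _ mphi.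
pose phi' : {mfun X >-> Y} := HB.pack phi mphi_mixin.
rewrite -ge0_integral_mscale//.
transitivity (\int[pushforward m1 phi']_y g y)%E.
  by rewrite ge0_integral_pushforward.
by apply: eq_measure_integral => S mS _; rewrite /mscale/= /pushforward Hk.
Qed.

Lemma ge0_integral_preserving (g : Y -> \bar R) :
  (forall S, measurable S -> m1 (phi @^-1` S) = m2 S) ->
  measurable_fun setT g -> (forall y, (0 <= g y)%E) ->
  (\int[m1]_x g (phi x) = \int[m2]_y g y)%E.
Proof.
move=> H mg g0; rewrite (@ge0_integral_transport 1%:nng) ?mul1e// => S mS.
by rewrite mul1e H.
Qed.

Lemma integrable_preserving (g : Y -> R) :
  (forall S, measurable S -> m1 (phi @^-1` S) = m2 S) ->
  m2.-integrable setT (EFin \o g) ->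
  m1.-integrable setT (EFin \o (g \o phi)) /\ \int[m1]_x g (phi x) = \int[m2]_y g y.
Proof.
move=> H /integrableP[mg Ig].
have mh : measurable_fun setT (EFin \o (g \o phi)) by exact: (measurableT_comp mg mphi).
split.
  apply/integrableP; split => //.
  rewrite (@ge0_integral_preserving (fun y => `|(g y)%:E|%E))//.
  exact: measurableT_comp.
rewrite /Rintegral; congr fine; rewrite integralE [RHS]integralE.
have mp := measurable_funepos mg; have mn := measurable_funeneg mg.
congr (_ - _)%E.
  transitivity (\int[m1]_x ((EFin \o g)^\+)%E (phi x))%E.
    by apply: eq_integral => x _; rewrite !funeposE.
  by rewrite (@ge0_integral_preserving ((EFin \o g)^\+)%E)// => y; exact: funepos_ge0.
transitivity (\int[m1]_x ((EFin \o g)^\-)%E (phi x))%E.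
  by apply: eq_integral => x _; rewrite !funenegE.
by rewrite (@ge0_integral_preserving ((EFin \o g)^\-)%E)// => y; exact: funeneg_ge0.
Qed.

Lemma cint_preserving (g : Y -> R[i]) :
  (forall S, measurable S -> m1 (phi @^-1` S) = m2 S) ->
  cintble m2 g -> cintble m1 (g \o phi) /\ cint m1 (g \o phi) = cint m2 g.
Proof.
move=> H [g1 g2].
have [h1 e1] := integrable_preserving H g1; have [h2 e2] := integrable_preserving H g2.
by split; [split|congr (_ +i* _)].
Qed.

End change_of_measure.

(** * Affine maps and Lebesgue measure on Borel sets *)

Section affine1.
Context {R : realType}.
Local Notation lam := (@lebesgue_measure R).
Local Notation mR := (measurableTypeR R).

Lemma measurable_affine (a b : R) : measurable_fun setT (fun x : mR => a * x + b : mR).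
Proof. by apply: measurable_funD => //; exact: measurable_funM. Qed.

Lemma lebesgue_affine_pos (a b : R) (S : set mR) : 0 < a -> measurable S ->
  lam ((fun x : mR => a * x + b : mR) @^-1` S) = ((a^-1)%:E * lam S)%E.
Proof.
move=> a0 mS.
have a0' : 0 <= a by exact: ltW.
pose phi := fun x : mR => a * x + b : mR.
pose pm : {measure set mR -> \bar R} :=
  measure_function_pushforward__canonical__measure_function_Measure lam (measurable_affine a b).
pose m := mscale (NngNum a0') pm.
(* [m] is a times the image of Lebesgue measure; the two agree on half-open intervals, and
   uniqueness of Lebesgue measure applies. *)
have H : lam S = m S.
  apply: lebesgue_measure_unique => //= _ [[u v] _ <-].
  rewrite /m /mscale /= /pushforward.
  have -> : phi @^-1` `]u, v]%classic = `](u - b) / a, (v - b) / a]%classic.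
    apply/seteqP; split => x /=; rewrite !in_itv/=;
      by rewrite ltr_pdivrMr// ler_pdivlMr// ltrBlDr lerBrDr mulrC.
  rewrite !lebesgue_measure_itv/= !lte_fin ltr_pM2r ?invr_gt0// ltrD2r.
  case: ifPn => _; last by rewrite mule0.
  rewrite -!EFinB -EFinM; congr _%:E; field; exact: lt0r_neq0.
rewrite H /m /mscale /= muleA -EFinM mulVf ?mul1e//; exact: lt0r_neq0.
Qed.

Lemma lebesgue_affine (a b : R) (S : set mR) : a != 0 -> measurable S ->
  lam ((fun x : mR => a * x + b : mR) @^-1` S) = ((`|a|^-1)%:E * lam S)%E.
Proof.
move=> a0 mS; have [an|ap] := ltP a 0; last first.
  by rewrite ger0_norm// lebesgue_affine_pos// lt_neqAle eq_sym a0.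
have mS' : measurable ((fun x : mR => - a * x + b : mR) @^-1` S).
  by rewrite -[X in measurable X]setTI; exact: measurable_affine.
rewrite ltr0_norm// -(@lebesgue_affine_pos (- a) b)// ?oppr_gt0// -[RHS]lebesgue_measureN//.
rewrite /pushforward; congr (lam _); apply/seteqP; split => x /=;
  by rewrite mulrNN.
Qed.

End affine1.

Section borel.
Context {R : realType}.
Local Notation lam := (@lebesgue_measure R).
Local Notation mR := (measurableTypeR R).
Local Notation tup d := (d.-tuple mR).
Local Notation bl d := (@borel_lebesgue R d).

Lemma borel_lebesgueS d (S : set (tup d.+1)) :
  bl d.+1 S = (lam \x bl d)%E (@cons_pair R d @^-1` S).
Proof. by []. Qed.

Lemma borel_lebesgue0 (S : set (tup 0)) : bl 0 S = \d_([tuple] : tup 0) S.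
Proof. by []. Qed.

Lemma integral_blS d (g : tup d.+1 -> \bar R) : measurable_fun setT g ->
  (forall t, (0 <= g t)%E) ->
  (\int[bl d.+1]_t g t = \int[lam]_x \int[bl d]_t g (cons_pair (x, t)))%E.
Proof.
move=> mg g0.
rewrite -(@ge0_integral_preserving _ _ _ _ R (lam \x bl d)%E (bl d.+1) (@cons_pair R d)
  (@measurable_cons_pair R d))//.
rewrite fubini_tonelli1//.
exact: (measurableT_comp mg (@measurable_cons_pair R d)).
Qed.

Lemma integral_bl0 (g : tup 0 -> \bar R) : measurable_fun setT g ->
  (\int[bl 0]_t g t = g [tuple])%E.
Proof.
move=> mg; have -> : (\int[bl 0]_t g t = \int[\d_([tuple] : tup 0)]_t g t)%E.
  by apply: eq_measure_integral.
by rewrite integral_dirac// diracT mul1e.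
Qed.

Definition affine d (a : R) (b : tup d) (t : tup d) : tup d :=
  [tuple a * tnth t i + tnth b i | i < d].

Lemma measurable_fun_tuple d d0 (X : measurableType d0) (f : X -> tup d) :
  (forall i, measurable_fun setT (fun x => tnth (f x) i)) -> measurable_fun setT f.
Proof. by move=> h; apply/measurable_fun_tnthP. Qed.

Lemma measurable_affineT d (a : R) (b : tup d) : measurable_fun setT (affine a b).
Proof.
apply: measurable_fun_tuple => i; rewrite /affine.
under eq_fun do rewrite tnth_mktuple.
exact: (measurableT_comp (measurable_affine a (tnth b i)) (measurable_tnth i)).
Qed.

Lemma tnth_cons0 d (p : mR * tup d) : tnth (cons_pair p) ord0 = p.1.
Proof. by rewrite (tnth_nth 0). Qed.

Lemma tnth_consS d (p : mR * tup d) j : tnth (cons_pair p) (lift ord0 j) = tnth p.2 j.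
Proof. by rewrite !(tnth_nth 0). Qed.

Lemma tnth_behead_lift d (b : tup d.+1) j : tnth [tuple of behead b] j = tnth b (lift ord0 j).
Proof. by rewrite !(tnth_nth 0) /= nth_behead. Qed.

Lemma affine_cons d (a : R) (b : tup d.+1) (x : mR) (t : tup d) :
  affine a b (cons_pair (x, t)) =
  cons_pair (a * x + thead b : mR, affine a [tuple of behead b] t).
Proof.
apply: eq_from_tnth => i; rewrite tnth_mktuple.
have [j ->|->] := unliftP ord0 i; last by rewrite !tnth_cons0.
by rewrite !tnth_consS /= tnth_mktuple tnth_behead_lift.
Qed.

Lemma integral_affine d (a : R) (b : tup d) (g : tup d -> \bar R) : a != 0 ->
  measurable_fun setT g -> (forall t, (0 <= g t)%E) ->
  (\int[bl d]_t g (affine a b t) = ((`|a| ^+ d)^-1)%:E * \int[bl d]_t g t)%E.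
Proof.
move=> a0; elim: d b g => [|d IH] b g mg g0.
  rewrite !integral_bl0//; last exact: (measurableT_comp mg (measurable_affineT a b)).
  rewrite expr0 invr1 mul1e; by congr g; apply: eq_from_tnth => -[].
have ma := measurableT_comp mg (measurable_affineT a b).
rewrite integral_blS// [in RHS]integral_blS//.
have mgc : measurable_fun setT (fun p : mR * tup d => g (cons_pair p)).
  exact: (measurableT_comp mg (@measurable_cons_pair R d)).
have E x : (\int[bl d]_t g (affine a b (cons_pair (x, t))) =
    ((`|a| ^+ d)^-1)%:E * \int[bl d]_t g (cons_pair ((a * x + thead b)%R : mR, t)))%E.
  rewrite -(IH [tuple of behead b] (fun t => g (cons_pair ((a * x + thead b)%R : mR, t))))//.
    by apply: eq_integral => t _; rewrite affine_cons.
  exact: (measurableT_comp mgc (measurable_pair1 _)).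
under eq_integral do rewrite E.
have mI : measurable_fun setT (fun x : mR => \int[bl d]_t g (cons_pair (x, t)))%E.
  exact: (measurable_fun_fubini_tonelli_F (fun p : mR * tup d => g (cons_pair p))).
have k0 : 0 <= `|a|^-1 by rewrite invr_ge0.
rewrite ge0_integralZl//; last 2 first.
- exact: (measurableT_comp mI (measurable_affine a (thead b))).
- by move=> x _; exact: integral_ge0.
rewrite (@ge0_integral_transport _ _ _ _ R lam lam _ (measurable_affine a (thead b)) (NngNum k0)
  (fun x => \int[bl d]_t g (cons_pair (x, t)))%E)//=; last 2 first.
- by move=> S mS; exact: lebesgue_affine.
- by move=> x; exact: integral_ge0.
by rewrite muleA -EFinM -invfM -exprSr.
Qed.

(** Needed for hyperplanes, the boundaries of the half-spaces that generate the Borel sets. *)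
Lemma bl_coord_null d (i : 'I_d) (Y : set mR) : measurable Y -> lam Y = 0%E ->
  bl d [set t | Y (tnth t i)] = 0%E.
Proof.
elim: d i => [[]//|d IH] i mY Y0; rewrite borel_lebesgueS.
have [j ->|->] := unliftP ord0 i.
  have -> : @cons_pair R d @^-1` [set t | Y (tnth t (lift ord0 j))] =
      setT `*` [set t | Y (tnth t j)].
    by apply/seteqP; split => -[x t] /=; rewrite tnth_consS => // -[].
  rewrite product_measure1E//.
    by rewrite [X in (_ * X)%E](_ : _ = 0%E) ?mule0//; exact: IH.
  by rewrite -[X in measurable X]setTI; exact: measurable_tnth.
have -> : @cons_pair R d @^-1` [set t | Y (tnth t ord0)] = Y `*` setT.
  by apply/seteqP; split => -[x t] /=; rewrite tnth_cons0 => // -[].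
by rewrite product_measure1E//; rewrite [X in (X * _)%E](_ : _ = 0%E) ?mul0e.
Qed.

Lemma bl_box_fin d (r : R) : (bl d [set t : tup d | forall i, (-r <= tnth t i <= r)%R] < +oo)%E.
Proof.
elim: d => [|d IH].
  by rewrite borel_lebesgue0 diracE ltry.
rewrite borel_lebesgueS.
have -> : @cons_pair R d @^-1` [set t | forall i, - r <= tnth t i <= r] =
    `[- r, r]%classic `*` [set t | forall i, - r <= tnth t i <= r].
  apply/seteqP; split => -[x t] /=.
    move=> h; split; first by have := h ord0; rewrite in_itv/= tnth_cons0.
    by move=> i; have := h (lift ord0 i); rewrite tnth_consS.
  rewrite in_itv /= => -[hx ht] i; have [j ->|->] := unliftP ord0 i.
    by rewrite tnth_consS.
  by rewrite tnth_cons0.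
have mbox : measurable [set t : tup d | forall i, - r <= tnth t i <= r].
  have -> : [set t : tup d | forall i, - r <= tnth t i <= r] =
      \bigcap_(i in [set: 'I_d]) ((fun t => tnth t i) @^-1` `[-r, r]%classic).
    apply/seteqP; split => t /=; first by move=> h i _; rewrite /= in_itv/=.
    by move=> h i; have := h i I; rewrite /= in_itv/=.
  apply: fin_bigcap_measurable => // i _.
  by rewrite -[X in measurable X]setTI; exact: measurable_tnth.
rewrite product_measure1E// lte_mul_pinfty// ?ge0_fin_numE//.
  by rewrite /= lebesgue_measure_itv /=; case: ifP => _; rewrite -?EFinB ltry.
Qed.

End borel.

(** * The completed Lebesgue measure: scaling and Borel hulls *)

HB.instance Definition _ (R : realType) (d : nat) := Measure_isSigmaFinite.Build _ _ _
  (@completed_measure_extension _ _ R (@borel_lebesgue R d))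
  (completed_measure_extension_sigma_finite (sigma_finiteT (@borel_lebesgue R d))).

Section lebesgue_space.
Context {R : realType}.
Local Notation lam := (@lebesgue_measure R).
Local Notation mR := (measurableTypeR R).
Local Notation tup d := (d.-tuple mR).
Local Notation bl d := (@borel_lebesgue R d).
Local Notation Rd d := (@Rd R d).

Definition lebs d : {sigma_finite_measure set (Rd d) -> \bar R} :=
  [the {sigma_finite_measure set _ -> \bar R} of
    @completed_measure_extension _ _ R (bl d)].

Lemma borel_Rd d (S : set (tup d)) : measurable S -> measurable (S : set (Rd d)).
Proof. by move=> mS; apply: sub_caratheodory; exact: sub_sigma_algebra. Qed.

Lemma lebs_borel d (S : set (tup d)) : measurable S -> lebs d (S : set (Rd d)) = bl d S.
Proof. by move=> mS; exact: measurable_mu_extE. Qed.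

Definition ofRd d (x : Rd d) : tup d := x.

Lemma measurable_ofRd d : measurable_fun setT (@ofRd d).
Proof. by move=> _ S mS; rewrite setTI; exact: borel_Rd. Qed.

Lemma lebs_ofRd d (S : set (tup d)) : measurable S -> lebs d (@ofRd d @^-1` S) = bl d S.
Proof. exact: lebs_borel. Qed.

Lemma bl_affine d (a : R) (b : tup d) (S : set (tup d)) : a != 0 -> measurable S ->
  bl d (affine a b @^-1` S) = (((`|a| ^+ d)^-1)%:E * bl d S)%E.
Proof.
move=> a0 mS; have mpre : measurable (affine a b @^-1` S).
  by rewrite -[X in measurable X]setTI; exact: measurable_affineT.
have mi : measurable_fun setT (fun t : tup d => (\1_S t : R)%:E).
  by apply/measurable_EFinP; exact: measurable_indic.
transitivity (\int[bl d]_t (\1_S (affine a b t))%:E)%E.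
  transitivity (\int[bl d]_t (\1_(affine a b @^-1` S) t)%:E)%E.
    by rewrite integral_indic// setIT.
  by apply: eq_integral.
rewrite (@integral_affine R d a b (fun t => (\1_S t)%:E))//.
by rewrite integral_indic// setIT.
Qed.

Lemma coord_scale d c (x : Rd d) i : Defs.coord (scale c x) i = c * Defs.coord x i.
Proof. exact: tnth_mktuple. Qed.

Let zt d : tup d := [tuple 0 | _ < d].

Lemma scaleE d c (x : Rd d) : ofRd (scale c x) = affine c (zt d) (ofRd x).
Proof. by apply: eq_from_tnth => i; rewrite !tnth_mktuple addr0. Qed.

Lemma scaleK d c : c != 0 -> cancel (@scale R d c) (scale c^-1).
Proof.
move=> c0 x; apply: eq_from_tnth => i; rewrite -!/(Defs.coord _ _) !coord_scale.
by rewrite mulrA mulVf// mul1r.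
Qed.

Lemma dilateE d c (A : set (Rd d)) : c != 0 -> dilate c A = scale c^-1 @^-1` A.
Proof.
move=> c0; apply/seteqP; split => x /=.
  by move=> [y Ay <-]; rewrite scaleK.
move=> Ax; exists (scale c^-1 x) => //.
by rewrite -{1}(invrK c) scaleK// invr_eq0.
Qed.

Local Notation ext d := ((bl d)^*)%mu.

(** Scaling is proved for the outer measure, by pulling back Borel covers. It then covers all
    Lebesgue measurable sets at once, null sets included. *)
Let ext_scale_le d a (X : set (Rd d)) : 0 < a ->
  (ext d (scale a @^-1` X) <= ((a ^+ d)^-1)%:E * ext d X)%E.
Proof.
move=> a0; have ad : 0 < a ^+ d by exact: exprn_gt0.
have ad0 : a ^+ d != 0 by exact: lt0r_neq0.
suff : ((a ^+ d)%:E * ext d (scale a @^-1` X) <= ext d X)%E.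
  move=> h; apply: (@le_trans _ _ (((a ^+ d)^-1)%:E * ((a ^+ d)%:E * ext d (scale a @^-1` X)))%E).
    by rewrite muleA -EFinM mulVf// mul1e.
  by rewrite lee_pmul2l// lte_fin invr_gt0.
apply: le_ereal_inf_tmp => _ [F [mF XF] <-].
have mF' k : measurable (affine a (zt d) @^-1` F k).
  by rewrite -[X in measurable X]setTI; exact: measurable_affineT.
have -> : (\sum_(0 <= k <oo) bl d (F k) = (a ^+ d)%:E *
    \sum_(0 <= k <oo) bl d (affine a (zt d) @^-1` F k))%E.
  rewrite -nneseriesZl//.
  apply: eq_eseriesr => k _; rewrite bl_affine ?gt_eqF// ger0_norm ?(ltW a0)//.
  by rewrite muleA -EFinM divff// mul1e.
rewrite lee_pmul2l ?lte_fin//.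
apply: ereal_inf_lbound; exists (fun k => affine a (zt d) @^-1` F k) => //.
split => // x /= /XF [k _ Fk]; exists k => //=.
by rewrite -(@scaleE d a x).
Qed.

Lemma ext_scale d a (X : set (Rd d)) : 0 < a ->
  (ext d (scale a @^-1` X) = ((a ^+ d)^-1)%:E * ext d X)%E.
Proof.
move=> a0; apply/eqP; rewrite eq_le ext_scale_le//=.
have ad0 : a ^+ d != 0 by rewrite expf_neq0// gt_eqF.
have ai : 0 < a^-1 by rewrite invr_gt0.
have XE : scale a^-1 @^-1` (scale a @^-1` X) = X.
  by apply/seteqP; split => x /=; rewrite -{1}(invrK a) scaleK// invr_eq0 gt_eqF.
have := ext_scale_le (scale a @^-1` X) ai; rewrite XE exprVn invrK => h.
apply: (@le_trans _ _ (((a ^+ d)^-1)%:E * ((a ^+ d)%:E * ext d (scale a @^-1` X)))%E).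
  by rewrite lee_pmul2l ?lte_fin ?invr_gt0 ?exprn_gt0.
by rewrite muleA -EFinM mulVf// mul1e.
Qed.

Lemma measurable_scale d a : 0 < a -> measurable_fun setT (@scale R d a).
Proof.
move=> a0 _ A mA; rewrite setTI.
have {}mA : caratheodory_measurable (ext d) A := mA.
suff : caratheodory_measurable (ext d) (scale a @^-1` A) by [].
(* Scaling is invertible, so every test set is a preimage and the Caratheodory equation for A
   transfers. *)
move=> X; have [Y ->] : exists Y, X = scale a @^-1` Y.
  exists (scale a^-1 @^-1` X).
  by apply/seteqP; split => x /=; rewrite scaleK// gt_eqF.
have h1 := ext_scale Y a0; have h2 := ext_scale (Y `&` A) a0.
have h3 := ext_scale (Y `&` ~` A) a0.
apply: (etrans h1); rewrite (mA Y) ge0_muleDr ?mu_ext_ge0//.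
by congr (_ + _)%E; [exact: esym h2|exact: esym h3].
Qed.

Lemma lebs_scale d a (A : set (Rd d)) : 0 < a ->
  (lebs d (scale a @^-1` A) = ((a ^+ d)^-1)%:E * lebs d A)%E.
Proof. exact: ext_scale. Qed.

Lemma measurable_dilate d c (A : set (Rd d)) : 0 < c -> measurable A -> measurable (dilate c A).
Proof.
move=> c0 mA; rewrite dilateE ?gt_eqF// -[X in measurable X]setTI.
by apply: measurable_scale => //; rewrite invr_gt0.
Qed.

Lemma lebs_dilate d c (A : set (Rd d)) : 0 < c ->
  (lebs d (dilate c A) = (c ^+ d)%:E * lebs d A)%E.
Proof. by move=> c0; rewrite dilateE ?gt_eqF// lebs_scale ?invr_gt0// exprVn invrK. Qed.

(** Intersect Borel covers whose measures exceed that of A by at most 1/(n+1). The hull moves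
    estimates from Lebesgue sets to Borel sets, where product structure and generators are at
    hand. *)
Lemma borel_hull d (A : set (Rd d)) : measurable A -> (lebs d A < +oo)%E ->
  exists B : set (tup d), [/\ measurable B, A `<=` B & lebs d (B `\` A) = 0%E].
Proof.
move=> mA Afin.
have /choice[U HU] : forall n : nat, exists U : set (tup d), [/\ measurable U, A `<=` U &
    (bl d U <= lebs d A + (n.+1%:R^-1)%:E)%E].
  move=> n; have n0 : 0 < n.+1%:R^-1 :> R by rewrite invr_gt0.
  have Afn : ext d A \is a fin_num by rewrite ge0_fin_numE// mu_ext_ge0.
  have [_ [F [mF AF] <-] hF] := lb_ereal_inf_adherent n0 Afn.
  exists (\bigcup_k F k); split => //; first exact: bigcupT_measurable.
  apply: le_trans (ltW hF).
  exact: measure_sigma_subadditive (bigcupT_measurable _ _) _.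
exists (\bigcap_n U n); have mI : measurable (\bigcap_n U n).
  by apply: bigcapT_measurable => n; case: (HU n).
have AI : A `<=` \bigcap_n U n by move=> x Ax n _; case: (HU n) => _ h _; exact: h.
split => //.
have mIR := borel_Rd mI.
have le : (lebs d (\bigcap_n U n) <= lebs d A)%E.
  apply/lee_addgt0Pr => e e0.
  have [n _ hn] : \forall n \near \oo, n.+1%:R^-1 < e.
    by have := near_infty_natSinv_lt (PosNum e0).
  have [mU AU hU] := HU n.
  apply: le_trans (le_trans _ hU) _; last first.
    by rewrite leeD2l// lee_fin ltW// hn/=.
  rewrite -lebs_borel//; apply: le_measure; rewrite ?inE//; first exact: borel_Rd.
  by move=> x; apply.
rewrite measureD//; last by apply: le_lt_trans le Afin.
have EI : lebs d (\bigcap_n U n) = lebs d A.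
  by apply/eqP; rewrite eq_le le/=; apply: le_measure; rewrite ?inE.
transitivity (lebs d A - lebs d A)%E; last by rewrite subee// ge0_fin_numE.
by congr (_ - _)%E; [exact: EI|rewrite setIidr].
Qed.

End lebesgue_space.

(** * The Poisson kernel on the line *)

Section poisson_kernel.
Context {R : realType}.
Local Notation lam := (@lebesgue_measure R).
Local Notation mR := (measurableTypeR R).
Implicit Types (a b t w : R).

Lemma cos_even b t : cos (b * - t) = cos (b * t).
Proof. by rewrite mulrN cosN. Qed.

Section exp_cos.
Variables a b : R.
Hypothesis a0 : 0 < a.

Let D := a ^+ 2 + b ^+ 2.
Let D0 : 0 < D. Proof. by rewrite ltr_pwDl ?exprn_gt0 ?sqr_ge0. Qed.

(** A primitive of [f] that vanishes at infinity; the term [- a^-1] belongs to the summand 1 of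
    [f]. *)
Let F t := expR (- a * t) * ((b * sin (b * t) - a * cos (b * t)) / D - a^-1).
Let f t := expR (- a * t) * (1 + cos (b * t)).

Let dF t : is_derive t 1 F (f t).
Proof.
have h1 : is_derive t 1 (fun t => expR (- a * t)) (expR (- a * t) * - a).
  by apply: is_derive_eq; rewrite scaler1.
have h2 : is_derive t 1 (fun t => sin (b * t)) (cos (b * t) * b).
  by apply: is_derive_eq; rewrite scaler1.
have h3 : is_derive t 1 (fun t => cos (b * t)) (- sin (b * t) * b).
  by apply: is_derive_eq; rewrite scaler1.
rewrite /F /f; apply: is_derive_eq.
rewrite /GRing.scale/=.
have aa : a != 0 by rewrite gt_eqF.
have DD : a ^+ 2 + b ^+ 2 != 0 by rewrite gt_eqF.
by rewrite /D; field; rewrite aa DD.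
Qed.

Let cF : F t @[t --> +oo] --> (0 : R).
Proof.
pose M := (`|b| + a) / D + a^-1.
have e0 : (expR (- a * t) * M) @[t --> +oo] --> (0 : R).
  rewrite -(mul0r M); apply: cvgM; last exact: cvg_cst.
  under eq_cvg do rewrite mulNr.
  apply: (@cvg_comp _ _ _ (fun t => a * t) (fun t => expR (- t)) _ (pinfty_nbhs R)).
    exact: gt0_cvgMry.
  exact: cvgr_expR.
apply: norm_cvg0.
apply: squeeze_cvgr e0; last exact: cvg_cst.
near=> t.
rewrite normr_ge0/= /F normrM ger0_norm ?expR_ge0// ler_wpM2l ?expR_ge0//.
rewrite (le_trans (ler_normB _ _))// [`|a^-1|]ger0_norm ?invr_ge0 ?(ltW a0)// lerD2r.
rewrite normrM [`|D^-1|]ger0_norm ?invr_ge0 ?(ltW D0)// ler_wpM2r ?invr_ge0 ?(ltW D0)//.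
rewrite (le_trans (ler_normB _ _))// !normrM (ger0_norm (ltW a0)).
rewrite lerD//.
- by rewrite ler_piMr// ler_norml sin_geN1 sin_le1.
- by rewrite ler_piMr ?(ltW a0)// ler_norml cos_geN1 cos_le1.
Unshelve. all: by end_near. Qed.

(** The summand 1 makes the integrand nonnegative, as the fundamental theorem on a half-line
    requires; [fourier_expR_abs] subtracts it again. *)
Lemma integral_exp_cos :
  (\int[lam]_(t in `[0%R, +oo[) (expR (- a * t) * (1 + cos (b * t)))%:E =
   (a / (a ^+ 2 + b ^+ 2) + a^-1)%:E)%E.
Proof.
have cf : continuous f.
  move=> t; apply: cvgM.
    apply: continuous_comp; last exact: continuous_expR.
    by apply: cvgM; [exact: cvg_cst|exact: cvg_id].
  apply: cvgD; first exact: cvg_cst.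
  apply: continuous_comp; last exact: continuous_cos.
  by apply: cvgM; [exact: cvg_cst|exact: cvg_id].
rewrite (@ge0_continuous_FTC2y R f F 0 0).
- rewrite /F !mulr0 expR0 mul1r sin0 cos0 mulr0 mulr1 sub0r -EFinB.
  by congr _%:E; rewrite /D; field; rewrite !gt_eqF.
- by move=> t _; rewrite mulr_ge0 ?expR_ge0// -lerBlDl sub0r cos_geN1.
- exact: continuous_subspaceT.
- exact: cF.
- by move=> t _; case: (dF t).
- apply: cvg_at_right_filter; apply: differentiable_continuous.
  by apply/derivable1_diffP; case: (dF 0).
- by move=> t _; rewrite derive1E; apply: derive_val.
Qed.

End exp_cos.

Lemma integral_abs_exp_cos a b : 0 < a ->
  (\int[lam]_t (expR (- a * `|t|) * (1 + cos (b * t)))%:E =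
   (2 * (a / (a ^+ 2 + b ^+ 2) + a^-1))%:E)%E.
Proof.
move=> a0; rewrite ge0_symfun_integralT.
- rewrite EFinM -(integral_exp_cos _ a0) -set_itvcy; congr (_ * _)%E.
  by apply: eq_integral => t /[!inE]/=; rewrite in_itv/= andbT => t0; rewrite ger0_norm.
- by move=> t; rewrite mulr_ge0 ?expR_ge0// -lerBlDl sub0r cos_geN1.
- move=> t; apply: cvgM.
    apply: continuous_comp; last exact: continuous_expR.
    by apply: cvgM; [exact: cvg_cst|exact: norm_continuous].
  apply: cvgD; first exact: cvg_cst.
  apply: continuous_comp; last exact: continuous_cos.
  by apply: cvgM; [exact: cvg_cst|exact: cvg_id].
- by move=> t /=; rewrite normrN cos_even.
Qed.

Lemma ge0_integral_finite d (T : measurableType d) (mu : {measure set T -> \bar R})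
    (f : T -> R) (r : R) :
  measurable_fun setT f -> (forall x, 0 <= f x) -> (\int[mu]_x (f x)%:E = r%:E)%E ->
  mu.-integrable setT (EFin \o f) /\ \int[mu]_x f x = r.
Proof.
move=> mf f0 H; split; last by rewrite /Rintegral H.
apply/integrableP; split; first exact/measurable_EFinP.
under eq_integral do rewrite /= ger0_norm//.
by rewrite H ltry.
Qed.

Lemma measurable_exp_abs a : measurable_fun setT (fun t : mR => expR (- a * `|t|) : R).
Proof.
apply: (measurableT_comp (f := expR)); first exact: measurable_expR.
by apply: measurable_funM => //; exact: measurable_normr.
Qed.

Lemma measurable_cosM b : measurable_fun setT (fun t : mR => cos (b * t) : R).
Proof.
apply: (measurableT_comp (continuous_measurable_fun (@continuous_cos R))).
exact: measurable_funM.
Qed.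

Lemma measurable_sinM b : measurable_fun setT (fun t : mR => sin (b * t) : R).
Proof.
apply: (measurableT_comp (continuous_measurable_fun (@continuous_sin R))).
exact: measurable_funM.
Qed.

Lemma integrable_exp_cos a b : 0 < a ->
  lam.-integrable setT (EFin \o (fun t : mR => expR (- a * `|t|) * (1 + cos (b * t)) : R)) /\
  \int[lam]_t (expR (- a * `|t|) * (1 + cos (b * t))) =
     2 * (a / (a ^+ 2 + b ^+ 2) + a^-1).
Proof.
move=> a0; apply: ge0_integral_finite; last exact: integral_abs_exp_cos.
- apply: measurable_funM; first exact: measurable_exp_abs.
  by apply: measurable_funD => //; exact: measurable_cosM.
- by move=> t; rewrite mulr_ge0 ?expR_ge0// -lerBlDl sub0r cos_geN1.
Qed.

Lemma integrable_expR_abs a : 0 < a ->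
  lam.-integrable setT (EFin \o (fun t : mR => expR (- a * `|t|) : R)) /\
  \int[lam]_t expR (- a * `|t|) = 2 / a.
Proof.
move=> a0; apply: ge0_integral_finite; [exact: measurable_exp_abs|by move=> t; exact: expR_ge0|].
(* At frequency 0 the factor 1 + cos equals 2, so half of the previous integral is the one
   sought. *)
have /(congr1 (fun z => (2^-1)%:E * z)%E) := integral_abs_exp_cos 0 a0.
have g0 t : (0 <= (expR (- a * `|t|) * (1 + cos (0 * t)))%:E :> \bar R)%E.
  by rewrite lee_fin mulr_ge0 ?expR_ge0// -lerBlDl sub0r cos_geN1.
rewrite -ge0_integralZl//; last first.
  apply/measurable_EFinP; apply: measurable_funM; first exact: measurable_exp_abs.
  by apply: measurable_funD => //; exact: measurable_cosM.
rewrite expr0n addr0 -EFinM => H.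
transitivity (\int[lam]_t ((2^-1)%:E * (expR (- a * `|t|) * (1 + cos (0 * t)))%:E)%E)%E.
  apply: eq_integral => t _; rewrite mul0r cos0 -EFinM; congr _%:E.
  by field.
by rewrite H; congr _%:E; field; rewrite gt_eqF.
Qed.

(** The Poisson kernel of the half-plane at height e, also known as the Cauchy density. *)
Definition poisson e w := e / (pi * (e ^+ 2 + w ^+ 2)).

Lemma fourier_expR_abs e w : 0 < e ->
  cintble lam (fun t : mR => (expR (- (2 * pi * e) * `|t|))%:C * cexpi (2 * pi * (w * t))) /\
  cint lam (fun t : mR => (expR (- (2 * pi * e) * `|t|))%:C * cexpi (2 * pi * (w * t))) =
    (poisson e w)%:C.
Proof.
move=> e0; set a := 2 * pi * e; pose b := 2 * pi * w.
have p0 : 0 < pi :> R := pi_gt0 R.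
have a0 : 0 < a by rewrite !mulr_gt0.
have [I0 V0] := integrable_expR_abs a0; have [I1 V1] := integrable_exp_cos b a0.
have -> : (fun t : mR => (expR (- a * `|t|))%:C * cexpi (2 * pi * (w * t))) =
   (fun t : mR => (expR (- a * `|t|) * (1 + cos (b * t)) - expR (- a * `|t|)) +i*
     (expR (- a * `|t|) * sin (b * t))).
  apply/funext => t; rewrite /cexpi /b -!mulrA; congr (_ +i* _) => /=; ring.
have I2 : lam.-integrable setT (EFin \o (fun t : mR => expR (- a * `|t|) * sin (b * t) : R)).
  apply: le_integrable I0 => //.
    apply/measurable_EFinP/measurable_funM; [exact: measurable_exp_abs|exact: measurable_sinM].
  move=> t _; rewrite lee_fin normrM ler_piMr// ler_norml sin_geN1 sin_le1//.
(* The integrand is odd and Lebesgue measure is invariant under reflection, so the integral equals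
   its own opposite. *)
have V2 : \int[lam]_t (expR (- a * `|t|) * sin (b * t)) = 0.
  have mN : measurable_fun setT (-%R : mR -> mR) by exact: oppr_measurable.
  have [_] := integrable_preserving mN (@lebesgue_measureN R) I2.
  under eq_Rintegral do rewrite /= normrN mulrN sinN mulrN.
  rewrite RintegralN// => /eqP; rewrite eq_sym -subr_eq0 opprK -mulr2n mulrn_eq0/=.
  by move/eqP.
split; first by split => //=; exact: (integrableB _ I1 I0).
congr (_ +i* _) => //.
rewrite RintegralB// V0 V1 /poisson /a /b.
have q0 : e ^+ 2 + w ^+ 2 != 0 by rewrite gt_eqF// ltr_pwDl ?exprn_gt0 ?sqr_ge0.
have q1 : pi != 0 :> R by rewrite gt_eqF.
have q2 : (2 * pi * e) ^+ 2 + (2 * pi * w) ^+ 2 = (2 * pi) ^+ 2 * (e ^+ 2 + w ^+ 2) by ring.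
rewrite q2; have e1 : e != 0 by rewrite gt_eqF.
move: q0; set Q := _ + w ^+ 2 => q0.
by clear -q0 q1 e1; move: (pi : R) q1 => p q1; field; rewrite q0 e1 q1.
Qed.

Lemma poisson_ge0 e w : 0 < e -> 0 <= poisson e w.
Proof. by move=> e0; rewrite divr_ge0 ?mulr_ge0 ?pi_ge0 ?(ltW e0)// addr_ge0 ?sqr_ge0. Qed.

Lemma measurable_poisson e : 0 < e -> measurable_fun setT (poisson e : mR -> R).
Proof.
move=> e0; apply: continuous_measurable_fun => w; apply: cvgM; first exact: cvg_cst.
apply: cvgV; first by rewrite gt_eqF// mulr_gt0 ?pi_gt0// ltr_pwDl ?exprn_gt0 ?sqr_ge0.
apply: cvgM; first exact: cvg_cst.
by apply: cvgD; [exact: cvg_cst|apply: cvgM; exact: cvg_id].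
Qed.

(** Substituting w = e x reduces this to the integral of 1 / (1 + x^2), which is pi. *)
Lemma integral_poisson e : 0 < e -> (\int[lam]_w (poisson e w)%:E = 1)%E.
Proof.
move=> e0; pose g (w : mR) : R := (oneDsqr w)^-1.
have p0 : 0 < pi :> R := pi_gt0 R.
have q1 : pi != 0 :> R by rewrite gt_eqF.
have cg : continuous g by exact: continuous_oneDsqrV.
have mg : measurable_fun setT g := continuous_measurable_fun cg.
have g0 w : 0 <= g w by rewrite invr_ge0 addr_ge0 ?sqr_ge0.
have V : (\int[lam]_w (g w)%:E = pi%:E)%E.
  rewrite ge0_symfun_integralT//; last by move=> w /=; rewrite /g /oneDsqr sqrrN.
  rewrite -set_itvcy integral0y_oneDsqr -EFinM; congr _%:E; by field.
have ie0 : e^-1 != 0 by rewrite invr_eq0 gt_eqF.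
have k0 : 0 <= `|e^-1|^-1 by rewrite invr_ge0.
have := @ge0_integral_transport _ _ _ _ R lam lam _ (measurable_affine e^-1 0) (NngNum k0) (EFin \o g).
move/(_ (fun S mS => lebesgue_affine 0 ie0 mS)).
have mEg : measurable_fun setT (EFin \o g) by exact/measurable_EFinP.
move/(_ mEg (fun w => g0 w)); rewrite V/= => H.
transitivity ((pi * e)^-1%:E * (\int[lam]_x ((g (e^-1 * x + 0)%R)%:E)))%E.
  rewrite -ge0_integralZl//.
  - apply: eq_integral => w _; rewrite -EFinM; congr _%:E.
    rewrite /poisson /g /oneDsqr addr0.
    have q0 : e ^+ 2 + w ^+ 2 != 0 by rewrite gt_eqF// ltr_pwDl ?exprn_gt0 ?sqr_ge0.
    have q3 : 1 + (e^-1 * w) ^+ 2 = (e ^+ 2 + w ^+ 2) / e ^+ 2 by field; rewrite gt_eqF.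
    rewrite q3; have e1 : e != 0 by rewrite gt_eqF.
    move: q0; set Q := _ + w ^+ 2 => q0.
    by clear -q0 q1 e1; move: (pi : R) q1 => p q1; field; rewrite q0 e1 q1.
  - exact: (measurableT_comp mEg (measurable_affine e^-1 0)).
  - by move=> w _; rewrite lee_fin.
  - by rewrite lee_fin invr_ge0 mulr_ge0 ?pi_ge0// ltW.
rewrite H; transitivity (((pi * e)^-1 * (`|e^-1|^-1 * pi))%:E : \bar R)%E => //.
rewrite -[RHS]/(1%R%:E); congr _%:E.
have e1 : e != 0 by rewrite gt_eqF.
rewrite [`|e^-1|]ger0_norm ?invr_ge0 ?(ltW e0)// invrK.
by clear -q1 e1; move: (pi : R) q1 => p q1; field; rewrite e1 q1.
Qed.

End poisson_kernel.

(** * Integrals of products over the coordinates *)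

Section coordinate_products.
Context {R : realType}.
Local Notation lam := (@lebesgue_measure R).
Local Notation mR := (measurableTypeR R).
Local Notation tup d := (d.-tuple mR).
Local Notation bl d := (@borel_lebesgue R d).

Lemma cmeas_prod dT (T : measurableType dT) d (g : 'I_d -> T -> R[i]) :
  (forall i, cmeas (g i)) -> cmeas (fun t => \prod_(i < d) g i t).
Proof.
elim: d g => [|d IH] g mg.
  by rewrite (_ : (fun t => _) = fun=> 1); [exact: cmeas_cst|apply/funext => t; rewrite big_ord0].
rewrite (_ : (fun t => _) = fun t => g ord0 t * \prod_(i < d) g (lift ord0 i) t); last first.
  by apply/funext => t; rewrite big_ord_recl.
by apply: cmeasM => //; exact: IH.
Qed.

Lemma cmeas_tnth d (g : 'I_d -> mR -> R[i]) : (forall i, cmeas (g i)) ->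
  cmeas (fun t : tup d => \prod_(i < d) g i (tnth t i)).
Proof.
move=> mg; apply: (cmeas_prod (g := fun i (t : tup d) => g i (tnth t i))) => i.
exact: (cmeas_comp (measurable_tnth i)).
Qed.

(** Splitting off the first coordinate through [cons_pair], the integrand is dominated by a product
    of two moduli, integrable by hypothesis and by induction. *)
Lemma cint_prod_coord d (g : 'I_d -> mR -> R[i]) : (forall i, cintble lam (g i)) ->
  cintble (bl d) (fun t : tup d => \prod_(i < d) g i (tnth t i)) /\
  cint (bl d) (fun t : tup d => \prod_(i < d) g i (tnth t i)) = \prod_(i < d) cint lam (g i).
Proof.
elim: d g => [|d IH] g Ig.
  have bl1 : bl 0 setT = 1%E by rewrite borel_lebesgue0 diracT.
  rewrite (_ : (fun t => _) = fun=> (1%R)%:C); last by apply/funext => t; rewrite big_ord0.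
  split.
    apply: cintble_real; apply/integrableP; split; first exact: measurable_cst.
    by rewrite integral_cst//= bl1 mule1 ltry.
  rewrite big_ord0 cint_real /Rintegral integral_cst//.
  by rewrite [X in (_ * X)%E]bl1 mule1.
have [I' E'] := IH (fun i => g (lift ord0 i)) (fun i => Ig (lift ord0 i)).
pose h (t : tup d) : R[i] := \prod_(i < d) g (lift ord0 i) (tnth t i).
rewrite -/h in I' E'.
pose G (t : tup d.+1) : R[i] := \prod_(i < d.+1) g i (tnth t i).
rewrite -/G.
have mG : cmeas G by apply: cmeas_tnth => i; exact: cintble_meas (Ig i).
have GE p : (G \o @cons_pair R d) p = g ord0 p.1 * h p.2.
  rewrite /G /= big_ord_recl tnth_cons0; congr (_ * _); apply: eq_bigr => i _.
  by rewrite tnth_consS.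
have mGc : cmeas (G \o @cons_pair R d) by exact: (cmeas_comp (@measurable_cons_pair R d)).
have I0 := cintble_normc (Ig ord0); have I1 := cintble_normc I'.
have dom x y : normc ((G \o @cons_pair R d) (x, y)) <= normc (g ord0 x) * normc (h y).
  by rewrite GE ComplexField.Normc.normcM.
have P : cintble (bl d.+1) G.
  apply: (@cintble_le _ _ _ _ _ (fun t => normc (G t))) => //.
  apply/integrableP; split; first by apply/measurable_EFinP; exact: cmeas_normc.
  rewrite integral_blS//; last by apply/measurable_EFinP/measurableT_comp => //; exact: cmeas_normc.
  have := integrable_prod_mul I0 I1.
  move/integrableP => [m1 l1]; apply: le_lt_trans l1.
  rewrite (fubini_tonelli1 (fun z : mR * tup d => `|(normc (g ord0 z.1) * normc (h z.2))%:E|%E)); last 2 first.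
  - exact: (measurableT_comp (@abse_measurable R setT) m1).
  - by move=> z; exact: abse_ge0.
  rewrite le_eqVlt; apply/orP; left; apply/eqP; apply: eq_integral => x _.
  apply: eq_integral => y _.
  have := congr1 (@normc R) (GE (x, y)); rewrite ComplexField.Normc.normcM => Exy.
  by congr (`|_%:E|)%E.
split=> //.
have [_ <-] := @cint_preserving _ _ _ _ R (lam \x bl d)%E (bl d.+1) _
  (@measurable_cons_pair R d) G (fun S _ => erefl) P.
rewrite (cint_prod mGc I0 I1 dom) big_ord_recl -E'.
transitivity (cint lam (fun x => cint (bl d) h * g ord0 x)); last by rewrite cintZ// mulrC.
congr cint; apply/funext => x; rewrite mulrC -cintZ//.
by congr cint; apply/funext => y; rewrite GE.
Qed.

End coordinate_products.

(** * The Fourier kernel as a unimodular kernel *)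

Section fourier_kernel.
Context {R : realType}.
Variable d : nat.
Local Notation lam := (@lebesgue_measure R).
Local Notation mR := (measurableTypeR R).
Local Notation tup d := (d.-tuple mR).
Local Notation bl d := (@borel_lebesgue R d).
Local Notation Rd := (@Rd R d).
Local Notation mu := (@lebs R d).

Lemma normc_cexpi (t : R) : normc (cexpi t) = 1.
Proof. by rewrite /= cos2Dsin2 sqrtr1. Qed.

Lemma cexpiN (t : R) : cexpi (- t) = conjc (cexpi t).
Proof. by rewrite /cexpi cosN sinN. Qed.

Lemma cexpiD (s t : R) : cexpi (s + t) = cexpi s * cexpi t.
Proof. by rewrite /cexpi cosD sinD; congr (_ +i* _); rewrite addrC [cos s * _]mulrC. Qed.

Lemma cexpi0 : cexpi (0 : R) = 1.
Proof. by rewrite /cexpi cos0 sin0. Qed.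

Lemma cexpi_sum n (t : 'I_n -> R) : cexpi (\sum_i t i) = \prod_i cexpi (t i).
Proof.
elim: n t => [|n IH] t; first by rewrite !big_ord0 cexpi0.
by rewrite !big_ord_recl cexpiD IH.
Qed.

Lemma cmeas_cexpi dT (T : measurableType dT) (f : T -> R) : measurable_fun setT f ->
  cmeas (fun x => cexpi (f x)).
Proof.
move=> mf; split.
  exact: (measurableT_comp (continuous_measurable_fun (@continuous_cos R))).
exact: (measurableT_comp (continuous_measurable_fun (@continuous_sin R))).
Qed.

Lemma measurable_dot dT (T : measurableType dT) (f g : T -> tup d) :
  measurable_fun setT f -> measurable_fun setT g ->
  measurable_fun setT (fun x => dot (f x : Rd) (g x : Rd)).
Proof.
move=> mf mg; apply: measurable_sum => i; apply: measurable_funM.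
  exact: (measurableT_comp (measurable_tnth i) mf).
exact: (measurableT_comp (measurable_tnth i) mg).
Qed.

Definition wave_kernel (z : Rd * Rd) : R[i] := cexpi (2 * pi * dot z.1 z.2).

Lemma cmeas_wave_kernel : cmeas wave_kernel.
Proof.
apply: cmeas_cexpi; apply: measurable_funM => //.
apply: (@measurable_dot _ _ (fun z : Rd * Rd => ofRd z.1) (fun z : Rd * Rd => ofRd z.2)).
  exact: (measurableT_comp (@measurable_ofRd R d) measurable_fst).
exact: (measurableT_comp (@measurable_ofRd R d) measurable_snd).
Qed.

Lemma normc_wave_kernel z : normc (wave_kernel z) = 1.
Proof. exact: normc_cexpi. Qed.

Lemma cintegralE (g : Rd -> R[i]) : cintegral g = cint mu g.
Proof. reflexivity. Qed.

Lemma fourierE (g : Rd -> R[i]) : fourier g = transform mu wave_kernel g.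
Proof.
apply/funext => xi; rewrite /fourier /transform cintegralE.
by apply: (f_equal (cint mu)); apply/funext => x; rewrite cexpiN.
Qed.

Lemma inv_fourierE (g : Rd -> R[i]) : inv_fourier g = cotransform mu wave_kernel g.
Proof.
apply/funext => x; rewrite /inv_fourier /cotransform cintegralE.
by apply: (f_equal (cint mu)); apply/funext => xi; rewrite /wave_kernel.
Qed.

Lemma projE (D : set Rd) (g : Rd -> R[i]) : Defs.proj D g = chi D g.
Proof. by []. Qed.

Lemma concentrationE (A B : set Rd) g : concentration A B g = limited mu wave_kernel A B g.
Proof.
transitivity (Defs.proj A (inv_fourier (Defs.proj B (fourier (Defs.proj A g))))).
  reflexivity.
rewrite inv_fourierE fourierE !projE; reflexivity.
Qed.

End fourier_kernel.

Lemma conjc_mulJ (R : realType) (a b : R[i]) : conjc (conjc a * b) = a * conjc b.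
Proof. by case: a b => [x y] [z w]; congr (_ +i* _) => /=; ring. Qed.

(** * Weighted Plancherel identity *)

Section plancherel_kernel.
Context dT (T : measurableType dT) {R : realType}.
Variables (mu : {sigma_finite_measure set T -> \bar R}) (E : T * T -> R[i]).
Hypotheses (mE : cmeas E) (E1 : forall z, normc (E z) = 1).
Variables (p : T -> R) (u : T -> R[i]).
Hypotheses (Ip : mu.-integrable setT (EFin \o p)) (p0 : forall x, 0 <= p x)
  (Iu : cintble mu u).

Let Q x y : R[i] := cint mu (fun xi => (p xi)%:C * (conjc (E (x, xi)) * E (y, xi))).

(** Write |F u|^2 as a double integral and integrate over xi first. The integrable weight [p]
    justifies the two exchanges, one for each factor of F u, with [u] merely integrable. *)
Lemma plancherel_damped :
  cint mu (fun xi => (p xi)%:C * (transform mu E u xi * conjc (transform mu E u xi))) =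
  cint mu (fun x => u x * cint mu (fun y => conjc (u y) * Q x y)).
Proof.
pose F := transform mu E u.
have mp : cmeas (fun xi => (p xi)%:C).
  by apply: cmeas_real; apply/measurable_EFinP; exact: measurable_int Ip.
have mu_ : cmeas u := cintble_meas Iu.
have mF : cmeas F by exact: cmeas_transform.
pose M := \int[mu]_x normc (u x).
have bF xi : normc (F xi) <= M by exact: normc_transform.
have Inu := cintble_normc Iu.
have IpM : mu.-integrable setT (EFin \o (fun x => p x * M)).
  exact: (integrableZr measurableT M Ip).
have m1 : cmeas (fun z : T * T => (p z.1)%:C * conjc (F z.1) * (conjc (E (z.2, z.1)) * u z.2)).
  apply: cmeasM; first apply: cmeasM.
  - exact: (cmeas_comp measurable_fst mp).
  - exact: (cmeas_comp measurable_fst (cmeasJ mF)).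
  - apply: cmeasM; first by apply: cmeasJ; exact: cmeas_swap.
    exact: (cmeas_comp measurable_snd mu_).
have np xi : normc ((p xi)%:C) = p xi by rewrite normc_real ger0_norm.
transitivity (cint mu (fun xi => cint mu (fun x =>
    (p xi)%:C * conjc (F xi) * (conjc (E (x, xi)) * u x)))).
  apply: (f_equal (cint mu)); apply/funext => xi; rewrite -/F cintZ; last first.
    exact: cintble_transform.
  by rewrite -mulrA [_ * F xi]mulrC.
have d1 xi x : normc ((p xi)%:C * conjc (F xi) * (conjc (E (x, xi)) * u x)) <=
    p xi * M * normc (u x).
  rewrite !ComplexField.Normc.normcM !normc_conjc E1 np mul1r.
  by rewrite ler_wpM2r ?normc_ge0// ler_wpM2l.
rewrite (cint_fubini m1 IpM Inu d1).
apply: (f_equal (cint mu)); apply/funext => x.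
have IEx : cintble mu (fun xi => (p xi)%:C * conjc (F xi) * conjc (E (x, xi))).
  apply: (@cintble_le _ _ _ _ _ (fun xi => p xi * M)) => //.
    apply: cmeasM; first by apply: cmeasM => //; exact: cmeasJ.
    by apply: cmeasJ; exact: (cmeas_comp (measurable_pair1 x)).
  by move=> xi; rewrite !ComplexField.Normc.normcM !normc_conjc E1 np mulr1 ler_wpM2l.
transitivity (u x * cint mu (fun xi => (p xi)%:C * conjc (F xi) * conjc (E (x, xi)))).
  by rewrite -cintZ//; apply: (f_equal (cint mu)); apply/funext => xi; rewrite mulrA mulrC.
congr (_ * _).
have m2 : cmeas (fun z : T * T =>
    (p z.1)%:C * conjc (E (x, z.1)) * (E (z.2, z.1) * conjc (u z.2))).
  apply: cmeasM; first apply: cmeasM.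
  - exact: (cmeas_comp measurable_fst mp).
  - apply: (cmeas_comp measurable_fst (g := fun xi => conjc (E (x, xi)))).
    by apply: cmeasJ; exact: (cmeas_comp (measurable_pair1 x)).
  - apply: cmeasM; first exact: cmeas_swap.
    exact: (cmeas_comp measurable_snd (cmeasJ mu_)).
have IuJ y : cintble mu (fun x => conjc (E (x, y)) * u x) by exact: cintble_transform.
transitivity (cint mu (fun xi => cint mu (fun y =>
    (p xi)%:C * conjc (E (x, xi)) * (E (y, xi) * conjc (u y))))).
  apply: (f_equal (cint mu)); apply/funext => xi; rewrite cintZ; last first.
    have := cintbleJ (IuJ xi); congr cintble.
    by apply/funext => y; rewrite conjc_mulJ.
  rewrite -mulrA [conjc (F xi) * _]mulrC mulrA; congr (_ * _).
  rewrite -cintJ; last exact: IuJ.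
  by apply: (f_equal (cint mu)); apply/funext => y; rewrite conjc_mulJ.
have d2 xi y : normc ((p xi)%:C * conjc (E (x, xi)) * (E (y, xi) * conjc (u y))) <=
    p xi * normc (u y).
  by rewrite !ComplexField.Normc.normcM !normc_conjc !E1 np mul1r mulr1.
rewrite (cint_fubini m2 Ip Inu d2).
apply: (f_equal (cint mu)); apply/funext => y.
rewrite /Q -cintZ.
  by apply: (f_equal (cint mu)); apply/funext => xi; rewrite [RHS]mulrC -!mulrA.
apply: (@cintble_le _ _ _ _ _ p) => //.
  apply: cmeasM => //; apply: cmeasM.
    by apply: cmeasJ; exact: (cmeas_comp (measurable_pair1 x)).
  exact: (cmeas_comp (measurable_pair1 y)).
by move=> xi; rewrite !ComplexField.Normc.normcM !normc_conjc !E1 np !mulr1.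
Qed.

Section positive_definite_kernel.
Variable P : T * T -> R.
Hypotheses (mP : measurable_fun setT P) (P0 : forall z, 0 <= P z)
  (PE : forall x y, cint mu (fun xi => (p xi)%:C * (conjc (E (x, xi)) * E (y, xi))) = (P (x, y))%:C).

Let C := \int[mu]_x p x.
Let F := transform mu E u.

Let PC z : P z <= C.
Proof.
case: z => x y; have -> : P (x, y) = normc (P (x, y))%:C by rewrite normc_real ger0_norm.
rewrite -PE; apply: le_trans (le_normc_cint _) _.
  apply: (@cintble_le _ _ _ _ _ p) => //.
    apply: cmeasM; first by apply: cmeas_real; apply/measurable_EFinP; exact: measurable_int Ip.
    apply: cmeasM; last exact: (cmeas_comp (measurable_pair1 y)).
    by apply: cmeasJ; exact: (cmeas_comp (measurable_pair1 x)).
  by move=> xi; rewrite !ComplexField.Normc.normcM !normc_conjc !E1 !mulr1 normc_real ger0_norm.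
rewrite le_eqVlt; apply/orP; left; apply/eqP; apply: eq_Rintegral => xi _.
by rewrite !ComplexField.Normc.normcM !normc_conjc !E1 !mulr1 normc_real ger0_norm.
Qed.

Let inner x := cint mu (fun y => conjc (u y) * (P (x, y))%:C).

Let mPx x : measurable_fun setT (fun y => P (x, y)).
Proof. exact: (measurableT_comp mP (measurable_pair1 x)). Qed.

Let I_inner x : cintble mu (fun y => conjc (u y) * (P (x, y))%:C).
Proof.
apply: (@cintble_le _ _ _ _ _ (fun y => normc (u y) * C)).
- apply: cmeasM; first by apply: cmeasJ; exact: cintble_meas Iu.
  exact: cmeas_real.
- exact: (integrableZr measurableT C (cintble_normc Iu)).
- move=> y; rewrite ComplexField.Normc.normcM normc_conjc normc_real ger0_norm//.
  by rewrite ler_wpM2l ?normc_ge0.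
Qed.

Let m_inner : cmeas inner.
Proof.
apply: (@cmeas_cint _ _ T T R mu (fun z => conjc (u z.2) * (P z)%:C)).
apply: cmeasM; last exact: cmeas_real.
by apply: (cmeas_comp measurable_snd (g := fun y => conjc (u y))); apply: cmeasJ; exact: cintble_meas Iu.
Qed.

Let normc_inner x : normc (inner x) <= \int[mu]_y (normc (u y) * P (x, y)).
Proof.
apply: le_trans (le_normc_cint (I_inner x)) _.
rewrite le_eqVlt; apply/orP; left; apply/eqP; apply: eq_Rintegral => y _.
by rewrite ComplexField.Normc.normcM normc_conjc normc_real ger0_norm.
Qed.

Let I_uP x : mu.-integrable setT (EFin \o (fun y => normc (u y) * P (x, y))).
Proof.
have := cintble_normc (I_inner x); congr integrable; apply/funext => y /=.
by rewrite ComplexField.Normc.normcM normc_conjc normc_real ger0_norm.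
Qed.

Let inner_le x : \int[mu]_y (normc (u y) * P (x, y)) <= C * \int[mu]_y normc (u y).
Proof.
rewrite -RintegralZl//; last exact: cintble_normc.
apply: le_Rintegral => //.
  exact: (integrableZl measurableT C (cintble_normc Iu)).
by move=> y _; rewrite mulrC ler_wpM2r ?normc_ge0.
Qed.

Let I_outer : cintble mu (fun x => u x * inner x).
Proof.
apply: (@cintble_le _ _ _ _ _ (fun x => normc (u x) * (C * \int[mu]_y normc (u y)))).
- by apply: cmeasM => //; exact: cintble_meas Iu.
- exact: (integrableZr measurableT _ (cintble_normc Iu)).
- move=> x; rewrite ComplexField.Normc.normcM ler_wpM2l ?normc_ge0//.
  exact: le_trans (normc_inner x) (inner_le x).
Qed.

Let damped_energyE :
  (\int[mu]_xi (p xi * normc (F xi) ^+ 2))%:C = cint mu (fun x => u x * inner x).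
Proof.
rewrite -cint_real.
transitivity (cint mu (fun xi => (p xi)%:C * (transform mu E u xi * conjc (transform mu E u xi)))).
  by apply: (f_equal (cint mu)); apply/funext => xi; rewrite mul_conjc -rmorphM.
rewrite plancherel_damped; apply: (f_equal (cint mu)); apply/funext => x; congr (_ * _).
by apply: (f_equal (cint mu)); apply/funext => y; rewrite /Q PE.
Qed.

(** Schur's test: |u(x)| |u(y)| <= (|u(x)|^2 + |u(y)|^2) / 2, and integrating P in the other
    variable costs at most 1 for each half. *)
Lemma damped_energy_le : sqint mu u ->
  (forall x, \int[mu]_y (P (x, y))%:E <= 1)%E -> (forall y, \int[mu]_x (P (x, y))%:E <= 1)%E ->
  \int[mu]_xi (p xi * normc (F xi) ^+ 2) <= \int[mu]_x normc (u x) ^+ 2.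
Proof.
move=> [cu Su] H1 H2; set I := Rintegral _ _ _.
have unit_mass (a : R) (h : T -> R) : 0 <= a -> (forall t, 0 <= h t) -> measurable_fun setT h ->
    (\int[mu]_t (h t)%:E <= 1)%E -> (\int[mu]_t (a * h t)%:E <= a%:E)%E.
  move=> a0 h0 mh h1; under eq_integral do rewrite EFinM.
  rewrite ge0_integralZl ?lee_fin//.
  - by rewrite -[leRHS]mule1 lee_wpmul2l// lee_fin.
  - exact/measurable_EFinP.
  - by move=> t _; rewrite lee_fin.
have I0 : 0 <= I by apply: Rintegral_ge0 => xi _; rewrite mulr_ge0 ?sqr_ge0.
have -> : I = normc (I%:C) by rewrite normc_real ger0_norm.
rewrite damped_energyE; apply: le_trans (le_normc_cint I_outer) _.
pose w x := normc (u x) ^+ 2 / 2.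
have w0 x : 0 <= w x by rewrite divr_ge0 ?sqr_ge0.
have mw : measurable_fun setT w by apply: measurable_funM => //; exact: cmeas_sqr_normc.
have mw1 : measurable_fun setT (fun z : T * T => (w z.1 * P z)%:E).
  by apply/measurable_EFinP/measurable_funM => //; exact: (measurableT_comp mw measurable_fst).
have mw2 : measurable_fun setT (fun z : T * T => (w z.2 * P z)%:E).
  by apply/measurable_EFinP/measurable_funM => //; exact: (measurableT_comp mw measurable_snd).
have Ew : (\int[mu]_x (w x)%:E + \int[mu]_x (w x)%:E = (\int[mu]_x normc (u x) ^+ 2)%:E)%E.
  rewrite -ge0_integralD//; try exact/measurable_EFinP; try by move=> x _; rewrite lee_fin.
  rewrite /Rintegral fineK ?integrable_fin_num//; apply: eq_integral => x _.
  by rewrite -EFinD /w -splitr.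
rewrite -lee_fin -Ew /Rintegral fineK; last first.
  by apply: integrable_fin_num => //; exact: cintble_normc.
have mF1 : measurable_fun setT (fun x => \int[mu]_y (w x * P (x, y))%:E)%E.
  by apply: (measurable_fun_fubini_tonelli_F (fun z : T * T => (w z.1 * P z)%:E)) => // z; rewrite lee_fin mulr_ge0.
have mF2 : measurable_fun setT (fun x => \int[mu]_y (w y * P (x, y))%:E)%E.
  by apply: (measurable_fun_fubini_tonelli_F (fun z : T * T => (w z.2 * P z)%:E)) => // z; rewrite lee_fin mulr_ge0.
have F10 x : (0 <= \int[mu]_y (w x * P (x, y))%:E)%E.
  by apply: integral_ge0 => y _; rewrite lee_fin mulr_ge0.
have F20 x : (0 <= \int[mu]_y (w y * P (x, y))%:E)%E.
  by apply: integral_ge0 => y _; rewrite lee_fin mulr_ge0.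
apply: (@le_trans _ _ (\int[mu]_x (\int[mu]_y (w x * P (x, y))%:E + \int[mu]_y (w y * P (x, y))%:E))%E).
  apply: ge0_le_integral => //.
  - by move=> x _; rewrite lee_fin normc_ge0.
  - by apply/measurable_EFinP; apply: cmeas_normc; apply: cmeasM => //; exact: cintble_meas Iu.
  - exact: emeasurable_funD.
  move=> x _; rewrite -ge0_integralD//; first last.
  - by apply/measurable_EFinP/measurable_funM.
  - by move=> y _; rewrite lee_fin mulr_ge0.
  - by apply/measurable_EFinP/measurable_funM.
  - by move=> y _; rewrite lee_fin mulr_ge0.
  apply: (@le_trans _ _ (normc (u x) * \int[mu]_y (normc (u y) * P (x, y)))%:E).
    by rewrite lee_fin ComplexField.Normc.normcM ler_wpM2l ?normc_ge0.
  rewrite EFinM /Rintegral fineK; last by apply: integrable_fin_num => //; exact: I_uP.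
  have mnu : measurable_fun setT (fun y => normc (u y)) by exact: cmeas_normc.
  rewrite -ge0_integralZl//; first last.
  - by rewrite lee_fin normc_ge0.
  - by move=> y _; rewrite lee_fin mulr_ge0 ?normc_ge0.
  - by apply/measurable_EFinP/measurable_funM.
  apply: ge0_le_integral => //.
  - by move=> y _; rewrite -EFinM lee_fin !mulr_ge0 ?normc_ge0.
  - by apply/measurable_EFinP/measurable_funM => //; exact: measurable_funM.
  - by apply/measurable_EFinP/measurable_funD; exact: measurable_funM.
  move=> y _; rewrite -EFinM -EFinD lee_fin mulrA -mulrDl ler_wpM2r//.
  by rewrite /w; have := sqr_ge0 (normc (u x) - normc (u y)); lra.
rewrite ge0_integralD//; apply: leeD.
  apply: ge0_le_integral => //; first exact/measurable_EFinP.
  by move=> x _; apply: unit_mass.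
have w2P z : (0 <= (w z.2 * P z)%:E)%E by rewrite lee_fin mulr_ge0.
(* In the half carrying [w y] the order of integration is exchanged, so that the bound on the other
   marginal applies. *)
rewrite [leLHS](fubini_tonelli _ mw2 w2P).
apply: ge0_le_integral => //.
- by move=> y _; apply: integral_ge0 => x _; rewrite lee_fin mulr_ge0.
- exact: (measurable_fun_fubini_tonelli_G (fun z : T * T => (w z.2 * P z)%:E) mw2 w2P).
- exact/measurable_EFinP.
move=> y _; apply: (unit_mass (w y) (fun x => P (x, y)) (w0 y) (fun x => P0 (x, y)) _ (H2 y)).
exact: (measurableT_comp mP (measurable_pair2 y)).
Qed.

(** For a nonnegative function the complex identity becomes one between iterated extended integrals,
    the form in which the approximate identity estimates are stated. *)
Lemma damped_energy_real (r : T -> R) : (forall x, 0 <= r x) -> (forall x, u x = (r x)%:C) ->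
  ((\int[mu]_xi (p xi * normc (F xi) ^+ 2))%:E =
   \int[mu]_x \int[mu]_y (r x * r y * P (x, y))%:E)%E.
Proof.
move=> r0 ur; have innerE x : inner x = (\int[mu]_y (r y * P (x, y)))%:C.
  rewrite -cint_real; apply: (f_equal (cint mu)); apply/funext => y.
  by rewrite ur conjc_real -rmorphM.
have outerE x : u x * inner x = (r x * \int[mu]_y (r y * P (x, y)))%:C.
  by rewrite ur innerE -rmorphM.
have IO := I_outer; move: damped_energyE IO.
rewrite (_ : (fun x => u x * inner x) =
    (fun x => (r x * \int[mu]_y (r y * P (x, y)))%:C)); last exact/funext.
rewrite cint_real => /(congr1 (@complex.Re R))/= -> [/= Iout _].
have ru x : normc (u x) = r x by rewrite ur normc_real ger0_norm.
rewrite /Rintegral fineK ?integrable_fin_num//; apply: eq_integral => x _.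
have Ix := I_uP x.
rewrite EFinM fineK; last first.
  apply: integrable_fin_num => //; move: Ix; congr integrable; apply/funext => y /=.
  by rewrite ru.
have mr : measurable_fun setT r.
  by rewrite (_ : r = fun x => normc (u x)); [apply: cmeas_normc; exact: cintble_meas Iu|apply/funext => z; rewrite ru].
rewrite -ge0_integralZl//.
- by apply: eq_integral => y _; rewrite -EFinM mulrA.
- by apply/measurable_EFinP/measurable_funM.
- by move=> y _; rewrite lee_fin mulr_ge0.
- by rewrite lee_fin.
Qed.

End positive_definite_kernel.

End plancherel_kernel.

(** * Damping and Poisson kernels in R^d *)

Section poisson_space.
Context {R : realType}.
Variable d : nat.
Local Notation lam := (@lebesgue_measure R).
Local Notation mR := (measurableTypeR R).
Local Notation tup := (d.-tuple mR).
Local Notation bl := (@borel_lebesgue R d).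
Local Notation Rd := (@Rd R d).
Local Notation mu := (@lebs R d).

(** Exponential damping in the l^1 norm instead of the Euclidean one: it and its Fourier transform
    are products over the coordinates. *)
Definition damp e (t : tup) : R := \prod_(i < d) expR (- (2 * pi * e) * `|tnth t i|).
Definition poissond e (t : tup) : R := \prod_(i < d) poisson e (tnth t i).
Definition scaled_diff (c : R) (x y : tup) : tup := [tuple c * (tnth y i - tnth x i) | i < d].

Lemma damp_ge0 e t : 0 <= damp e t.
Proof. by apply: prodr_ge0 => i _; exact: expR_ge0. Qed.

Lemma damp_le1 e t : 0 < e -> damp e t <= 1.
Proof.
move=> e0; have -> : 1 = \prod_(i < d) (1 : R) by rewrite big1.
apply: ler_prod => i _; rewrite expR_ge0/= -expR0 ler_expR mulNr oppr_le0.
by rewrite !mulr_ge0 ?pi_ge0// ltW.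
Qed.

Lemma measurable_damp e : measurable_fun setT (damp e).
Proof.
apply: measurable_prod => i _.
exact: (measurableT_comp (measurable_exp_abs (2 * pi * e)) (measurable_tnth i)).
Qed.

Lemma poissond_ge0 e t : 0 < e -> 0 <= poissond e t.
Proof. by move=> e0; apply: prodr_ge0 => i _; exact: poisson_ge0. Qed.

Lemma measurable_poissond e : 0 < e -> measurable_fun setT (poissond e).
Proof.
move=> e0; apply: measurable_prod => i _.
exact: (measurableT_comp (measurable_poisson e0) (measurable_tnth i)).
Qed.

Lemma integrable_prod_coord (g : mR -> R) : lam.-integrable setT (EFin \o g) ->
  bl.-integrable setT (EFin \o (fun t : tup => \prod_(i < d) g (tnth t i))) /\
  \int[bl]_t (\prod_(i < d) g (tnth t i)) = (\int[lam]_t g t) ^+ d.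
Proof.
move=> Ig.
have [I E] := cint_prod_coord (fun i : 'I_d => cintble_real Ig).
have Ee : (fun t : tup => \prod_(i < d) (g (tnth t i))%:C) =
  (fun t : tup => (\prod_(i < d) g (tnth t i))%:C).
  by apply/funext => t; rewrite rmorph_prod.
rewrite Ee in I E; split; first by case: I.
by move: E; rewrite !cint_real -rmorph_prod prodr_const card_ord => /(congr1 (@complex.Re R)).
Qed.

Lemma integrable_damp e : 0 < e -> mu.-integrable setT (EFin \o (fun x : Rd => damp e (ofRd x))).
Proof.
move=> e0; have a0 : 0 < 2 * pi * e by rewrite !mulr_gt0 ?pi_gt0.
have [I _] := integrable_prod_coord (integrable_expR_abs a0).1.
by have [] := integrable_preserving (@measurable_ofRd R d) (@lebs_ofRd R d) I.
Qed.

Lemma integral_poissond e : 0 < e -> (\int[bl]_t (poissond e t)%:E = 1)%E.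
Proof.
move=> e0; have [I1 E1] := ge0_integral_finite (measurable_poisson e0)
  (fun t => poisson_ge0 t e0) (integral_poisson e0).
have [I E] := integrable_prod_coord I1.
have := integrable_fin_num measurableT I; move/fineK => <-.
move: E; rewrite E1 expr1n => E; congr _%:E; exact: E.
Qed.

Lemma damped_wave e (x y : Rd) : 0 < e ->
  cint mu (fun xi => (damp e (ofRd xi))%:C * (conjc (wave_kernel (x, xi)) * wave_kernel (y, xi))) =
  (poissond e (scaled_diff 1 (ofRd x) (ofRd y)))%:C.
Proof.
move=> e0; pose w i := tnth (ofRd y) i - tnth (ofRd x) i.
have [I E] := cint_prod_coord (fun i : 'I_d => (fourier_expR_abs (w i) e0).1).
have [_ E2] := cint_preserving (@measurable_ofRd R d) (@lebs_ofRd R d) I.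
transitivity (\prod_(i < d) (poisson e (w i))%:C).
  rewrite -(eq_bigr _ (fun i _ => (fourier_expR_abs (w i) e0).2)) -E -E2.
  apply: (f_equal (cint mu)); apply/funext => xi; rewrite [RHS]big_split -rmorph_prod.
  rewrite -cexpi_sum {1}/wave_kernel -cexpiN -cexpiD; congr (_ * cexpi _).
  rewrite /dot -mulr_sumr /w /=.
  under [in RHS]eq_bigr do rewrite mulrBl.
  by rewrite sumrB mulrBr addrC.
rewrite -rmorph_prod; congr (_%:C); apply: eq_bigr => i _.
by rewrite tnth_mktuple mul1r.
Qed.

Lemma measurable_scaled_diff c : measurable_fun setT (fun z : tup * tup => scaled_diff c z.1 z.2).
Proof.
apply: measurable_fun_tuple => i; rewrite /scaled_diff.
under eq_fun do rewrite tnth_mktuple.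
apply: measurable_funM => //; apply: measurable_funB.
  exact: (measurableT_comp (measurable_tnth i) measurable_snd).
exact: (measurableT_comp (measurable_tnth i) measurable_fst).
Qed.

(** The kernel with parameter 1/c is the rescaled kernel with parameter 1. Removing the damping is
    thus an instance of the approximate identity theorem. *)
Lemma poissond_scale c (x y : tup) : 0 < c ->
  c ^+ d * poissond 1 (scaled_diff c x y) = poissond c^-1 (scaled_diff 1 x y).
Proof.
move=> c0; have -> : c ^+ d = \prod_(i < d) c by rewrite prodr_const card_ord.
rewrite /poissond -big_split; apply: eq_bigr => i _ /=; rewrite !tnth_mktuple /poisson mul1r.
set w := _ - _; have c1 : c != 0 by rewrite gt_eqF.
have p1 : pi != 0 :> R by rewrite gt_eqF ?pi_gt0.
have q1 : 1 + (c * w) ^+ 2 != 0 by rewrite gt_eqF// ltr_pwDl ?sqr_ge0.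
rewrite mul1r expr1n; have -> : c^-1 ^+ 2 + w ^+ 2 = (1 + (c * w) ^+ 2) / c ^+ 2 by field.
move: q1; set q := 1 + _ => q1.
by clear -q1 p1 c1; move: (pi : R) p1 => p p1; field; rewrite q1 c1 p1.
Qed.

Lemma integral_scaled_diffr c (x : tup) (g : tup -> \bar R) : 0 < c ->
  measurable_fun setT g -> (forall t, (0 <= g t)%E) ->
  (\int[bl]_y g (scaled_diff c x y) = ((c ^+ d)^-1)%:E * \int[bl]_t g t)%E.
Proof.
move=> c0 mg g0.
have := @integral_affine R d c [tuple - c * tnth x i | i < d] g.
rewrite gt_eqF// => /(_ isT mg g0); rewrite (ger0_norm (ltW c0)) => <-.
apply: eq_integral => y _; congr g; apply: eq_from_tnth => i; rewrite !tnth_mktuple; ring.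
Qed.

Lemma integral_scaled_diffl c (y : tup) (g : tup -> \bar R) : 0 < c ->
  measurable_fun setT g -> (forall t, (0 <= g t)%E) ->
  (\int[bl]_x g (scaled_diff c x y) = ((c ^+ d)^-1)%:E * \int[bl]_t g t)%E.
Proof.
move=> c0 mg g0.
have := @integral_affine R d (- c) [tuple c * tnth y i | i < d] g.
rewrite oppr_eq0 gt_eqF// => /(_ isT mg g0); rewrite normrN (ger0_norm (ltW c0)) => <-.
apply: eq_integral => x _; congr g; apply: eq_from_tnth => i; rewrite !tnth_mktuple; ring.
Qed.

End poisson_space.

Lemma mem_set_pred (T : Type) (p : pred T) x : (x \in [set y | p y]) = p x.
Proof. by apply/idP/idP => [/set_mem|h]; [|exact/mem_set]. Qed.

(** * Approximate identities and Borel sets *)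

Section approximate_identity.
Context {R : realType}.
Variable d : nat.
Local Notation lam := (@lebesgue_measure R).
Local Notation mR := (measurableTypeR R).
Local Notation tup := (d.-tuple mR).
Local Notation bl := (@borel_lebesgue R d).
Local Notation sdiff := (@scaled_diff R d).

Variables (phi : tup -> R) (M : R).
Hypotheses (mphi : measurable_fun setT phi) (phi0 : forall t, 0 <= phi t)
  (phiM : (\int[bl]_t (phi t)%:E = M%:E)%E).

(** [h] weighs pairs of points against the approximate identity c^d phi(c (y - x)); only its total
    mass in y is independent of c. *)
Definition mass (c : R) (h : tup * tup -> R) : \bar R :=
  (\int[bl]_x \int[bl]_y (h (x, y) * (c ^+ d * phi (sdiff c x y)))%:E)%E.

Definition weight (h : tup * tup -> R) := measurable_fun setT h /\ forall z, 0 <= h z.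

Definition vanishing (h : tup * tup -> R) := forall eps : R, 0 < eps ->
  \forall c \near +oo, (mass c h <= eps%:E)%E.

Let M0 : 0 <= M.
Proof. by rewrite -lee_fin -phiM; apply: integral_ge0 => t _; rewrite lee_fin. Qed.

Let mk c : measurable_fun setT (fun z : tup * tup => c ^+ d * phi (sdiff c z.1 z.2)).
Proof.
by apply: measurable_funM => //; exact: (measurableT_comp mphi (measurable_scaled_diff c)).
Qed.

Let mhk c h : weight h ->
  measurable_fun setT (fun z : tup * tup => (h z * (c ^+ d * phi (sdiff c z.1 z.2)))%:E).
Proof. by move=> [mh _]; apply/measurable_EFinP/measurable_funM. Qed.

Let hk0 c h z : 0 < c -> weight h ->
  (0 <= (h z * (c ^+ d * phi (sdiff c z.1 z.2)))%:E)%E.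
Proof. by move=> c0 [_ h0]; rewrite lee_fin !mulr_ge0// exprn_ge0// ltW. Qed.

Let mhkx c h x : weight h ->
  measurable_fun setT (fun y : tup => (h (x, y) * (c ^+ d * phi (sdiff c x y)))%:E).
Proof. by move=> /(mhk c) H; exact: (measurableT_comp H (measurable_pair1 x)). Qed.

Let mF c h : 0 < c -> weight h ->
  measurable_fun setT (fun x => \int[bl]_y (h (x, y) * (c ^+ d * phi (sdiff c x y)))%:E)%E.
Proof.
move=> c0 wh; exact: (measurable_fun_fubini_tonelli_F
  (fun z : tup * tup => (h z * (c ^+ d * phi (sdiff c z.1 z.2)))%:E) (mhk c wh) (fun z => hk0 z c0 wh)).
Qed.

Let F0 c h x : 0 < c -> weight h ->
  (0 <= \int[bl]_y (h (x, y) * (c ^+ d * phi (sdiff c x y)))%:E)%E.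
Proof. by move=> c0 wh; apply: integral_ge0 => y _; exact: (hk0 (x, y) c0 wh). Qed.

Lemma weightD h1 h2 : weight h1 -> weight h2 -> weight (fun z => h1 z + h2 z).
Proof.
by move=> [m1 p1] [m2 p2]; split; [exact: measurable_funD|move=> z; rewrite addr_ge0].
Qed.

Lemma weightM h1 h2 : weight h1 -> weight h2 -> weight (fun z => h1 z * h2 z).
Proof.
by move=> [m1 p1] [m2 p2]; split; [exact: measurable_funM|move=> z; rewrite mulr_ge0].
Qed.

Lemma mass_le c h1 h2 : 0 < c -> weight h1 -> weight h2 -> (forall z, h1 z <= h2 z) ->
  (mass c h1 <= mass c h2)%E.
Proof.
move=> c0 w1 w2 h12; apply: ge0_le_integral => //.
- by move=> x _; exact: F0.
- exact: mF.
- exact: mF.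
move=> x _; apply: ge0_le_integral => //.
- by move=> y _; exact: (hk0 (x, y) c0 w1).
- exact: mhkx.
- exact: mhkx.
by move=> y _; rewrite lee_fin ler_wpM2r// mulr_ge0// exprn_ge0// ltW.
Qed.

Lemma massD c h1 h2 : 0 < c -> weight h1 -> weight h2 ->
  mass c (fun z => h1 z + h2 z) = (mass c h1 + mass c h2)%E.
Proof.
move=> c0 w1 w2; rewrite /mass -ge0_integralD//; first last.
- exact: mF.
- by move=> x _; exact: F0.
- exact: mF.
- by move=> x _; exact: F0.
apply: eq_integral => x _; rewrite -ge0_integralD//; first last.
- exact: mhkx.
- by move=> y _; exact: (hk0 (x, y) c0 w2).
- exact: mhkx.
- by move=> y _; exact: (hk0 (x, y) c0 w1).
by apply: eq_integral => y _; rewrite -EFinD mulrDl.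
Qed.

Lemma vanishing_le h1 h2 : weight h1 -> weight h2 -> (forall z, h1 z <= h2 z) ->
  vanishing h2 -> vanishing h1.
Proof.
move=> w1 w2 h12 v e e0; near=> c.
apply: (@le_trans _ _ (mass c h2)); last by near: c; exact: v.
by apply: mass_le => //; near: c; exact: nbhs_pinfty_gt.
Unshelve. all: by end_near. Qed.

Lemma vanishingD h1 h2 : weight h1 -> weight h2 -> vanishing h1 -> vanishing h2 ->
  vanishing (fun z => h1 z + h2 z).
Proof.
move=> w1 w2 v1 v2 e e0; have e2 : 0 < e / 2 by rewrite divr_gt0.
apply: filterS (filterI (v1 _ e2) (filterI (v2 _ e2) (nbhs_pinfty_gt (num_real 0)))).
move=> c [l1 [l2 c0]].
by rewrite (massD c0 w1 w2) [e]splitr EFinD; exact: (leeD l1 l2).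
Qed.

Lemma vanishing_approx h : weight h ->
  (forall e, 0 < e -> exists h1 h2, [/\ weight h1, weight h2, vanishing h1,
     forall z, h z <= h1 z + h2 z & forall c, 0 < c -> (mass c h2 <= e%:E)%E]) ->
  vanishing h.
Proof.
move=> wh H e e0; have e2 : 0 < e / 2 by rewrite divr_gt0.
have [h1 [h2 [w1 w2 v1 h12 m2]]] := H _ e2.
near=> c; have c0 : 0 < c by near: c; exact: nbhs_pinfty_gt.
apply: (@le_trans _ _ (mass c (fun z => h1 z + h2 z))).
  by apply: mass_le => //; exact: weightD.
rewrite massD// [e]splitr EFinD; apply: leeD; last exact: m2.
by near: c; exact: v1.
Unshelve. all: by end_near. Qed.

Definition ind1 (S : set tup) (z : tup * tup) : R := \1_S z.1.
Definition ind2 (S : set tup) (z : tup * tup) : R := \1_S z.2.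

Lemma weight_ind1 S : measurable S -> weight (ind1 S).
Proof.
move=> mS; split; last by move=> z; rewrite /ind1 /ind2 indicE ler0n.
by apply: (measurableT_comp _ measurable_fst); exact: measurable_indic.
Qed.

Lemma weight_ind2 S : measurable S -> weight (ind2 S).
Proof.
move=> mS; split; last by move=> z; rewrite /ind1 /ind2 indicE ler0n.
by apply: (measurableT_comp _ measurable_snd); exact: measurable_indic.
Qed.

(** Stated for a general profile [g] because it is applied to [phi] and also to its tails [cut]. *)
Lemma mass_section (S : set tup) (g : tup -> R) c : 0 < c -> measurable S ->
  measurable_fun setT g -> (forall t, 0 <= g t) ->
  (\int[bl]_x \int[bl]_y (\1_S x * (c ^+ d * g (sdiff c x y)))%:E =
   bl S * \int[bl]_t (g t)%:E)%E.
Proof.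
move=> c0 mS mg g0.
have mEg : measurable_fun setT (fun t => (g t)%:E) by exact/measurable_EFinP.
have inner x : (\int[bl]_y (\1_S x * (c ^+ d * g (sdiff c x y)))%:E =
    (\1_S x)%:E * \int[bl]_t (g t)%:E)%E.
  under eq_integral do rewrite mulrA EFinM.
  rewrite ge0_integralZl//; last first.
  - by rewrite lee_fin mulr_ge0// exprn_ge0// ltW.
  - by move=> y _; rewrite lee_fin.
  - apply: (measurableT_comp mEg); exact: (measurableT_comp (measurable_scaled_diff c) (measurable_pair1 x)).
  rewrite (integral_scaled_diffr x c0 mEg)//.
  rewrite muleA -EFinM -mulrA divff ?mulr1// expf_neq0// gt_eqF//.
under eq_integral do rewrite inner.
rewrite ge0_integralZr//.
- by rewrite integral_indic// setIT.
- by apply/measurable_EFinP; exact: measurable_indic.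
- by apply: integral_ge0 => t _; rewrite lee_fin.
Qed.

Lemma mass_ind1 c S : 0 < c -> measurable S -> mass c (ind1 S) = (bl S * M%:E)%E.
Proof. by move=> c0 mS; rewrite -phiM -(mass_section c0 mS). Qed.

Lemma mass_ind2 c S : 0 < c -> measurable S -> mass c (ind2 S) = (bl S * M%:E)%E.
Proof.
move=> c0 mS; have w := weight_ind2 mS.
rewrite /mass (fubini_tonelli _ (mhk c w) (fun z => hk0 z c0 w)).
have mEg : measurable_fun setT (fun t => (phi t)%:E) by exact/measurable_EFinP.
have inner y : (\int[bl]_x (\1_S y * (c ^+ d * phi (sdiff c x y)))%:E = (\1_S y)%:E * M%:E)%E.
  under eq_integral do rewrite mulrA EFinM.
  rewrite ge0_integralZl//; last first.
  - by rewrite lee_fin mulr_ge0// exprn_ge0// ltW.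
  - by move=> x _; rewrite lee_fin.
  - apply: (measurableT_comp mEg); exact: (measurableT_comp (measurable_scaled_diff c) (measurable_pair2 y)).
  rewrite (integral_scaled_diffl y c0 mEg)// phiM.
  by rewrite -!EFinM mulrA mulfK// expf_neq0// gt_eqF.
transitivity (\int[bl]_y ((\1_S y)%:E * M%:E))%E.
  by apply: eq_integral => y _; rewrite -inner.
rewrite ge0_integralZr//.
- by rewrite integral_indic// setIT.
- by apply/measurable_EFinP; exact: measurable_indic.
Qed.

(** Pairs in F x F that E separates. The cut-off to an F of finite measure gives meaning to the
    notion for half-spaces and complements, as a sigma-algebra argument demands. *)
Definition dist (E F : set tup) (z : tup * tup) : R :=
  ind1 F z * ind2 F z * `|ind1 E z - ind2 E z|.

Lemma weight_dist E F : measurable E -> measurable F -> weight (dist E F).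
Proof.
move=> mE mF'; have [m1 _] := weight_ind1 mE; have [m2 _] := weight_ind2 mE.
have [n1 p1] := weight_ind1 mF'; have [n2 p2] := weight_ind2 mF'.
split; last by move=> z; rewrite !mulr_ge0.
apply: measurable_funM; first exact: measurable_funM.
by apply: measurableT_comp => //; exact: measurable_funB.
Qed.

Definition asymptotically_invariant (E : set tup) := measurable E /\
  forall F, measurable F -> (bl F < +oo)%E -> vanishing (dist E F).

Lemma asymptotically_invariantC E :
  asymptotically_invariant E -> asymptotically_invariant (~` E).
Proof.
move=> [mE h]; split; first exact: measurableC.
move=> F mF' fF; rewrite (_ : dist _ _ = dist E F); first exact: h.
apply/funext => z; rewrite /dist /ind1 /ind2; congr (_ * _).
by rewrite !indicE !in_setC; case: (z.1 \in E); case: (z.2 \in E); rewrite /= ?subrr ?subr0 ?sub0r// normrN.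
Qed.

Lemma asymptotically_invariantU E1 E2 :
  asymptotically_invariant E1 -> asymptotically_invariant E2 ->
  asymptotically_invariant (E1 `|` E2).
Proof.
move=> [m1 h1] [m2 h2]; split; first exact: measurableU.
move=> F mF' fF; have w1 := weight_dist m1 mF'; have w2 := weight_dist m2 mF'.
apply: (vanishing_le _ (weightD w1 w2)) (vanishingD w1 w2 (h1 _ mF' fF) (h2 _ mF' fF)).
  by apply: weight_dist => //; exact: measurableU.
move=> z; rewrite /dist -mulrDr ler_wpM2l//.
  by rewrite mulr_ge0// /ind1 /ind2 indicE ler0n.
rewrite /ind1 /ind2 !indicE !in_setU.
case: (z.1 \in E1); case: (z.1 \in E2); case: (z.2 \in E1); case: (z.2 \in E2);
  rewrite /= ?subrr ?subr0 ?sub0r ?normrN ?normr0 ?normr1; lra.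
Qed.

Lemma nonincreasing_measure_cvg0 (F : (set tup)^nat) : (forall n, measurable (F n)) ->
  (bl (F 0%N) < +oo)%E -> (forall n, F n.+1 `<=` F n) -> bl (\bigcap_n F n) = 0%E ->
  forall e : R, 0 < e -> exists n, (bl (F n) * M%:E <= e%:E)%E.
Proof.
move=> mF' f0 dF b0 e e0.
have /nonincreasing_cvg_mu : (bl (F 0%N) < +oo)%E by [].
move=> /(_ mF' (bigcapT_measurable mF')) H.
have nF : nonincreasing_seq F.
  by apply/nonincreasing_seqP => n; apply/subsetPset; exact: dF.
have H0 : bl \o F @ \oo --> 0%E by rewrite -b0; exact: H.
move/fine_cvgP: H0 => [fin].
have q0 : 0 < e / (M + 1) by rewrite divr_gt0// ltr_wpDl.
move=> /cvgr0Pnorm_le/(_ _ q0) c0.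
have [n [fn cn]] : exists n, bl (F n) \is a fin_num /\ `|fine (bl (F n))| <= e / (M + 1).
  have [N _ hN] : \forall n \near \oo, bl (F n) \is a fin_num /\
    `|fine (bl (F n))| <= e / (M + 1) by apply: filterI.
  by exists N; apply: hN => /=.
exists n; rewrite -(fineK fn) -EFinM lee_fin.
rewrite ger0_norm ?fine_ge0// ler_pdivlMr ?ltr_wpDl// in cn.
by apply: le_trans cn; rewrite ler_wpM2l ?fine_ge0// lerDl.
Qed.

(** Within F the union exceeds the finite union [U n] by a set [G n] whose measure tends to 0. A
    pair separated by the union but not by [U n] has a point in [G n], and such pairs have small
    mass uniformly in c. *)
Lemma asymptotically_invariant_bigcup (E : (set tup)^nat) :
  (forall n, asymptotically_invariant (E n)) -> asymptotically_invariant (\bigcup_n E n).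
Proof.
move=> hE; pose U n := \bigcup_(k < n.+1) E k.
have hU n : asymptotically_invariant (U n).
  rewrite /U; elim: n => [|n IH].
    by rewrite bigcup_mkord big_ord_recl big_ord0 setU0; exact: hE.
  rewrite bigcup_mkord big_ord_recr/= -bigcup_mkord.
  exact: (asymptotically_invariantU IH (hE _)).
have mE : measurable (\bigcup_n E n) by apply: bigcupT_measurable => n; case: (hE n).
split => // F mF' fF; apply: vanishing_approx; first exact: weight_dist.
move=> e e0; have e2 : 0 < e / 2 by rewrite divr_gt0.
pose G n := F `&` (\bigcup_n E n) `\` U n.
have mG n : measurable (G n).
  by apply: measurableD; [exact: measurableI|case: (hU n)].
have [n hn] : exists n, (bl (G n) * M%:E <= (e / 2)%:E)%E.
  apply: nonincreasing_measure_cvg0 => //.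
  - apply: le_lt_trans fF; apply: le_measure; rewrite ?inE//.
    by move=> x [[]].
  - move=> k x [Fx nx]; split => //; apply: contra_not nx => -[i /= ik Ei].
    by exists i => //=; exact: ltnW.
  rewrite (_ : \bigcap_n G n = set0) ?measure0// -subset0 => x Gx.
  have [[_ [k _ Ek]] _] := Gx 0%N I.
  by have [_] := Gx k I; apply; exists k => /=.
exists (dist (U n) F), (fun z => ind1 (G n) z + ind2 (G n) z).
have w1 := weight_ind1 (mG n); have w2 := weight_ind2 (mG n).
have [mU vU] := hU n.
split.
- exact: weight_dist.
- exact: weightD.
- exact: vU.
- move=> z; rewrite /dist /ind1 /ind2 !indicE.
  have UE x : x \in U n -> x \in \bigcup_n E n.
    by rewrite !inE => -[k _ ?]; exists k.
  have GE x : (x \in G n) = [&& x \in F, x \in \bigcup_n E n & x \notin U n].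
    rewrite in_setD in_setI -andbA; by case: (x \in F).
  rewrite !GE; have := UE z.1; have := UE z.2.
  case: (z.1 \in F); case: (z.2 \in F);
    rewrite /= ?mul0r ?mulr0 ?mul0r ?add0r ?addr_ge0 ?ler0n//.
  rewrite !mul1r; case: (z.1 \in U n); case: (z.2 \in U n);
    case: (z.1 \in \bigcup_n E n); case: (z.2 \in \bigcup_n E n) => //= h1 h2;
    try (by have := h1 isT); try (by have := h2 isT);
    rewrite ?subrr ?subr0 ?sub0r ?normrN ?normr0 ?normr1; lra.
move=> c c0; rewrite massD// mass_ind1// mass_ind2// [e]splitr EFinD.
exact: leeD.
Qed.

Lemma sigma_algebra_asymptotically_invariant :
  sigma_algebra [set: tup] asymptotically_invariant.
Proof.
split.
- split=> // F mF' fF e e0; near=> c.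
  have c0 : 0 < c by near: c; exact: nbhs_pinfty_gt.
  rewrite /mass [X in (X <= _)%E](_ : _ = 0%E) ?lee_fin ?ltW//.
  rewrite integral0_eq// => x _; rewrite integral0_eq// => y _.
  by rewrite /dist /ind1 /ind2 !indicE !in_set0 subrr normr0 mulr0 mul0r.
- by move=> E hE; rewrite setTD; exact: asymptotically_invariantC.
- exact: asymptotically_invariant_bigcup.
Unshelve. all: by end_near. Qed.

Definition far (i : 'I_d) (r : R) (z : tup * tup) : R :=
  \1_[set t : mR | r < `|t|] (tnth z.2 i - tnth z.1 i).

Let m_out (r : R) : measurable [set t : mR | r < `|t|].
Proof.
rewrite [X in measurable X](_ : _ = (fun t : mR => `|t| : R) @^-1` `]r, +oo[); last first.
  by apply/seteqP; split => t /=; rewrite in_itv/= andbT.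
by rewrite -[X in measurable X]setTI; exact: normr_measurable.
Qed.

Lemma weight_far i r : weight (far i r).
Proof.
split; last by move=> z; rewrite /far indicE ler0n.
apply: (measurableT_comp (measurable_indic (m_out r))); apply: measurable_funB.
  exact: (measurableT_comp (measurable_tnth i) measurable_snd).
exact: (measurableT_comp (measurable_tnth i) measurable_fst).
Qed.

(** The tail of [phi] in the direction of the i-th coordinate. *)
Let cut (i : 'I_d) (r : R) (t : tup) : R := phi t * \1_[set s : mR | r < `|s|] (tnth t i).

Let m_cut i r : measurable_fun setT (cut i r).
Proof.
apply: measurable_funM => //.
exact: (measurableT_comp (measurable_indic (m_out r)) (measurable_tnth i)).
Qed.

Let cut0 i r t : 0 <= cut i r t.
Proof. by rewrite mulr_ge0// indicE ler0n. Qed.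

Lemma cut_vanishing i (e : R) : 0 < e ->
  \forall r \near +oo, (\int[bl]_t (cut i r t)%:E <= e%:E)%E.
Proof.
move=> e0.
have Iphi : bl.-integrable setT (EFin \o phi).
  by have [] := ge0_integral_finite mphi phi0 phiM.
have H : (\int[bl]_t (cut i n%:R t)%:E @[n --> \oo] --> \int[bl]_t (cst 0%E t : \bar R))%E.
  apply: (@dominated_cvg _ _ _ bl setT measurableT (fun n t => (cut i n%:R t)%:E) _ (EFin \o phi)) => //.
  - by move=> n; apply/measurable_EFinP; exact: m_cut.
  - move=> t _; apply: cvg_near_cst.
    have [N hN] : exists N : nat, `|tnth t i| < N%:R.
      exists (Num.truncn `|tnth t i|).+1; exact: truncnS_gt.
    exists N => // n /= Nn; rewrite /cut indicE memNset ?mulr0//= => h.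
    by have := lt_trans h hN; rewrite ltr_nat ltnNge Nn.
  - move=> n t _; rewrite /= lee_fin ger0_norm// /cut.
    by rewrite ler_piMr// indicE; case: (X in (nat_of_bool X)%:R <= _).
rewrite integral0 in H.
move/fine_cvgP: H => [fin /cvgr0Pnorm_le/(_ _ e0) c0].
have [N hN] : exists N : nat, (\int[bl]_t (cut i N%:R t)%:E <= e%:E)%E.
  have [N _ hN] := filterI fin c0.
  exists N; have [/= h1 h2] := hN N (leqnn N).
  by rewrite -(fineK h1) lee_fin (le_trans (ler_norm _) h2).
near=> r; apply: le_trans hN; apply: ge0_le_integral => //.
- by move=> t _; rewrite lee_fin.
- by apply/measurable_EFinP; exact: m_cut.
- by apply/measurable_EFinP; exact: m_cut.
move=> t _; rewrite lee_fin /cut ler_wpM2l// !indicE ler_nat.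
case: (boolP (_ \in [set s | r < _])) => //; rewrite inE /= => h.
rewrite mem_set//=; apply: le_lt_trans h.
by near: r; exact: nbhs_pinfty_ge.
Unshelve. all: by end_near. Qed.

(** With t = c (y - x), a displacement beyond r in coordinate i means |t_i| > c r; the mass is the
    measure of F times the tail of [phi] beyond c r. *)
Lemma vanishing_far (F : set tup) i (r : R) : measurable F -> (bl F < +oo)%E -> 0 < r ->
  vanishing (fun z => ind1 F z * far i r z).
Proof.
move=> mF' fF r0 e e0.
have q0 : 0 < e / (fine (bl F) + 1) by rewrite divr_gt0// ltr_wpDl// fine_ge0.
have [A [_ hA]] := cut_vanishing i q0.
near=> c; have c0 : 0 < c by near: c; exact: nbhs_pinfty_gt.
have cr : A < c * r.
  by rewrite -ltr_pdivrMr//; near: c; exact: (nbhs_pinfty_gt (num_real _)).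
apply: (@le_trans _ _ (bl F * \int[bl]_t (cut i (c * r) t)%:E)%E); last first.
  apply: (@le_trans _ _ (bl F * (e / (fine (bl F) + 1))%:E)%E).
    by apply: lee_wpmul2l => //; exact: hA.
  rewrite -[X in (X * _)%E]fineK ?ge0_fin_numE// -EFinM lee_fin.
  rewrite mulrA ler_pdivrMr ?ltr_wpDl ?fine_ge0// mulrC ler_wpM2l ?(ltW e0)//.
  by rewrite lerDl.
rewrite -(mass_section c0 mF' (m_cut i _) (cut0 i _)) le_eqVlt; apply/orP; left; apply/eqP.
apply: eq_integral => x _; apply: eq_integral => y _; congr _%:E.
rewrite /cut /far /ind1 /= tnth_mktuple -!mulrA; congr (_ * _).
rewrite mulrC -!mulrA; do 2 congr (_ * _); rewrite !indicE; congr (nat_of_bool _)%:R.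
by apply/idP/idP; rewrite !inE /= normrM (gtr0_norm c0) ltr_pM2l.
Unshelve. all: by end_near. Qed.

(** If the hyperplane separates x from y, then either x lies in the slab of half-width 1/(n+1)
    around it, or the i-th coordinates differ by more than 1/(n+1). The slabs in F shrink to a null
    set, and the second kind of pair vanishes for each n. *)
Lemma asymptotically_invariant_halfspace (i : 'I_d) (a : R) :
  asymptotically_invariant [set x : tup | a < tnth x i].
Proof.
have mH : measurable [set x : tup | a < tnth x i].
  rewrite [X in measurable X](_ : _ = (fun x : tup => tnth x i) @^-1` `]a, +oo[); last first.
    by apply/seteqP; split => t /=; rewrite in_itv/= andbT.
  by rewrite -[X in measurable X]setTI; exact: (measurable_tnth i).
split => // F mF' fF; apply: vanishing_approx; first exact: weight_dist.
move=> e e0; pose S n := F `&` [set x : tup | `|tnth x i - a| <= n.+1%:R^-1].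
have mS n : measurable (S n).
  apply: measurableI => //.
  rewrite [X in measurable X](_ : _ = (fun x : tup => tnth x i) @^-1` `[a - n.+1%:R^-1, a + n.+1%:R^-1]).
    by rewrite -[X in measurable X]setTI; exact: (measurable_tnth i).
  by apply/seteqP; split => t /=; rewrite in_itv/= ler_distl.
have [n hn] : exists n, (bl (S n) * M%:E <= e%:E)%E.
  apply: nonincreasing_measure_cvg0 => //.
  - apply: le_lt_trans fF; apply: le_measure; rewrite ?inE//.
    by move=> x [].
  - move=> k x [Fx /= kx]; split => //=; apply: le_trans kx _.
    by rewrite lef_pV2 ?posrE// ler_nat.
  apply/eqP; rewrite -measure_le0 -(@bl_coord_null R d i [set a])//; last exact: lebesgue_measure_set1.
  apply: le_measure; rewrite ?inE//.
  - exact: bigcapT_measurable.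
  - by rewrite -[X in measurable X]setTI; apply: (measurable_tnth i).
  move=> x Sx /=; apply/eqP; rewrite -subr_eq0 -normr_le0; apply/ler_addgt0Pr => q q0.
  have [k _ hk] : \forall k \near \oo, k.+1%:R^-1 < q.
    by have := near_infty_natSinv_lt (PosNum q0).
  have [_ /= h] := Sx k I; rewrite add0r; apply: le_trans h (ltW _).
  exact: (hk k (leqnn k)).
have r0 : 0 < n.+1%:R^-1 :> R by rewrite invr_gt0.
exists (fun z => ind1 F z * far i n.+1%:R^-1 z), (ind1 (S n)).
split.
- by apply: weightM; [exact: weight_ind1|exact: weight_far].
- exact: weight_ind1.
- exact: vanishing_far.
- move=> [x y]; rewrite /dist /ind1 /ind2 /far !indicE /= in_setI.
  case: (x \in F) => /=; last by rewrite !mul0r addr0.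
  case: (y \in F) => /=; last by rewrite mulr0 mul0r addr_ge0// ?mulr_ge0.
  rewrite !mul1r.
  rewrite !mem_set_pred.
  clear hn; move: n.+1%:R^-1 => r in r0 *.
  case: (ltP a (tnth x i)) => hx; case: (ltP a (tnth y i)) => hy;
    rewrite ?subrr ?subr0 ?sub0r ?normrN ?normr0 ?normr1 ?addr_ge0//.
  + case: (leP `|tnth x i - a| r) => [h1|]; first by rewrite lerDr.
    rewrite ltr_normr => /orP[h1|h1]; last by exfalso; clear fF; lra.
    by rewrite ltr_normr (_ : (r < - _) = true) ?orbT ?addr0//; lra.
  + case: (leP `|tnth x i - a| r) => [h1|]; first by rewrite lerDr.
    rewrite ltr_normr => /orP[h1|h1]; first by exfalso; clear fF; lra.
    by rewrite ltr_normr (_ : (r < tnth y i - tnth x i) = true) ?addr0//; lra.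
by move=> c c0; rewrite mass_ind1.
Qed.

Lemma asymptotically_invariant_coord (i : 'I_d) (Y : set mR) : measurable Y ->
  asymptotically_invariant ((fun x : tup => tnth x i) @^-1` Y).
Proof.
have [s0 sC sU] := sigma_algebra_asymptotically_invariant.
have sgen : <<s @RGenOInfty.G R >> `<=`
    [set Y : set mR | asymptotically_invariant ((fun x : tup => tnth x i) @^-1` Y)].
  apply: smallest_sub; last first.
    move=> _ [a ->] /=; rewrite (_ : _ @^-1` _ = [set x : tup | a < tnth x i]).
      exact: asymptotically_invariant_halfspace.
    by apply/seteqP; split => t /=; rewrite in_itv/= andbT.
  split => /=; first by rewrite preimage_set0.
  - by move=> A hA; rewrite setTD preimage_setC -setTD; exact: sC.
  - by move=> A hA; rewrite preimage_bigcup; exact: sU.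
move=> mY; apply: sgen.
by have : (@RGenOInfty.G R).-sigma.-measurable Y by rewrite -RGenOInfty.measurableE.
Qed.

Lemma asymptotically_invariant_borel (E : set tup) : measurable E ->
  asymptotically_invariant E.
Proof.
apply: smallest_sub; first exact: sigma_algebra_asymptotically_invariant.
elim/big_ind : _ => [//|A B hA hB|i _]; first by rewrite subUset.
by move=> _ [Y mY <-]; rewrite setTI; exact: asymptotically_invariant_coord.
Qed.

Lemma vanishing_sum n (h : 'I_n -> tup * tup -> R) : (forall i, weight (h i)) ->
  (forall i, vanishing (h i)) -> vanishing (fun z => \sum_(i < n) h i z) /\
  weight (fun z => \sum_(i < n) h i z).
Proof.
elim: n h => [|n IH] h wh vh.
  rewrite (_ : (fun z => _) = cst 0); last by apply/funext => z; rewrite big_ord0.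
  split; last by split => //; exact: measurable_cst.
  move=> e e0; apply: nearW => c; rewrite /mass [X in (X <= _)%E](_ : _ = 0%E) ?lee_fin ?ltW//.
  by rewrite integral0_eq// => x _; rewrite integral0_eq// => y _; rewrite mul0r.
rewrite (_ : (fun z => _) = (fun z => h ord0 z + \sum_(i < n) h (lift ord0 i) z)); last first.
  by apply/funext => z; rewrite big_ord_recl.
have [v w] := IH (fun i => h (lift ord0 i)) (fun i => wh _) (fun i => vh _).
by split; [exact: (vanishingD (wh ord0) w (vh ord0) v)|exact: (weightD (wh ord0) w)].
Qed.

Let box (r : R) : set tup := [set t : tup | forall i, (- r <= tnth t i <= r)%R].

Let m_box r : measurable (box r).
Proof.
rewrite (_ : box r = \bigcap_(i in [set: 'I_d]) ((fun x : tup => tnth x i) @^-1` `[- r, r])).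
  apply: fin_bigcap_measurable => // i _.
  by rewrite -[X in measurable X]setTI; exact: (measurable_tnth i).
by apply/seteqP; split => [t bt i _|t bt i] /=; rewrite ?in_itv/=; [exact: bt|have := bt i I; rewrite /= in_itv].
Qed.

(** The complement of E may have infinite measure, so asymptotic invariance does not apply at once.
    Let x be in E and y outside. Either x lies outside a large box, a small set; or y lies in the
    box enlarged by 1, where [dist] applies; or some coordinate moves by more than 1, which is
    [far]. *)
Lemma vanishing_leak (E : set tup) : measurable E -> (bl E < +oo)%E ->
  vanishing (fun z => ind1 E z * ind2 (~` E) z).
Proof.
move=> mE fE; have mEC : measurable (~` E) by exact: measurableC.
apply: vanishing_approx.
  by apply: weightM; [exact: weight_ind1|exact: weight_ind2].
move=> e e0; pose S n := E `\` box n%:R.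
have mS n : measurable (S n) by exact: measurableD.
have [n hn] : exists n, (bl (S n) * M%:E <= e%:E)%E.
  apply: nonincreasing_measure_cvg0 => //.
  - apply: le_lt_trans fE; apply: le_measure; rewrite ?inE//.
    by move=> x [].
  - move=> k x [Ex nx]; split => //; apply: contra_not nx => bx i.
    have /andP[h1 h2] := bx i; have : (k%:R : R) <= k.+1%:R by rewrite ler_nat.
    by move=> h; apply/andP; split; lra.
  rewrite (_ : \bigcap_n S n = set0) ?measure0// -subset0 => x Sx.
  (* The box of half-width K contains x, since K exceeds the sum of the moduli of its
     coordinates. *)
  pose K := (Num.truncn (\sum_(i < d) `|tnth x i|)).+1.
  have [_] := Sx K I; apply => i; rewrite -ler_norml.
  apply: (@le_trans _ _ (\sum_(i < d) `|tnth x i|)); last by rewrite ltW// truncnS_gt.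
  by rewrite (bigD1 i)//= lerDl sumr_ge0.
have mQ := m_box n%:R; have mQ1 := m_box (n%:R + 1).
have fQ : (bl (box n%:R) < +oo)%E := bl_box_fin d n%:R.
have fQ1 : (bl (box (n%:R + 1)) < +oo)%E := bl_box_fin d (n%:R + 1).
have [vs ws] := vanishing_sum (fun i => weightM (weight_ind1 mQ) (weight_far i 1))
  (fun i => vanishing_far i mQ fQ ltr01).
have [_ vE] := asymptotically_invariant_borel mE.
have wd := weight_dist mE mQ1.
exists (fun z => dist E (box (n%:R + 1)) z + \sum_(i < d) ind1 (box n%:R) z * far i 1 z), (ind1 (S n)).
split.
- exact: weightD.
- exact: weight_ind1.
- exact: (vanishingD wd ws (vE _ mQ1 fQ1) vs).
- move=> z; have [_ /(_ z) d0] := wd; have [_ /(_ z) s0] := ws.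
  have [_ /(_ z) i0] := weight_ind1 (mS n).
  case: (boolP (z.1 \in E)) => z1; last first.
    by rewrite /ind1 indicE (negbTE z1) mul0r !addr_ge0.
  case: (boolP (z.2 \in E)) => z2.
    by rewrite [ind2 _ _]indicE in_setC z2 mulr0 !addr_ge0.
  have -> : ind1 E z * ind2 (~` E) z = 1 by rewrite /ind1 /ind2 !indicE in_setC z1 z2 mulr1.
  case: (boolP (z.1 \in box n%:R)) => b1; last first.
    have -> : ind1 (S n) z = 1 by rewrite /ind1 indicE in_setD z1 b1.
    by rewrite lerDr addr_ge0.
  case: (boolP (z.2 \in box (n%:R + 1))) => b2.
    have -> : dist E (box (n%:R + 1)) z = 1.
      rewrite /dist /ind1 /ind2 !indicE z1 (negbTE z2) b2 mem_set ?mulr1 ?mul1r ?subr0 ?normr1//.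
      move: b1; rewrite inE => h i; have /andP[h1 h2] := h i; apply/andP; split; lra.
    by rewrite -addrA lerDl addr_ge0.
  have [i hi] : exists i, 1 < `|tnth z.2 i - tnth z.1 i|.
    apply: contrapT => /forallNP nh; move/negP: b2; apply; rewrite inE => i.
    have := nh i; move/negP; rewrite -leNgt ler_norml => /andP[h1 h2].
    move: b1; rewrite inE => /(_ i)/andP[h3 h4]; apply/andP; split; lra.
  have : 1 <= \sum_(i < d) ind1 (box n%:R) z * far i 1 z.
    rewrite (bigD1 i)//= {1}/ind1 indicE b1 mul1r {1}/far indicE mem_set//= lerDl.
    have [_ p1] := weight_ind1 mQ.
    by apply: sumr_ge0 => j _; have [_ p2] := weight_far j 1; exact: mulr_ge0.
  lra.
by move=> c c0; rewrite mass_ind1.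
Qed.

(** Starting from a point of E the total mass is M |E| for each c; it splits into the part ending in
    E and the leak. *)
Theorem approximate_identity_borel (E : set tup) (e : R) : measurable E ->
  (bl E < +oo)%E -> 0 < e ->
  \forall c \near +oo, ((M * fine (bl E) - e)%:E <= mass c (fun z => (ind1 E z * ind2 E z)%R))%E.
Proof.
move=> mE fE e0; have mEC : measurable (~` E) by exact: measurableC.
apply: filterS (filterI (vanishing_leak mE fE e0) (nbhs_pinfty_gt (num_real 0))).
move=> c [l1 c0].
have h : (mass c (fun z => (ind1 E z * ind2 E z)%R) + mass c (fun z => (ind1 E z * ind2 (~` E) z)%R) =
    (M * fine (bl E))%:E)%E.
  have -> : (M * fine (bl E))%:E = mass c (ind1 E).
    by rewrite mass_ind1// -[bl E]fineK ?ge0_fin_numE// -EFinM mulrC.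
  have w1 := weightM (weight_ind1 mE) (weight_ind2 mE).
  have w2 := weightM (weight_ind1 mE) (weight_ind2 mEC).
  rewrite -(massD c0 w1 w2).
  congr mass; apply/funext => z.
  rewrite -mulrDr (_ : ind2 E z + ind2 (~` E) z = 1) ?mulr1//.
  by rewrite /ind2 !indicE in_setC; case: (z.2 \in E); rewrite /= ?addr0 ?add0r.
rewrite EFinB -h leeBlDr; last by [].
exact: (leeD (lexx _) l1).
Qed.

End approximate_identity.

(** * Bessel's inequality for the Fourier transform *)

Lemma ind_ge0 (R : realType) (T : Type) (A : set T) x : 0 <= (\1_A x : R).
Proof. by rewrite indicE ler0n. Qed.

Lemma ind_le1 (R : realType) (T : Type) (A : set T) x : (\1_A x : R) <= 1.
Proof. by rewrite indicE; case: (x \in A). Qed.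

(** Dominated convergence with [w] itself as the bound. For Bessel's inequality [w] is |F u|^2 cut
    off to B, integrable because the transform is bounded and B has finite measure. *)
Lemma Rintegral_le_damped dT (T : measurableType dT) (R : realType)
    (mu : {measure set T -> \bar R}) (w : T -> R) (p : nat -> T -> R) (N : R) :
  mu.-integrable setT (EFin \o w) -> (forall x, 0 <= w x) ->
  (forall n, measurable_fun setT (p n)) -> (forall n x, 0 <= p n x <= 1) ->
  (forall x, p n x @[n --> \oo] --> (1 : R)) ->
  (forall n, \int[mu]_x (p n x * w x) <= N) -> \int[mu]_x w x <= N.
Proof.
move=> Iw w0 mp p01 p1 H.
have mw : measurable_fun setT w by apply/measurable_EFinP; exact: measurable_int Iw.
have mf n : measurable_fun setT (fun x => p n x * w x) by exact: measurable_funM.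
have f0 n x : 0 <= p n x * w x by have /andP[? _] := p01 n x; rewrite mulr_ge0.
have lef n x : p n x * w x <= w x by have /andP[_ ?] := p01 n x; rewrite ler_piMl.
have If n : mu.-integrable setT (EFin \o (fun x => p n x * w x)).
  apply: le_integrable Iw => //; first exact/measurable_EFinP.
  by move=> x _; rewrite /= lee_fin !ger0_norm.
have L : (\int[mu]_x (p n x * w x)%:E @[n --> \oo] --> \int[mu]_x (w x)%:E)%E.
  apply: (@dominated_cvg _ _ _ mu setT measurableT (fun n x => (p n x * w x)%:E) _ (EFin \o w)) => //.
  - by move=> n; apply/measurable_EFinP.
  - move=> x _; apply: cvg_EFin; first by apply: nearW.
    by rewrite -[X in _ --> X]mul1r; apply: cvgM => //; exact: cvg_cst.
  - by move=> n x _; rewrite /= lee_fin ger0_norm.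
rewrite -lee_fin {1}/Rintegral fineK; last exact: integrable_fin_num.
apply: (cvge_to_le L); apply: nearW => n.
by rewrite -(fineK (integrable_fin_num measurableT (If n))) lee_fin; exact: H.
Qed.

Section energy_bounds.
Context {R : realType}.
Variable d : nat.
Local Notation mR := (measurableTypeR R).
Local Notation tup := (d.-tuple mR).
Local Notation bl := (@borel_lebesgue R d).
Local Notation Rd := (@Rd R d).
Local Notation mu := (@lebs R d).
Local Notation sdiff := (@scaled_diff R d).
Local Notation mE := (@cmeas_wave_kernel R d).
Local Notation E1 := (@normc_wave_kernel R d).
Local Notation K := (@wave_kernel R d).

Lemma measurable_ofRd2 : measurable_fun setT (fun z : Rd * Rd => (ofRd z.1, ofRd z.2)).
Proof.
apply: measurable_fun_pair.
  exact: (measurableT_comp (@measurable_ofRd R d) measurable_fst).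
exact: (measurableT_comp (@measurable_ofRd R d) measurable_snd).
Qed.

Lemma ge0_integral_ofRd (g : tup -> \bar R) : measurable_fun setT g -> (forall t, (0 <= g t)%E) ->
  (\int[mu]_x g (ofRd x) = \int[bl]_t g t)%E.
Proof.
exact: (ge0_integral_preserving (@measurable_ofRd R d) (@lebs_ofRd R d)).
Qed.

Definition poisson_kernel e (z : Rd * Rd) : R := poissond e (sdiff 1 (ofRd z.1) (ofRd z.2)).

Lemma measurable_poisson_kernel e : 0 < e -> measurable_fun setT (poisson_kernel e).
Proof.
move=> e0; apply: (measurableT_comp (@measurable_poissond R d e e0)).
exact: (measurableT_comp (@measurable_scaled_diff R d 1) measurable_ofRd2).
Qed.

Lemma poisson_kernel_ge0 e z : 0 < e -> 0 <= poisson_kernel e z.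
Proof. exact: poissond_ge0. Qed.

Lemma integral_poisson_kernelr e x : 0 < e -> (\int[mu]_y (poisson_kernel e (x, y))%:E = 1)%E.
Proof.
move=> e0; have mp : measurable_fun setT (fun t : tup => (poissond e t)%:E : \bar R).
  by apply/measurable_EFinP; exact: measurable_poissond.
rewrite (ge0_integral_ofRd (g := fun t => (poissond e (sdiff 1 (ofRd x) t))%:E)).
- rewrite (integral_scaled_diffr (ofRd x) ltr01 mp) => [|t]; last by rewrite lee_fin poissond_ge0.
  by rewrite integral_poissond// expr1n invr1 mule1.
- apply: (measurableT_comp mp); exact: (measurableT_comp (@measurable_scaled_diff R d 1) (measurable_pair1 _)).
- by move=> t; rewrite lee_fin poissond_ge0.
Qed.

Lemma integral_poisson_kernell e y : 0 < e -> (\int[mu]_x (poisson_kernel e (x, y))%:E = 1)%E.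
Proof.
move=> e0; have mp : measurable_fun setT (fun t : tup => (poissond e t)%:E : \bar R).
  by apply/measurable_EFinP; exact: measurable_poissond.
rewrite (ge0_integral_ofRd (g := fun t => (poissond e (sdiff 1 t (ofRd y)))%:E)).
- rewrite (integral_scaled_diffl (ofRd y) ltr01 mp) => [|t]; last by rewrite lee_fin poissond_ge0.
  by rewrite integral_poissond// expr1n invr1 mule1.
- apply: (measurableT_comp mp); exact: (measurableT_comp (@measurable_scaled_diff R d 1) (measurable_pair2 _)).
- by move=> t; rewrite lee_fin poissond_ge0.
Qed.

Lemma damp_cvg1 (t : tup) : damp n.+1%:R^-1 t @[n --> \oo] --> (1 : R).
Proof.
pose S : R := \sum_(i < d) `|tnth t i|.
have dampE e : damp e t = expR (- (2 * pi * S) * e).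
  rewrite /damp /S -(big_morph _ (@expRD R) (@expR0 R)) -mulr_sumr; congr expR; ring.
rewrite (_ : (fun n => _) = (fun n => expR (- (2 * pi * S) * n.+1%:R^-1))); last exact/funext.
have h : - (2 * pi * S) * n.+1%:R^-1 @[n --> \oo] --> (0 : R).
  rewrite -(mulr0 (- (2 * pi * S))); apply: cvgM; first exact: cvg_cst.
  exact: cvg_harmonic.
have c : expR x @[x --> (0 : R)] --> (1 : R).
  by rewrite -[X in _ --> X](@expR0 R); exact: continuous_expR.
exact: (cvg_comp _ _ h c).
Qed.

Lemma damped_energy_nm2_le e (u : Rd -> R[i]) : 0 < e -> sqint mu u -> cintble mu u ->
  \int[mu]_xi (damp e (ofRd xi) * normc (transform mu K u xi) ^+ 2) <=
  \int[mu]_x normc (u x) ^+ 2.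
Proof.
move=> e0 su iu.
apply: (damped_energy_le mE E1 (integrable_damp d e0) (fun x => damp_ge0 _ _) iu
  (measurable_poisson_kernel e0) (fun z => poisson_kernel_ge0 z e0) (fun x y => damped_wave x y e0) su).
- by move=> x; rewrite integral_poisson_kernelr.
- by move=> y; rewrite integral_poisson_kernell.
Qed.

Lemma integrable_damped_transform e (u : Rd -> R[i]) : 0 < e -> cintble mu u ->
  mu.-integrable setT (EFin \o (fun xi => damp e (ofRd xi) * normc (transform mu K u xi) ^+ 2)).
Proof.
move=> e0 iu; pose M := \int[mu]_x normc (u x); pose F := transform mu K u.
have FM x : normc (F x) ^+ 2 <= M ^+ 2.
  rewrite ler_sqr ?nnegrE ?normc_ge0//; first exact: (normc_transform mE E1 x iu).
  exact: le_trans (normc_ge0 _) (normc_transform mE E1 x iu).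
have cF : cmeas F by exact: (cmeas_transform mu mE (cintble_meas iu)).
rewrite -/F; clearbody F.
apply: (le_integrable measurableT _ _ (integrableZr measurableT (M ^+ 2) (integrable_damp d e0))).
  apply/measurable_EFinP; apply: (measurable_funM _ (cmeas_sqr_normc cF)).
  exact: (measurableT_comp (measurable_damp _) (@measurable_ofRd R d)).
move=> x _; rewrite /= lee_fin ger0_norm; last by rewrite mulr_ge0 ?damp_ge0 ?sqr_ge0.
by apply: le_trans (ler_norm _); rewrite ler_wpM2l ?damp_ge0.
Qed.

Section band.
Variables (A B : set Rd).
Hypotheses (mA : measurable A) (mB : measurable B)
  (A_fin : (mu A < +oo)%E) (B_fin : (mu B < +oo)%E).

(** For each damping parameter, Schur's test bounds the damped energy by the squared norm of
    [1_A u]; on B the damping can then be sent to 1. *)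
Lemma nm2_band_le_nm2 u : nm2 (@ip2 _ _ _ mu) (band mE E1 mA mB A_fin B_fin u) <=
  nm2 (@ip2 _ _ _ mu) u.
Proof.
pose F := transform mu K (chi A u).
have su := sqint_chi mA (l2_sqint u).
have iu := chi_sqint_cintble mA A_fin (l2_sqint u).
have cF : cmeas F by exact: (cmeas_transform mu mE (cintble_meas iu)).
have mF2 : measurable_fun setT (fun x => normc (F x) ^+ 2) by exact: cmeas_sqr_normc.
have m1B : measurable_fun setT (fun x => \1_B x : R) by exact: measurable_indic.
have bE x : normc (band mE E1 mA mB A_fin B_fin u x) ^+ 2 = \1_B x * normc (F x) ^+ 2.
  by rewrite normc_chi exprMn -[\1_B x ^+ 2]/(\1_B x * \1_B x) ind_idem.
have Ib : mu.-integrable setT (EFin \o (fun x => \1_B x * normc (F x) ^+ 2)).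
  have [_] := l2_sqint (band mE E1 mA mB A_fin B_fin u); congr integrable.
  by apply/funext => x /=; rewrite bE.
rewrite !nm2_ip2E; under eq_Rintegral do rewrite bE.
have uu : \int[mu]_x normc (chi A u x) ^+ 2 <= \int[mu]_x normc (u x) ^+ 2.
  apply: le_Rintegral => //; [by case: su|by case: (l2_sqint u)|].
  move=> x _; rewrite normc_chi exprMn ler_piMl ?sqr_ge0//.
apply: le_trans uu.
set N := Rintegral _ _ (fun x => normc (chi A u x) ^+ 2).
have e0 n : 0 < n.+1%:R^-1 :> R by rewrite invr_gt0.
have w0 x : 0 <= \1_B x * normc (F x) ^+ 2 by apply: mulr_ge0; [exact: ind_ge0|exact: sqr_ge0].
have mp n : measurable_fun setT (fun x : Rd => damp n.+1%:R^-1 (ofRd x)).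
  exact: (measurableT_comp (measurable_damp _) (@measurable_ofRd R d)).
have p01 n (x : Rd) : 0 <= damp n.+1%:R^-1 (ofRd x) <= 1 by rewrite damp_ge0 damp_le1.
apply: (Rintegral_le_damped Ib w0 mp p01 (fun x => damp_cvg1 _)) => n.
have HN := damped_energy_nm2_le (e0 n) su iu; rewrite -/F -/N in HN; apply: le_trans HN.
have IF := integrable_damped_transform (e0 n) iu; rewrite -/F in IF; clearbody F.
apply: le_Rintegral => //.
- apply: (le_integrable measurableT _ _ IF).
    apply/measurable_EFinP; exact: (measurable_funM (mp n) (measurable_funM m1B mF2)).
  move=> x _; rewrite /= lee_fin !ger0_norm ?mulr_ge0 ?damp_ge0 ?sqr_ge0 ?normc_ge0//.
  by rewrite ler_wpM2l ?damp_ge0// ler_piMl ?sqr_ge0 ?ind_le1.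
- by move=> x _; rewrite ler_wpM2l ?damp_ge0// ler_piMl ?sqr_ge0 ?ind_le1.
Qed.

End band.

End energy_bounds.

(** * Lower bound for the kernel energy on dilated sets *)

Lemma iterated_integral_le d1 d2 (T1 : measurableType d1) (T2 : measurableType d2) (R : realType)
    (m1 : {sigma_finite_measure set T1 -> \bar R}) (m2 : {sigma_finite_measure set T2 -> \bar R})
    (f g : T1 * T2 -> \bar R) :
  measurable_fun setT f -> measurable_fun setT g -> (forall z, (0 <= f z)%E) ->
  (forall z, (f z <= g z)%E) ->
  (\int[m1]_x \int[m2]_y f (x, y) <= \int[m1]_x \int[m2]_y g (x, y))%E.
Proof.
move=> mf mg f0 fg; have g0 z : (0 <= g z)%E := le_trans (f0 z) (fg z).
apply: ge0_le_integral => //.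
- by move=> x _; apply: integral_ge0.
- exact: (measurable_fun_fubini_tonelli_F _ mf f0).
- exact: (measurable_fun_fubini_tonelli_F _ mg g0).
move=> x _; apply: ge0_le_integral => //.
- exact: (measurableT_comp mf (measurable_pair1 x)).
- exact: (measurableT_comp mg (measurable_pair1 x)).
Qed.

Lemma iterated_integral_ae d0 (T : measurableType d0) (R : realType)
    (m : {sigma_finite_measure set T -> \bar R}) (f g : T * T -> \bar R) (P : T -> Prop) :
  measurable_fun setT f -> measurable_fun setT g -> (forall z, (0 <= f z)%E) ->
  (forall z, (0 <= g z)%E) -> {ae m, forall x, P x} ->
  (forall x y, P x -> P y -> f (x, y) = g (x, y)) ->
  (\int[m]_x \int[m]_y f (x, y) = \int[m]_x \int[m]_y g (x, y))%E.
Proof.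
move=> mf mg f0 g0 aeP fg; apply: ae_eq_integral => //.
- exact: (measurable_fun_fubini_tonelli_F _ mf f0).
- exact: (measurable_fun_fubini_tonelli_F _ mg g0).
have aeP' := aeP; apply: filterS aeP => x Px _; apply: ae_eq_integral => //.
- exact: (measurableT_comp mf (measurable_pair1 x)).
- exact: (measurableT_comp mg (measurable_pair1 x)).
by apply: filterS aeP' => y Py _; exact: fg.
Qed.

Lemma iterated_integral_transport d0 (T : measurableType d0) (R : realType)
    (m : {sigma_finite_measure set T -> \bar R}) (s : T -> T) (k : {nonneg R}) (f : T * T -> \bar R) :
  measurable_fun setT s -> (forall S, measurable S -> m (s @^-1` S) = (k%:num%:E * m S)%E) ->
  measurable_fun setT f -> (forall z, (0 <= f z)%E) ->
  (\int[m]_x \int[m]_y f (s x, s y) =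
   k%:num%:E * \int[m]_x \int[m]_y (k%:num%:E * f (x, y)))%E.
Proof.
move=> ms H mf f0.
have mx x : measurable_fun setT (fun y => f (x, y)) by exact: (measurableT_comp mf (measurable_pair1 x)).
transitivity (\int[m]_x (k%:num%:E * \int[m]_y f (s x, y)))%E.
  apply: eq_integral => x _.
  exact: (ge0_integral_transport ms H (mx (s x)) (fun y => f0 (s x, y))).
have mF := measurable_fun_fubini_tonelli_F _ mf f0.
have F0 x : (0 <= \int[m]_y f (x, y))%E by apply: integral_ge0.
rewrite (ge0_integral_transport ms H (g := fun x => (k%:num%:E * \int[m]_y f (x, y))%E)).
- by congr (_ * _)%E; apply: eq_integral => x _; rewrite ge0_integralZl.
- exact: (measurable_funeM _ (mF m)).
- by move=> x; rewrite mule_ge0// lee_fin.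
Qed.

Section hilbert_schmidt_lower_bound.
Context {R : realType}.
Variable d : nat.
Local Notation mR := (measurableTypeR R).
Local Notation tup := (d.-tuple mR).
Local Notation bl := (@borel_lebesgue R d).
Local Notation Rd := (@Rd R d).
Local Notation mu := (@lebs R d).
Local Notation sdiff := (@scaled_diff R d).
Local Notation mE := (@cmeas_wave_kernel R d).
Local Notation E1 := (@normc_wave_kernel R d).
Local Notation K := (@wave_kernel R d).

(** [G] lives on pairs of Borel tuples whereas A is Lebesgue measurable: A can be exchanged for a
    Borel hull while [G] stays a Borel function. *)
Definition pair_energy (A : set Rd) (G : tup * tup -> R) : \bar R :=
  (\int[mu]_x \int[mu]_y (\1_A x * \1_A y * G (ofRd x, ofRd y))%:E)%E.

Section pair_energy.
Variables (G : tup * tup -> R).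
Hypotheses (mG : measurable_fun setT G) (G0 : forall z, 0 <= G z).

Let mGR : measurable_fun setT (fun z : Rd * Rd => G (ofRd z.1, ofRd z.2)).
Proof. exact: (measurableT_comp mG (@measurable_ofRd2 R d)). Qed.

Lemma measurable_pair_energy (A : set Rd) : measurable A ->
  measurable_fun setT (fun z : Rd * Rd => (\1_A z.1 * \1_A z.2 * G (ofRd z.1, ofRd z.2))%:E).
Proof.
move=> mA; apply/measurable_EFinP; apply: measurable_funM mGR.
apply: measurable_funM.
  exact: (measurableT_comp (measurable_indic mA) measurable_fst).
exact: (measurableT_comp (measurable_indic mA) measurable_snd).
Qed.

Let pe0 (A : set Rd) z : (0 <= (\1_A z.1 * \1_A z.2 * G (ofRd z.1, ofRd z.2))%:E)%E.
Proof. by rewrite lee_fin; apply: mulr_ge0 => //; apply: mulr_ge0; exact: ind_ge0. Qed.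

Lemma pair_energy_ae (A E : set Rd) : measurable A -> measurable E -> A `<=` E ->
  mu (E `\` A) = 0%E -> pair_energy A G = pair_energy E G.
Proof.
move=> mA mE' AE EA0.
have ae : {ae mu, forall x, (\1_A x : R) = \1_E x}.
  exists (E `\` A); split => //; first exact: measurableD.
  move=> x /=; rewrite !indicE => h; split; apply: contrapT => n; apply: h.
    by rewrite !memNset// => /AE.
  have Ax : A x by exact: contrapT.
  by rewrite !mem_set//; exact: AE.
have mA' := measurable_pair_energy mA; have mE'' := measurable_pair_energy mE'.
apply: (iterated_integral_ae mA' mE'' (pe0 A) (pe0 E) ae) => x y ex ey.
by rewrite /= ex ey.
Qed.

Lemma pair_energy_borel (E : set tup) : measurable E ->
  pair_energy E G = (\int[bl]_x \int[bl]_y (\1_E x * \1_E y * G (x, y))%:E)%E.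
Proof.
move=> mE'.
have mH : measurable_fun setT (fun z : tup * tup => (\1_E z.1 * \1_E z.2 * G z)%:E).
  apply/measurable_EFinP; apply: measurable_funM mG; apply: measurable_funM.
    exact: (measurableT_comp (measurable_indic mE') measurable_fst).
  exact: (measurableT_comp (measurable_indic mE') measurable_snd).
have H0 z : (0 <= (\1_E z.1 * \1_E z.2 * G z)%:E)%E.
  by rewrite lee_fin; apply: mulr_ge0 => //; apply: mulr_ge0; exact: ind_ge0.
rewrite -(ge0_integral_ofRd (measurable_fun_fubini_tonelli_F _ mH H0)); last first.
  by move=> x; apply: integral_ge0 => y _; exact: (H0 (x, y)).
apply: eq_integral => x _; rewrite /fubini_F.
exact: (ge0_integral_ofRd (measurableT_comp mH (measurable_pair1 (ofRd x))) (fun y => H0 (ofRd x, y))).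
Qed.

End pair_energy.

(** A Borel hull differs from A by a null set and so has the same [pair_energy] for every c, which
    reduces the claim to Borel sets. *)
Theorem approximate_identity (phi : tup -> R) (M : R) (A : set Rd) (e : R) :
  measurable_fun setT phi -> (forall t, 0 <= phi t) -> (\int[bl]_t (phi t)%:E = M%:E)%E ->
  measurable A -> (mu A < +oo)%E -> 0 < e ->
  \forall c \near +oo, ((M * fine (mu A) - e)%:E <=
    pair_energy A (fun z => (c ^+ d * phi (sdiff c z.1 z.2))%R))%E.
Proof.
move=> mphi phi0 phiM mA fA e0.
have [E [mE' AE EA]] := borel_hull mA fA.
have muE : mu A = bl E.
  rewrite -(lebs_borel mE'); transitivity (mu (A `|` (E `\` A))).
    rewrite measureU.
    - by rewrite [X in (_ + X)%E]EA adde0.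
    - exact: mA.
    - by apply: measurableD; [exact: borel_Rd|exact: mA].
    - exact: setDIK.
  by rewrite setDUK.
rewrite muE in fA *.
apply: filterS (filterI (approximate_identity_borel mphi phi0 phiM mE' fA e0) (nbhs_pinfty_gt (num_real 0))).
move=> c [h c0]; apply: le_trans h _.
have mG : measurable_fun setT (fun z : tup * tup => c ^+ d * phi (sdiff c z.1 z.2)).
  by apply: measurable_funM => //; exact: (measurableT_comp mphi (measurable_scaled_diff c)).
have G0 z : 0 <= c ^+ d * phi (sdiff c z.1 z.2) by rewrite mulr_ge0// exprn_ge0// ltW.
rewrite (pair_energy_ae mG G0 mA (borel_Rd mE') AE EA) (pair_energy_borel mG G0 mE').
by [].
Qed.

Lemma pair_energy_le (A : set Rd) (G H : tup * tup -> R) : measurable A ->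
  measurable_fun setT G -> measurable_fun setT H -> (forall z, 0 <= G z) ->
  (forall z, G z <= H z) -> (pair_energy A G <= pair_energy A H)%E.
Proof.
move=> mA mG mH G0 GH; have H0 z : 0 <= H z := le_trans (G0 z) (GH z).
have m1 := measurable_pair_energy mG mA; have m2 := measurable_pair_energy mH mA.
have p1 z : (0 <= (\1_A z.1 * \1_A z.2 * G (ofRd z.1, ofRd z.2))%:E)%E.
  by rewrite lee_fin; apply: mulr_ge0 => //; apply: mulr_ge0; exact: ind_ge0.
apply: (iterated_integral_le _ _ m1 m2 p1) => z.
rewrite lee_fin; apply: ler_wpM2l (GH _).
by apply: mulr_ge0; exact: ind_ge0.
Qed.

(** Each of the two variables brings a Jacobian c^d: one is the growth of volume, the other
    normalizes the approximate identity. *)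
Lemma pair_energy_dilate (A : set Rd) (phi : tup -> R) c : 0 < c -> measurable A ->
  measurable_fun setT phi -> (forall t, 0 <= phi t) ->
  pair_energy (dilate c A) (fun z => phi (sdiff 1 z.1 z.2)) =
  ((c ^+ d)%:E * pair_energy A (fun z => (c ^+ d * phi (sdiff c z.1 z.2))%R))%E.
Proof.
move=> c0 mA mphi phi0; have ic0 : 0 < c^-1 by rewrite invr_gt0.
have k0 : 0 <= c ^+ d by rewrite exprn_ge0// ltW.
have mG : measurable_fun setT (fun z : tup * tup => phi (sdiff c z.1 z.2)).
  exact: (measurableT_comp mphi (measurable_scaled_diff c)).
have H S : measurable S -> mu (scale c^-1 @^-1` S) = ((c ^+ d)%:E * mu S)%E.
  by move=> mS; rewrite lebs_scale// exprVn invrK.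
have mf := measurable_pair_energy mG mA.
have f0 (z : Rd * Rd) : (0 <= (\1_A z.1 * \1_A z.2 * phi (sdiff c (ofRd z.1) (ofRd z.2)))%:E)%E.
  by rewrite lee_fin; apply: mulr_ge0 => //; apply: mulr_ge0; exact: ind_ge0.
have indD x : (\1_(dilate c A) x : R) = \1_A (scale c^-1 x).
  by rewrite dilateE ?gt_eqF// !indicE; congr (nat_of_bool _)%:R; apply/idP/idP; rewrite !inE.
have sdE (x y : Rd) : sdiff 1 (ofRd x) (ofRd y) = sdiff c (ofRd (scale c^-1 x)) (ofRd (scale c^-1 y)).
  apply: eq_from_tnth => i; rewrite !tnth_mktuple mul1r -!/(Defs.coord _ _).
  by rewrite mulrBr !mulrA divff ?gt_eqF// !mul1r.
have T := iterated_integral_transport (k := NngNum k0) (measurable_scale ic0) H mf f0.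
rewrite /pair_energy; transitivity (\int[mu]_x \int[mu]_y (\1_A (scale c^-1 x) * \1_A (scale c^-1 y) *
    phi (sdiff c (ofRd (scale c^-1 x)) (ofRd (scale c^-1 y))))%:E)%E.
  apply: eq_integral => x _; apply: eq_integral => y _.
  by rewrite -sdE indD indD.
apply: (eq_trans T); apply: (f_equal (fun t => (c ^+ d)%:E * t)%E).
apply: eq_integral => x _; apply: eq_integral => y _.
by rewrite -EFinM mulrCA.
Qed.

Section window.
Variable B : set Rd.
Hypotheses (mB : measurable B) (B_fin : (mu B < +oo)%E).

Let oneB := chi B (fun=> 1 : R[i]).

Let I1B : cintble mu oneB.
Proof. by apply: (chi_cintble mB B_fin (cmeas_cst _ 1) (M := 1)) => x; rewrite ComplexField.Normc.normc1. Qed.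

(** The function |F 1_B|^2, read on Borel tuples so that it can serve as the profile of an
    approximate identity. *)
Definition window (t : tup) : R := normc (transform mu K oneB (t : Rd)) ^+ 2.

Lemma window_ge0 t : 0 <= window t.
Proof. exact: sqr_ge0. Qed.

Lemma measurable_window : measurable_fun setT window.
Proof.
apply: cmeas_sqr_normc.
apply: (@cmeas_cint _ _ tup Rd R mu (fun z => conjc (cexpi (2 * pi * dot z.2 (z.1 : Rd))) * oneB z.2)).
apply: cmeasM; last exact: (cmeas_comp measurable_snd (cintble_meas I1B)).
apply: cmeasJ; apply: cmeas_cexpi; apply: measurable_funM => //.
apply: (@measurable_dot _ _ _ _ (fun z : tup * Rd => ofRd z.2) (fun z : tup * Rd => z.1)).
  exact: (measurableT_comp (@measurable_ofRd R d) measurable_snd).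
exact: measurable_fst.
Qed.

Lemma normc_kernel (y z : Rd) :
  normc (cint mu (fun xi => K (z, xi) * ((\1_B xi)%:C * conjc (K (y, xi))))) ^+ 2 =
  window (sdiff 1 (ofRd y) (ofRd z)).
Proof.
rewrite /window; congr (_ ^+ 2); set w := sdiff _ _ _.
rewrite -[RHS]normc_conjc /transform -cintJ; last exact: (cintble_transform mE E1 _ I1B).
congr normc; apply: (f_equal (cint mu)); apply/funext => xi.
rewrite conjc_mulJ /oneB /chi mulr1 conjc_real mulrC -mulrA mulrC; congr (_ * _).
rewrite /wave_kernel -cexpiN -cexpiD; apply: (f_equal (@cexpi R)).
rewrite addrC -mulrBr /dot -sumrB; congr (_ * _); apply: eq_bigr => i _.
rewrite /w -![Defs.coord _ _]/(tnth _ _) tnth_mktuple mul1r -mulrBl mulrC.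
by [].
Qed.

Let damped L (t : tup) : R := damp L^-1 t * window t.

Let m_damped L : measurable_fun setT (damped L).
Proof. exact: (measurable_funM (measurable_damp _) measurable_window). Qed.

Let damped0 L t : 0 <= damped L t.
Proof. by apply: mulr_ge0; [exact: damp_ge0|exact: window_ge0]. Qed.

(** By the weighted Plancherel identity, the mass of the damped window is itself a Poisson
    approximate identity at scale L tested on B x B; hence it is close to |B| for large L. *)
Lemma window_mass L : 0 < L -> exists M : R, (\int[bl]_t (damped L t)%:E = M%:E)%E /\
  (M%:E = pair_energy B (fun z => (L ^+ d * poissond 1 (sdiff L z.1 z.2))%R))%E.
Proof.
move=> L0; have iL0 : 0 < L^-1 by rewrite invr_gt0.
exists (\int[mu]_xi (damp L^-1 (ofRd xi) * normc (transform mu K oneB xi) ^+ 2)).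
have uB x : oneB x = (\1_B x : R)%:C by rewrite /oneB /chi mulr1.
have E := damped_energy_real mE E1 (integrable_damp d iL0) (fun x => damp_ge0 _ _) I1B
  (measurable_poisson_kernel iL0) (fun z => poisson_kernel_ge0 z iL0)
  (fun x y => damped_wave x y iL0) (@ind_ge0 R Rd B) uB.
split.
  have mEd : measurable_fun setT (fun t => (damped L t)%:E) by exact/measurable_EFinP.
  rewrite -(ge0_integral_ofRd mEd) => [|t]; last by rewrite lee_fin.
  rewrite /Rintegral fineK//.
  exact: (integrable_fin_num measurableT (integrable_damped_transform iL0 I1B)).
rewrite E /pair_energy; apply: eq_integral => x _; apply: eq_integral => y _.
by congr (_ * _)%:E; rewrite /poisson_kernel -poissond_scale.
Qed.

(** Two limits in a fixed order: L is chosen so that the damped window has mass M close to |B|, then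
    c tends to infinity with this damped window as profile. Passing from the damped to the full
    window only increases the energy. *)
Lemma energy_lower (A : set Rd) (e : R) : measurable A -> (mu A < +oo)%E -> 0 < e ->
  \forall c \near +oo, ((c ^+ d * (fine (mu A) * fine (mu B) - e))%:E <=
    pair_energy (dilate c A) (fun z => window (sdiff 1 z.1 z.2)))%E.
Proof.
move=> mA fA e0; set a := fine (mu A); set b := fine (mu B).
have a0 : 0 <= a by exact: fine_ge0.
(* The loss in M gets multiplied by a, so this choice keeps it below e/2; the summand 1 covers a =
   0. *)
have e1 : 0 < e / (2 * (a + 1)) by rewrite divr_gt0// mulr_gt0// ltr_wpDl.
have [L [L0 hL]] : exists L, 0 < L /\ ((b - e / (2 * (a + 1)))%:E <=
    pair_energy B (fun z => (L ^+ d * poissond 1 (sdiff L z.1 z.2))%R))%E.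
  have H := filterI (approximate_identity (@measurable_poissond R d _ ltr01)
     (fun t => poissond_ge0 t ltr01) (integral_poissond d ltr01) mB B_fin e1)
     (nbhs_pinfty_gt (num_real 0)).
  have [L [h L0]] := filter_ex (H _).
  by exists L; split => //; rewrite mul1r in h.
have [M [phiM ME]] := window_mass L0.
rewrite -ME lee_fin in hL.
have e2 : 0 < e / 2 by rewrite divr_gt0.
apply: filterS (filterI (approximate_identity (m_damped L) (damped0 L) phiM mA fA e2)
  (nbhs_pinfty_gt (num_real 0))).
move=> c [h c0]; have cd0 : 0 < c ^+ d by rewrite exprn_gt0.
rewrite (pair_energy_dilate c0 mA measurable_window window_ge0) EFinM.
apply: lee_wpmul2l; first by rewrite lee_fin ltW.
apply: le_trans (le_trans _ h) _; last first.
- apply: pair_energy_le => //.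
  + by apply: measurable_funM => //; exact: (measurableT_comp (m_damped L) (measurable_scaled_diff c)).
  + by apply: measurable_funM => //; exact: (measurableT_comp measurable_window (measurable_scaled_diff c)).
  + by move=> z; rewrite mulr_ge0// ltW.
  + move=> z; rewrite ler_wpM2l ?(ltW cd0)// ler_piMl ?window_ge0// damp_le1 ?invr_gt0//.
rewrite lee_fin -/a.
have : (b - e / (2 * (a + 1))) * a <= M * a by rewrite ler_wpM2r.
have : e / (2 * (a + 1)) * a <= e / 2.
  have a1 : a + 1 != 0 by rewrite gt_eqF// ltr_wpDl.
  have -> : e / 2 = e / (2 * (a + 1)) * (a + 1) by field.
  by rewrite ler_wpM2l ?(ltW e1)// lerDl.
lra.
Qed.

Lemma kernel_energy (A : set Rd) (mA : measurable A) (A_fin : (mu A < +oo)%E) :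
  (\int[mu]_y \int[mu]_z (\1_A y * normc (ker mE E1 mA mB A_fin B_fin y z) ^+ 2)%:E =
   pair_energy A (fun z => window (sdiff 1 z.1 z.2)))%E.
Proof.
apply: eq_integral => y _; apply: eq_integral => z _; congr (_%:E).
rewrite kerE normc_chi exprMn normc_kernel.
by rewrite -[\1_A z ^+ 2]/(\1_A z * \1_A z) ind_idem mulrA.
Qed.

End window.

End hilbert_schmidt_lower_bound.

(** * From trace estimates to the trace of f *)

Section spectral_trace.
Context {R : realType}.

Lemma normcD_le (x y : R[i]) : normc (x + y) <= normc x + normc y.
Proof. exact: le_normcD. Qed.

Lemma normcB_le (x y : R[i]) : normc (x - y) <= normc x + normc y.
Proof. by rewrite -[normc y](normcN y); exact: normcD_le. Qed.

(** Near 1 continuity is used; at distance at least s from 1, the linear bound [(C + F) * t] is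
    absorbed by [K * (t * (1 - t))] with K = (C + F) / s. *)
Lemma near_one_bound (f : R -> R[i]) (C e : R) :
  (f : R -> R[i]^o) x @[x --> within `[0, 1] (nbhs (1 : R))] --> (f 1 : R[i]^o) ->
  0 < C -> (forall t, 0 <= t <= 1 -> normc (f t) <= C * t) -> 0 < e ->
  exists K : R, 0 <= K /\ forall t, 0 <= t <= 1 ->
    normc (f t - t%:C * f 1) <= e * t + K * (t * (1 - t)).
Proof.
move=> cf C0 fC e0; set F := normc (f 1).
have F0 : 0 <= F := normc_ge0 _.
have gC t : 0 <= t <= 1 -> normc (f t - t%:C * f 1) <= (C + F) * t.
  move=> t01; have /andP[t0 _] := t01; apply: le_trans (normcB_le _ _) _.
  by rewrite ComplexField.Normc.normcM normc_real ger0_norm// mulrDl [F * t]mulrC lerD// fC.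
have e4 : 0 < e / 4 by rewrite divr_gt0.
have [r r0 Hr] : exists2 r : R, 0 < r & forall t, 0 <= t <= 1 -> 1 - t < r -> normc (f t - f 1) <= e / 4.
  have e4C : 0 < (e / 4)%:C by rewrite ltcR.
  move/cvgrPdist_lt : cf => /(_ _ e4C); rewrite near_withinE => /nbhs_normP[r /= r0 Hr].
  exists r => // t t01 tr; have /andP[t0 t1] := t01.
  have : `|f 1 - f t| < (e / 4)%:C.
    by apply: Hr; rewrite /= ?in_itv//= ger0_norm// subr_ge0.
  have -> : normc (f t - f 1) = normc (f 1 - f t) by rewrite -opprB normcN.
  by rewrite normc_def ltcR => /ltW; case: (f 1 - f t).
(* For 1 - t < s, the bound r gives |f t - f 1| <= e/4, the last bound gives (1 - t) |f 1| <= e/4,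
   and s <= 1/2 gives e/2 <= e t. *)
pose s := Num.min r (Num.min (2^-1) (e / (4 * (F + 1)))).
have s0 : 0 < s by rewrite !lt_min r0 invr_gt0 ltr0n divr_gt0// mulr_gt0// ltr_wpDl.
exists ((C + F) / s); split; first by rewrite divr_ge0 ?addr_ge0// ltW.
move=> t t01; have /andP[t0 t1] := t01.
have [ts|ts] := ltP (1 - t) s; last first.
  apply: le_trans (gC t t01) _; rewrite -[leLHS]add0r lerD ?mulr_ge0 ?(ltW e0)//.
  rewrite -mulrA ler_wpM2l ?addr_ge0 ?(ltW C0)// mulrCA ler_peMr//.
  by rewrite mulrC ler_pdivlMr// mul1r.
rewrite -[leLHS]addr0 lerD//; last first.
  apply: mulr_ge0; first by rewrite divr_ge0 ?addr_ge0 ?(ltW s0) ?(ltW C0).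
  by rewrite mulr_ge0 ?subr_ge0.
have [sr s2 sF] : [/\ s <= r, s <= 2^-1 & s <= e / (4 * (F + 1))].
  by split; rewrite /s !ge_min lexx ?orbT.
have -> : f t - t%:C * f 1 = (f t - f 1) + (1 - t)%:C * f 1.
  by rewrite rmorphB mulrBl mul1r addrA subrK.
apply: le_trans (normcD_le _ _) _.
rewrite ComplexField.Normc.normcM normc_real ger0_norm ?subr_ge0// -/F.
have h1 := Hr t t01 (lt_le_trans ts sr).
have h2 : (1 - t) * F <= e / 4.
  apply: (@le_trans _ _ (e / (4 * (F + 1)) * F)).
    by rewrite ler_wpM2r// (le_trans (ltW ts)).
  have F1 : F + 1 != 0 by rewrite gt_eqF// ltr_wpDl.
  have -> : e / 4 = e / (4 * (F + 1)) * (F + 1) by field.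
  by rewrite ler_wpM2l ?lerDl// divr_ge0 ?(ltW e0)// mulr_ge0// addr_ge0.
have h3 : 2^-1 <= t by lra.
apply: (@le_trans _ _ (e / 2)); first by lra.
by rewrite ler_wpM2l// ltW.
Qed.

Lemma cvg_series_le (g l : nat -> R) (C S : R) : 0 <= C ->
  (forall n, \sum_(i < n) l i <= S) -> (forall n, 0 <= g n) -> (forall n, g n <= C * l n) ->
  cvgn (series g).
Proof.
move=> C0 lS g0 gC; apply: nondecreasing_is_cvgn.
  by apply/nondecreasing_seqP => n; rewrite /series/= big_nat_recr//= lerDl.
exists (C * S) => _ [n _ <-]; rewrite /series/= big_mkord.
apply: (@le_trans _ _ (\sum_(i < n) C * l i)); first exact: ler_sum.
by rewrite -mulr_sumr ler_wpM2l.
Qed.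

(** With p and q the n-th partial sums of l and l^2, one has q <= p <= S and S <= q + eta + l_n S.
    So S - p and p - q are both at most eta + l_n S, which bounds the n-th partial sum of the trace;
    finally l_n tends to 0. *)
Lemma spectral_trace_bound (f : R -> R[i]) (C e K S eta : R) (l : nat -> R) :
  (forall t, 0 <= t <= 1 -> normc (f t) <= C * t) ->
  (forall t, 0 <= t <= 1 -> normc (f t - t%:C * f 1) <= e * t + K * (t * (1 - t))) ->
  0 < C -> 0 <= e -> 0 <= K ->
  (forall n, 0 <= l n <= 1) -> nonincreasing_seq l ->
  (forall n, \sum_(i < n) l i <= S) ->
  (forall n, S - eta <= l n * S + \sum_(i < n) l i ^+ 2) ->
  normc (cseries (fun n => f (l n)) - S%:C * f 1) <= e * S + (K + normc (f 1)) * eta.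
Proof.
move=> fC fg C0 e0 K0 l01 ld lS lH; set F := normc (f 1).
have F0 : 0 <= F := normc_ge0 _.
have l0 n : 0 <= l n by case/andP: (l01 n).
have S0 : 0 <= S by have := lS 0%N; rewrite big_ord0.
have bnd g := cvg_series_le (g := g) (ltW C0) lS.
have cRe : cvgn (series (fun n => complex.Re (f (l n)))).
  apply: normed_cvg; apply: bnd => n //=.
  by apply: le_trans (normr_Re _) _; exact: fC.
have cIm : cvgn (series (fun n => complex.Im (f (l n)))).
  apply: normed_cvg; apply: bnd => n //=.
  by apply: le_trans (normr_Im _) _; exact: fC.
pose s n := \sum_(i < n) f (l i).
have sRe : (fun n => complex.Re (s n)) = series (fun n => complex.Re (f (l n))).
  by apply/funext => n; rewrite /series/= big_mkord /s (big_morph _ (@ReD R) (erefl : complex.Re 0 = 0)).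
have sIm : (fun n => complex.Im (s n)) = series (fun n => complex.Im (f (l n))).
  by apply/funext => n; rewrite /series/= big_mkord /s (big_morph _ (@ImD R) (erefl : complex.Im 0 = 0)).
(* The limit is taken for squared moduli, which are polynomial in the real and imaginary parts; the
   squares are removed at the end. *)
have L : normc (S%:C * f 1 - s n) ^+ 2 @[n --> \oo] -->
    normc (S%:C * f 1 - cseries (fun n => f (l n))) ^+ 2.
  by rewrite /cseries -sRe -sIm; apply: sqr_normcB_cvg; rewrite ?sRe ?sIm.
set X := e * S + (K + F) * eta.
pose Y n := e * S + (K + F) * (eta + l n * S).
have lc : l @ \oo --> (0 : R) := nonincreasing_summable_cvg0 l0 ld lS.
have YX : Y n @[n --> \oo] --> X.
  apply: cvgD; first exact: cvg_cst.
  apply: cvgM; first exact: cvg_cst.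
  rewrite -[X in _ --> X]addr0; apply: cvgD; first exact: cvg_cst.
  by rewrite -[X in _ --> X](mul0r S); apply: cvgM => //; exact: cvg_cst.
have sY n : normc (S%:C * f 1 - s n) <= Y n.
  pose q := \sum_(i < n) l i ^+ 2; pose p := \sum_(i < n) l i.
  have qp : q <= p.
    apply: ler_sum => i _; have /andP[a b] := l01 i.
    by rewrite expr2 ler_piMl.
  have hq := lH n; have hp := lS n; rewrite -/q -/p in hq hp.
  (* Comparison with the linear function t f(1): its sum is p f(1), and the deviations are
     controlled termwise by [fg]. *)
  have -> : S%:C * f 1 - s n = (S - p)%:C * f 1 - \sum_(i < n) (f (l i) - (l i)%:C * f 1).
    rewrite sumrB -mulr_suml -rmorph_sum rmorphB mulrBl -/p -/(s n) /=.
    by rewrite opprB addrA subrK.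
  apply: le_trans (normcB_le _ _) _.
  rewrite ComplexField.Normc.normcM normc_real ger0_norm ?subr_ge0// -/F.
  have h1 : normc (\sum_(i < n) (f (l i) - (l i)%:C * f 1)) <= e * p + K * (p - q).
    apply: (@le_trans _ _ (\sum_(i < n) normc (f (l i) - (l i)%:C * f 1))).
      elim/big_ind2 : _ => [|x1 x2 y1 y2 h1 h2|//]; first by rewrite ComplexField.Normc.normc0.
      exact: le_trans (normcD_le _ _) (lerD h1 h2).
    rewrite /p /q -sumrB !mulr_sumr -big_split/=; apply: ler_sum => i _.
    by apply: le_trans (fg _ (l01 i)) _; rewrite mulrBr mulr1 expr2.
  have h2 : (S - p) * F <= (eta + l n * S) * F by rewrite ler_wpM2r//; lra.
  have h3 : K * (p - q) <= K * (eta + l n * S) by rewrite ler_wpM2l//; lra.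
  have h4 : e * p <= e * S by rewrite ler_wpM2l.
  rewrite /Y; lra.
have Y0 n : 0 <= Y n := le_trans (normc_ge0 _) (sY n).
have X0 : 0 <= X by apply: (cvgr_to_ge YX); exact: nearW.
have : normc (S%:C * f 1 - cseries (fun n => f (l n))) ^+ 2 <= X ^+ 2.
  apply: (ler_cvg_to L (cvgM YX YX)); apply: nearW => n.
  change (normc (S%:C * f 1 - s n) ^+ 2 <= Y n * Y n).
  by rewrite -expr2 ler_sqr ?nnegrE ?normc_ge0.
by rewrite ler_sqr ?nnegrE ?normc_ge0// -opprB normcN.
Qed.

End spectral_trace.

(** * Eigenvalues of the concentration operator *)

Section eigenvalue_sequence.
Context {R : realType}.
Variable d : nat.
Local Notation Rd := (@Rd R d).
Local Notation mu := (@lebs R d).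
Local Notation mE := (@cmeas_wave_kernel R d).
Local Notation E1 := (@normc_wave_kernel R d).
Local Notation K := (@wave_kernel R d).

(** [xget] makes an arbitrary choice, but value counts determine the sequence, so any sequence with
    the right multiplicities is the chosen one. *)
Lemma eigenvalues_unique (T : (Rd -> R[i]) -> (Rd -> R[i])) (l : nat -> R) :
  eigenvalue_seq T l -> eigenvalues T = l.
Proof.
move=> hl; apply: xget_subset1 => // l1 l2 [p1 d1 c1] [p2 d2 c2].
apply: same_positive_counts_eq => // m k m0.
exact: (iff_trans (iff_sym (c1 m k m0)) (c2 m k m0)).
Qed.

Lemma L2_sqint (g : Rd -> R[i]) : L2 g <-> sqint mu g.
Proof.
split=> [[m1 m2 fin]|[[m1 m2] /integrableP[_ fin]]].
  split => //; apply/integrableP; split.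
    by apply/measurable_EFinP; exact: cmeas_sqr_normc.
  by under eq_integral do rewrite /= ger0_norm ?sqr_ge0//.
have E : (fun x => (normc (g x) ^+ 2)%:E) = (fun x => `|(normc (g x) ^+ 2)%:E|%E).
  by apply/funext => x; rewrite /= ger0_norm ?sqr_ge0.
by split; [exact: m1|exact: m2|rewrite E; exact: fin].
Qed.

Variables (A B : set Rd).
Hypotheses (mA : measurable A) (mB : measurable B)
  (A_fin : (mu A < +oo)%E) (B_fin : (mu B < +oo)%E).
Local Notation T := (lim_op mE E1 mA mB A_fin B_fin).
Local Notation ip := (@ip2 _ Rd R mu).

Lemma eigenfunction_approx_eigen (m : R) (u : l2 mu) :
  eigenfunction (concentration A B) m u <-> approx_eigen ip T m u.
Proof.
rewrite /approx_eigen nm2_ip2_eq0.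
have pt x : ((T u - m%:C *: u) x = 0) <-> (concentration A B u x = m%:C * u x).
  rewrite l2B l2Z lim_opE -concentrationE; split=> [/eqP|->]; last by rewrite subrr.
  by rewrite subr_eq0 => /eqP.
split=> [[_]|h]; first by apply: filterS => x /pt.
split; first by apply/L2_sqint; exact: l2_sqint.
by apply: filterS h => x /pt.
Qed.

Lemma independent_l2 k (e : 'I_k -> l2 mu) :
  independent (fun i => e i : Rd -> R[i]) <->
  forall c : 'I_k -> R[i], nm2 ip (\sum_(i < k) c i *: e i) = 0 -> forall i, c i = 0.
Proof.
have pt c x : (\sum_(i < k) c i *: e i) x = \sum_(i < k) c i * e i x.
  by rewrite l2_sum; apply: eq_bigr => i _; rewrite l2Z.
split=> h c; [rewrite nm2_ip2_eq0|] => hc; apply: h.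
  by apply: filterS hc => x; rewrite pt.
by rewrite nm2_ip2_eq0; apply: filterS hc => x; rewrite pt.
Qed.

Lemma multiplicity_geE (m : R) k : multiplicity_ge (concentration A B) m k <->
  exists E0 : 'I_k -> l2 mu, (forall i, approx_eigen ip T m (E0 i)) /\
    forall c : 'I_k -> R[i], nm2 ip (\sum_(i < k) c i *: E0 i) = 0 -> forall i, c i = 0.
Proof.
split=> [[e [he ie]]|[E0 [he ie]]]; last first.
  exists (fun i => E0 i : Rd -> R[i]); split; last exact: (iffRL (independent_l2 E0) ie).
  move=> i; exact: (iffRL (eigenfunction_approx_eigen m (E0 i)) (he i)).
have se i : sqint mu (e i) by apply/L2_sqint; case: (he i).
exists (fun i => L2fun (se i)); split; last exact: (iffLR (independent_l2 (fun i => L2fun (se i))) ie).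
move=> i; exact: (iffLR (eigenfunction_approx_eigen m (L2fun (se i))) (he i)).
Qed.

Lemma concentration_eigenvalues (l := eigenvalues (concentration A B)) :
  [/\ forall n, 0 <= l n <= 1, nonincreasing_seq l,
      forall n, \sum_(i < n) l i <= fine (mu A) * fine (mu B) &
      forall n, (\int[mu]_y \int[mu]_z
          (\1_A y * normc (ker mE E1 mA mB A_fin B_fin y z) ^+ 2)%:E <=
        (l n * (fine (mu A) * fine (mu B)) + \sum_(i < n) l i ^+ 2)%:E)%E].
Proof.
have [l' [[l0 ld] lm ls lh lu]] := limited_spectrum mE E1 mA mB A_fin B_fin.
have El : l = l'.
  apply: eigenvalues_unique; split => // m k m0.
  by rewrite multiplicity_geE; exact: lm.
rewrite El; split => // n; rewrite l0 /=.
have [l1|l1] := leP (l' n) 0; first exact: le_trans l1 ler01.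
(* A positive eigenvalue is N(band u) for a unit vector u, and Bessel's inequality bounds it by
   1. *)
have [u [u1 <-]] := lu n l1; rewrite -u1; exact: nm2_band_le_nm2.
Qed.

End eigenvalue_sequence.

(** * Asymptotics of the trace *)

Section trace_asymptotics.
Context {R : realType}.
Variable d : nat.
Local Notation Rd := (@Rd R d).
Local Notation mu := (@lebs R d).

Variables (A B : set Rd) (f : R -> R[i]) (C : R).
Hypotheses (mA : measurable A) (mB : measurable B)
  (A_fin : (mu A < +oo)%E) (B_fin : (mu B < +oo)%E) (C0 : 0 < C)
  (fC : forall t, 0 <= t <= 1 -> normc (f t) <= C * t).

Let S := fine (mu A) * fine (mu B).

Let S0 : 0 <= S.
Proof. by rewrite mulr_ge0// fine_ge0. Qed.

Let dilate_fin c : 0 < c -> (mu (dilate c A) < +oo)%E.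
Proof.
move=> c0; rewrite (lebs_dilate A c0) lte_mul_pinfty// ?lee_fin ?exprn_ge0 ?(ltW c0)//.
Qed.

Let fine_dilate c : 0 < c -> fine (mu (dilate c A)) * fine (mu B) = c ^+ d * S.
Proof.
move=> c0; have cd0 : 0 <= c ^+ d by rewrite exprn_ge0// ltW.
by rewrite (lebs_dilate A c0) fineM// ?mulrA// ge0_fin_numE.
Qed.

Lemma abs_summable_dilate c : 0 < c ->
  abs_summable (fun n => f (eigenvalues (concentration (dilate c A) B) n)).
Proof.
move=> c0; have [l01 ld ls _] := concentration_eigenvalues (measurable_dilate c0 mA) mB (dilate_fin c0) B_fin.
apply: (cvg_series_le (ltW C0) ls) => n; first exact: normc_ge0.
exact: fC.
Qed.

(** [spectral_trace_bound] is used with total mass c^d S and defect c^d eta, both proportional to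
    c^d; after division the bound no longer depends on c. *)
Lemma trace_dilate_near (e K eta : R) : 0 <= e -> 0 <= K -> 0 < eta ->
  (forall t, 0 <= t <= 1 -> normc (f t - t%:C * f 1) <= e * t + K * (t * (1 - t))) ->
  \forall c \near +oo,
    normc (trace_fun f (concentration (dilate c A) B) - (c ^+ d * S)%:C * f 1) / c ^+ d <=
    e * S + (K + normc (f 1)) * eta.
Proof.
move=> e0 K0 eta0 fg.
apply: filterS (filterI (energy_lower mB B_fin mA A_fin eta0) (nbhs_pinfty_gt (num_real 0))).
move=> c [h c0]; have cd0 : 0 < c ^+ d by rewrite exprn_gt0.
have mD := measurable_dilate c0 mA; have fD := dilate_fin c0.
have [l01 ld ls lh] := concentration_eigenvalues mD mB fD B_fin.
rewrite -(kernel_energy mB B_fin mD fD) in h.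
have lS n : \sum_(i < n) eigenvalues (concentration (dilate c A) B) i <= c ^+ d * S.
  by rewrite -(fine_dilate c0); exact: ls.
have lH n : c ^+ d * S - c ^+ d * eta <=
    eigenvalues (concentration (dilate c A) B) n * (c ^+ d * S) +
    \sum_(i < n) eigenvalues (concentration (dilate c A) B) i ^+ 2.
  by have := le_trans h (lh n); rewrite lee_fin (fine_dilate c0) -/S mulrBr.
rewrite ler_pdivrMr//; apply: le_trans (spectral_trace_bound fC fg C0 e0 K0 l01 ld lS lH) _.
by rewrite le_eqVlt; apply/orP; left; apply/eqP; ring.
Qed.

End trace_asymptotics.

Theorem theorem1p16 (R : realType) (d : nat) (hd : (0 < d)%N)
    (A B : set (@Rd R d)) (f : R -> R[i]) (C : R) :
  measurable A -> measurable B ->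
  (leb d A < +oo)%E -> (leb d B < +oo)%E ->
  (f : R -> R[i]^o) x @[x --> within `[0, 1] (nbhs (1 : R))] --> (f 1 : R[i]^o) ->
  0 < C ->
  (forall t, 0 <= t <= 1 -> normc (f t) <= C * t) ->
  (forall c, 0 < c ->
     abs_summable (fun n => f (eigenvalues (concentration (dilate c A) B) n))) /\
  (normc (trace_fun f (concentration (dilate c A) B)
     - (c ^+ d * fine (leb d A) * fine (leb d B))%:C * f 1) / c ^+ d)
    @[c --> +oo] --> (0 : R).
Proof.
move=> mA mB A_fin B_fin cf C0 fC; split.
  by move=> c c0; exact: (abs_summable_dilate mA mB A_fin B_fin C0 fC c0).
set S := fine (lebs d A) * fine (lebs d B).
have S0 : 0 <= S by rewrite mulr_ge0// fine_ge0.
apply/cvgr0Pnorm_le => r r0.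
(* The two error terms, with coefficients S and K + |f 1|, get r/2 each; the summand 1 in the
   denominators covers vanishing coefficients. K depends on the first choice, so [eta] is fixed
   after it. *)
have e0 : 0 < r / (2 * (S + 1)) by rewrite divr_gt0// mulr_gt0// ltr_wpDl.
have [K [K0 fg]] := near_one_bound cf C0 fC e0.
have KF0 : 0 <= K + normc (f 1) by rewrite addr_ge0// normc_ge0.
have eta0 : 0 < r / (2 * (K + normc (f 1) + 1)) by rewrite divr_gt0// mulr_gt0// ltr_wpDl.
apply: filterS (filterI (trace_dilate_near mA mB A_fin B_fin C0 fC (ltW e0) K0 eta0 fg)
  (nbhs_pinfty_gt (num_real 0))).
move=> c [h c0].
rewrite ger0_norm; last by rewrite divr_ge0 ?normc_ge0// exprn_ge0// ltW.
rewrite -mulrA; apply: le_trans h _.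
have half x : 0 <= x -> r / (2 * (x + 1)) * x <= r / 2.
  move=> x0; have x1 : x + 1 != 0 by rewrite gt_eqF// ltr_wpDl.
  have -> : r / 2 = r / (2 * (x + 1)) * (x + 1) by field.
  by rewrite ler_wpM2l ?lerDl// divr_ge0 ?(ltW r0)// mulr_ge0// addr_ge0.
have h1 := half _ S0; have h2 := half _ KF0; rewrite mulrC in h2; rewrite -/S.
by rewrite [leRHS]splitr; apply: lerD.
Qed.
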